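(* Assume $1\le\sigma'<p_0\le\beta$, $H^1_{ato}\hookrightarrow L^1$ (continuous embedding) and $\mu(X)=\infty$. Let $T$ be an $L^{p_0}$-bounded sublinear operator, and suppose there are coefficients $(\gamma_j)_{j\ge0}$ with $\sum_{j\ge0}\gamma_j<\infty$ such that for all balls $Q$, all functions $f$ supported in $Q$ and all $j\ge0$, $$\Big(\frac{1}{\mu(2^{j+1}Q)}\int_{S_j(Q)}|T(B_Q(f))|^{p_0}d\mu\Big)^{1/p_0}\le\gamma_j\frac{\mu(Q)}{\mu(2^jQ)}\Big(\frac1{\mu(Q)}\int_Q|f|^\beta d\mu\Big)^{1/\beta}$$ and $$\Big(\frac{1}{\mu(2^{j+1}Q)}\int_{S_j(Q)}|f-B_Q(f)|^{\beta}d\mu\Big)^{1/\beta}\le\gamma_j\frac{\mu(Q)}{\mu(2^jQ)}\Big(\frac1{\mu(Q)}\int_Q|f|^{\sigma'}d\mu\Big)^{1/\sigma'}.$$ Then for all exponents $p\in(\sigma',p_0)$ there exists a constant $C=C(p)$ such that $$\|T(f)\|_{L^p}\le C\|f\|_{L^p}\qquad\text{for all } f\in L^{p_0}\cap L^p.$$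
   Context: Setting. $(X,d,\mu)$ is a space of homogeneous type: $d$ is a quasi-distance on $X$ and $\mu$ is a Borel measure for which there are $A,\delta>0$ with $\mu(B(x,\tau r))\le A\tau^\delta\mu(B(x,r))$ for all $x\in X$, $r>0$, $\tau\ge1$, where $B(x,r)$ is the open ball. Functions are real valued, $L^p=L^p(X,\mu)$, $p'$ is the conjugate exponent (with $1/\infty=0$). For a ball $Q$ with centre $c(Q)$ and radius $r_Q$, $\lambda Q=B(c(Q),\lambda r_Q)$ and $S_i(Q)=\{x: 2^i\le 1+d(x,c(Q))/r_Q<2^{i+1}\}$, $i\ge0$. Normalized $L^\beta$ averages with $\beta=\infty$ are read as essential suprema. Hardy space. $\beta\in(1,\infty]$ is fixed and $\mathbb B=(B_Q)_Q$ is a collection, indexed by all balls $Q$ of $X$, of linear operators on $L^\beta$, uniformly bounded: $\|B_Q f\|_{L^\beta}\le A'\|f\|_{L^\beta}$. An atom associated to $Q$ is a function $m=B_Q(f_Q)$ with $\operatorname{supp} f_Q\subset Q$ and $\|f_Q\|_{L^\beta}\le\mu(Q)^{-1/\beta'}$. $H^1_{ato}$ is the set of measurable $h$ with $h=\sum_{i\in\mathbb N}\lambda_im_i$ $\mu$-a.e., $m_i$ atoms, $\lambda_i\in\mathbb R$, $\sum|\lambda_i|<\infty$, with norm the infimum of $\sum|\lambda_i|$ over such decompositions.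
   Formalization: The exponent p_0 is taken to be finite; in the endpoint case p_0 = β = ∞ the claim fails, e.g. for T(f) = φ(f)·1 with φ a functional on L^∞ that vanishes on compactly supported functions but not on L^p ∩ L^∞. *)

(* Defs.v *)
From HB Require Import structures.
From mathcomp Require Import all_boot all_order all_algebra.
From mathcomp Require Import all_classical all_reals all_analysis.

Set Implicit Arguments.
Unset Strict Implicit.
Unset Printing Implicit Defensive.

Import Order.TTheory GRing.Theory Num.Theory.
Import numFieldNormedType.Exports.

Local Open Scope classical_set_scope.
Local Open Scope ring_scope.

Definition quasi_distance (R : realType) (X : Type) (d : X -> X -> R) : Prop :=
  [/\ forall x y, 0 <= d x y,
      forall x y, d x y = 0 <-> x = y,
      forall x y, d x y = d y x &
      exists K : R, forall x y z, d x z <= K * (d x y + d y z)].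

(* A ball carries its centre and its (positive) radius: the same set of points
   may arise from several balls. *)
Record ball_of (R : realType) (X : Type) := Ball {
  center : X ;
  radius : R ;
  radius_gt0 : 0 < radius }.

Definition open_ball (R : realType) (X : Type) (d : X -> X -> R)
  (x : X) (r : R) : set X := [set y | d x y < r].

Definition dilate (R : realType) (X : Type) (d : X -> X -> R)
  (l : R) (Q : ball_of R X) : set X := open_ball d (center Q) (l * radius Q).

Definition ball_set (R : realType) (X : Type) (d : X -> X -> R)
  (Q : ball_of R X) : set X := open_ball d (center Q) (radius Q).

Definition corona (R : realType) (X : Type) (d : X -> X -> R)
    (i : nat) (Q : ball_of R X) : set X :=
  [set x | 2 ^+ i <= 1 + d x (center Q) / radius Q < 2 ^+ i.+1].

Definition quasi_open (R : realType) (X : Type) (d : X -> X -> R) (U : set X) :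
    Prop :=
  forall x, U x -> exists2 r : R, 0 < r & open_ball d x r `<=` U.

(* Balls of a quasi-distance need not be open, whence the separate requirement
   that they be Borel. As usual for a doubling measure, balls have positive and
   finite measure. *)
Record homogeneous_space (R : realType) (dX : measure_display)
    (X : measurableType dX) (d : X -> X -> R)
    (mu : {measure set X -> \bar R}) : Prop := {
  hs_quasi_distance : quasi_distance d ;
  hs_borel : @measurable dX X = <<s [set U | quasi_open d U] >> ;
  hs_ball_measurable : forall x r, measurable (open_ball d x r) ;
  hs_ball_gt0 : forall x (r : R), 0 < r -> (0 < mu (open_ball d x r))%E ;
  hs_ball_fin : forall x (r : R), 0 < r -> (mu (open_ball d x r) < +oo)%E ;
  hs_doubling : exists A delta : R, [/\ 0 < A, 0 < delta &
    forall x (r tau : R), 0 < r -> 1 <= tau ->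
      (mu (open_ball d x (tau * r)) <=
       (A * tau `^ delta)%:E * mu (open_ball d x r))%E] }.

(* (1/mu(F) \int_E |g|^q dmu)^(1/q), and the essential supremum of |g| on E when
   q = +oo; the exponents that occur are all at least 1. *)
Definition Lavg (R : realType) (dX : measure_display) (X : measurableType dX)
    (mu : {measure set X -> \bar R}) (q : \bar R) (E F : set X) (g : X -> R) :
    \bar R :=
  (match q with
   | r%:E => ((mu F)^-1 * \int[mu]_(x in E) (`|g x| `^ r)%:E) `^ r^-1
   | _ => 'N[mu]_+oo [(fun x => (g x * \1_E x)%:E)]
   end)%E.

Definition supported_in (R : realType) (dX : measure_display)
    (X : measurableType dX) (mu : {measure set X -> \bar R})
    (f : X -> R) (E : set X) : Prop :=
  \forall x \ae mu, ~ E x -> f x = 0.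

(* An operator on L^q is given by its action on representatives; only its values
   on L^q matter, and those up to equality almost everywhere. *)
Definition bounded_by (R : realType) (dX : measure_display)
    (X : measurableType dX) (mu : {measure set X -> \bar R}) (q : \bar R)
    (C : R) (T : (X -> R) -> X -> R) : Prop :=
  forall f, f \in Lfun mu q -> T f \in Lfun mu q /\
    ('N[mu]_q [EFin \o T f] <= C%:E * 'N[mu]_q [EFin \o f])%E.

Definition linear_op (R : realType) (dX : measure_display)
    (X : measurableType dX) (mu : {measure set X -> \bar R}) (q : \bar R)
    (T : (X -> R) -> X -> R) : Prop :=
  forall (a : R) (f g : X -> R), f \in Lfun mu q -> g \in Lfun mu q ->
    \forall x \ae mu, T (fun y => a * f y + g y) x = a * T f x + T g x.

Definition sublinear_op (R : realType) (dX : measure_display)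
    (X : measurableType dX) (mu : {measure set X -> \bar R}) (q : \bar R)
    (T : (X -> R) -> X -> R) : Prop :=
  (forall f g : X -> R, f \in Lfun mu q -> g \in Lfun mu q ->
     \forall x \ae mu, `|T (fun y => f y + g y) x| <= `|T f x| + `|T g x|) /\
  (forall (a : R) (f : X -> R), f \in Lfun mu q ->
     \forall x \ae mu, `|T (fun y => a * f y) x| = `|a| * `|T f x|).

Section hardy.
Context (R : realType) (dX : measure_display) (X : measurableType dX).
Context (d : X -> X -> R) (mu : {measure set X -> \bar R}) (beta : \bar R).
Context (B : ball_of R X -> (X -> R) -> X -> R).

Definition uniformly_bounded_family : Prop :=
  (forall Q, linear_op mu beta (B Q)) /\
  exists A' : R, forall Q, bounded_by mu beta A' (B Q).

Definition atom_of (Q : ball_of R X) (m : X -> R) : Prop :=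
  exists f : X -> R, [/\ f \in Lfun mu beta,
    supported_in mu f (ball_set d Q),
    ('N[mu]_beta [EFin \o f] <=
       mu (ball_set d Q) `^ (- fine (hoelder_conjugate beta)^-1))%E &
    m = B Q f].

Definition is_atom (m : X -> R) : Prop := exists Q, atom_of Q m.

Definition atomic_decomposition (h : X -> R) (l : nat -> R)
    (m : nat -> X -> R) : Prop :=
  [/\ forall i, is_atom (m i),
      (\sum_(0 <= i <oo) `|l i|%:E < +oo)%E &
      \forall x \ae mu, series (fun i => l i * m i x) @ \oo --> h x].

Definition H1ato : set (X -> R) :=
  [set h | measurable_fun [set: X] h /\
    exists l m, atomic_decomposition h l m].

Definition H1ato_norm (h : X -> R) : \bar R :=
  ereal_inf [set s | exists l m, atomic_decomposition h l m /\
    s = (\sum_(0 <= i <oo) `|l i|%:E)%E].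

Definition H1ato_embeds_L1 : Prop :=
  exists C : R, forall h, H1ato h -> h \in Lfun mu 1%E /\
    ('N[mu]_1 [EFin \o h] <= C%:E * H1ato_norm h)%E.

End hardy.

(* Main.v *)
Require Import Defs.
From HB Require Import structures.
From mathcomp Require Import all_boot all_order all_algebra.
From mathcomp Require Import all_classical all_reals all_analysis.
From mathcomp Require Import measurable_realfun ess_sup_inf ring lra.

Import Order.TTheory GRing.Theory Num.Theory.
Import numFieldNormedType.Exports.

Local Open Scope classical_set_scope.
Local Open Scope ring_scope.

Set Implicit Arguments.
Unset Strict Implicit.
Unset Printing Implicit Defensive.

(** Fix a weight [v]. The seminorm [N g], the integral of [|T g| |v|], is
    bounded on [L^p0]. By Hahn-Banach there is a linear functional [l <= N] on
    [L^p0] with [l f = N f] for the function [f] under consideration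
    ([exists_adjoint]). It plays the part of the adjoint of [T] applied to [v],
    although [T] is not linear, and by [converse_hoelder] it is enough to bound
    [l f] by a constant times the product of the norms of [f] in [L^p] and of
    [v] in [L^q], [q] being conjugate to [p].

    If [l] were integration against a function [h], one would estimate a maximal
    function of [h] in [L^q] by a good-lambda inequality, whose input is the
    following. For [g] carried by a ball [Q], write [g = B_Q g + (g - B_Q g)].
    The first term is paired with [v]: by the first decay hypothesis [l (B_Q g)
    <= N (B_Q g)] is at most a constant times the volume of [Q] times the
    largest average of [v] over the dilates of [Q]. On each corona of [Q] the
    second term is a multiple of a normalized function of a dilate of [Q], and
    by the second decay hypothesis the multiples are summable and controlled by
    the [L^s1] average of [g] only, [s1] being conjugate to [sigma]
    ([adjoint_test]). If [g] is made of functions on small balls that fill a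
    proportion [tau] of [Q], that average is at most [tau ^ (1 / s)], for a
    fixed [s > 1] with [s1 <= s < p]. So the balls on which [l] is large at
    level [K lam] fill little of a ball with no dilate on which [l] is large at
    level [lam], unless [v] is large nearby ([good_ball], [good_lambda]). The
    gain is a power of [K] with exponent the conjugate of [s], larger than [q]
    since [s < p], so that for large [K] the inequality can be summed over the
    levels. The sums are finite to begin with, because the bound on [L^p0] gives
    a weak type estimate of order [a < q], the conjugate of [p0]
    ([level_mass_sum]).

    This is carried out without [h]: one tests [l] on normalized functions
    carried by balls ([large]), and in place of the measure of a level set one
    takes the total volume of finite families of disjoint balls
    ([packing_mass]), which avoids all questions of measurability. Infinite
    total measure guarantees that every ball has a last dilate on which [l] is
    large.

    Finally [f] is cut into its level sets. Outer regularity and Vitali's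
    covering argument cover each of them by balls of about the same total volume
    ([cover_measurable]); a ball contributes at most the height of [f] times the
    volume times the largest level at which [l] is large there, and the
    resulting double sum over heights and levels is controlled as in Young's
    inequality ([adjoint_le]). *)

(** * A dominated linear functional *)

Section dominated_linear_functional.
Context (R : realType) (V : lmodType R).
Implicit Types (q N : V -> R) (f u v : V).

Definition sublinear_fun q :=
  (forall u v, q (u + v) <= q u + q v) /\
  (forall t u, 0 < t -> q (t *: u) <= t * q u).

Lemma sublinear_fun0 q : sublinear_fun q -> q 0 = 0.
Proof.
move=> [_ qZ]; have := qZ 2 0 (ltr0Sn _ _); have := qZ 2^-1 0.
by rewrite !scaler0 invr_gt0 ltr0n => /(_ isT); lra.
Qed.

Lemma sublinear_funZ q t u : sublinear_fun q -> 0 <= t ->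
  q (t *: u) = t * q u.
Proof.
move=> hq; rewrite le_eqVlt => /predU1P[<-|t0].
  by rewrite scale0r mul0r sublinear_fun0.
apply/eqP; rewrite eq_le hq.2//=.
have := hq.2 t^-1 (t *: u); rewrite invr_gt0 => /(_ t0).
by rewrite scalerA mulVf ?gt_eqF// scale1r ler_pdivlMl.
Qed.

Lemma sublinear_funN q u : sublinear_fun q -> - q (- u) <= q u.
Proof. by move=> hq; have := hq.1 u (- u); rewrite subrr sublinear_fun0//; lra. Qed.

(** The largest sublinear minorant of [q] whose value at [- y] is at most
    [- q y]: the supporting functional is squeezed along the direction [y]. *)
Definition squeeze q y u : R :=
  inf [set q (u + t *: y) - t * q y | t in [set t : R | 0 <= t]].

Lemma squeeze_has_inf q y u : sublinear_fun q ->
  has_inf [set q (u + t *: y) - t * q y | t in [set t : R | 0 <= t]].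
Proof.
move=> hq; split; first by exists (q (u + 0 *: y) - 0 * q y), 0 => /=.
exists (- q (- u)) => _ [t /= t0 <-].
have := hq.1 (u + t *: y) (- u).
by rewrite addrAC subrr add0r sublinear_funZ//; lra.
Qed.

Lemma squeeze_le q y u t : sublinear_fun q -> 0 <= t ->
  squeeze q y u <= q (u + t *: y) - t * q y.
Proof.
move=> hq t0; apply: ge_inf; last by exists t.
exact: (squeeze_has_inf y u hq).2.
Qed.

Lemma squeeze_ge q y u c : sublinear_fun q ->
  (forall t, 0 <= t -> c <= q (u + t *: y) - t * q y) -> c <= squeeze q y u.
Proof.
move=> hq hc; apply: lb_le_inf; first exact: (squeeze_has_inf y u hq).1.
by move=> _ [t t0 <-]; exact: hc.
Qed.

Lemma squeeze_sublinear q y : sublinear_fun q -> sublinear_fun (squeeze q y).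
Proof.
move=> hq; split=> [u v|s u s0].
  rewrite -lerBlDr; apply: squeeze_ge => // t t0.
  rewrite lerBlDr -lerBlDl; apply: squeeze_ge => // t' t'0.
  rewrite lerBlDl.
  apply: (le_trans (squeeze_le y (u + v) hq (addr_ge0 t0 t'0))).
  have := hq.1 (u + t *: y) (v + t' *: y).
  by rewrite addrACA -scalerDl; lra.
rewrite -ler_pdivrMl//; apply: squeeze_ge => // t t0.
rewrite ler_pdivrMl//.
apply: (le_trans (squeeze_le y (s *: u) hq (mulr_ge0 (ltW s0) t0))).
by have := hq.2 s (u + t *: y) s0; rewrite scalerDr scalerA; lra.
Qed.

Lemma squeeze_le_id q y u : sublinear_fun q -> squeeze q y u <= q u.
Proof.
move=> hq; have := squeeze_le y u hq (lexx 0).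
by rewrite scale0r addr0 mul0r subr0.
Qed.

Lemma squeeze_opp q y : sublinear_fun q -> squeeze q y (- y) <= - q y.
Proof.
move=> hq; have := squeeze_le y (- y) hq ler01.
by rewrite scale1r addNr sublinear_fun0// mul1r sub0r.
Qed.

(** A minimal sublinear functional coincides with all its squeezings, hence it
    is additive; Zorn's lemma provides one below the squeezing of [N] along
    [f]. *)
Lemma hahn_banach_dominated N f : sublinear_fun N ->
  exists l : V -> R, [/\ forall a u v, l (a *: u + v) = a * l u + l v,
    forall u, l u <= N u & l f = N f].
Proof.
move=> hN; pose Nf := squeeze N f.
have hNf : sublinear_fun Nf by exact: squeeze_sublinear.
pose D := {q : V -> R | sublinear_fun q /\ forall u, q u <= Nf u}.
pose mkD q (h : sublinear_fun q /\ forall u, q u <= Nf u) : D := exist _ q h.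
pose q0 := mkD Nf (conj hNf (fun u => lexx (Nf u))).
pose below (q1 q2 : D) := `[< forall u, sval q2 u <= sval q1 u >].
have [||A totA|m mmax] := @ZL_preorder D q0 below.
- by move=> q; apply/asboolP.
- move=> q1 q2 q3 /asboolP h1 /asboolP h2; apply/asboolP => u.
  exact: le_trans (h2 u) (h1 u).
- have [[q1 Aq1]|A0] := pselect (exists q1 : D, A q1); last first.
    by exists q0 => q Aq; case: A0; exists q.
  pose S u := [set (sval q : V -> R) u | q in A].
  have hS u : has_inf (S u).
    split; first by exists (sval q1 u); exists q1.
    exists (- Nf (- u)) => _ [q Aq <-].
    have := sublinear_funN u (svalP q).1; have := (svalP q).2 (- u); lra.
  have qi_le (q : D) u : A q -> inf (S u) <= sval q u.
    by move=> Aq; apply: ge_inf; [exact: (hS u).2|exists q].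
  have le_qi u c : (forall q : D, A q -> c <= sval q u) -> c <= inf (S u).
    move=> hc; apply: lb_le_inf; first exact: (hS u).1.
    by move=> _ [q Aq <-]; exact: hc.
  have hqi : sublinear_fun (fun u => inf (S u)) /\ forall u, inf (S u) <= Nf u.
    split; last first.
      by move=> u; apply: (le_trans (qi_le q1 u Aq1)); exact: (svalP q1).2.
    split=> [u v|t u t0].
      rewrite -lerBlDr; apply: (le_qi) => q Aq.
      rewrite lerBlDr -lerBlDl; apply: (le_qi) => q' Aq'.
      rewrite lerBlDl.
      have [/asboolP h|/asboolP h] := totA _ _ Aq Aq'.
        apply: (le_trans (qi_le q' _ Aq')).
        have := (svalP q').1.1 u v; have := h u; lra.
      apply: (le_trans (qi_le q _ Aq)).
      have := (svalP q).1.1 u v; have := h v; lra.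
    rewrite -ler_pdivrMl//; apply: (le_qi) => q Aq; rewrite ler_pdivrMl//.
    apply: (le_trans (qi_le q _ Aq)).
    by rewrite sublinear_funZ ?(ltW t0)//; exact: (svalP q).1.
  exists (mkD _ hqi) => q Aq; apply/asboolP => u /=; exact: qi_le.
have [hl lNf] := svalP m; set l := sval m in hl lNf.
have l_squeeze y u : l u <= squeeze l y u.
  have hs : sublinear_fun (squeeze l y) /\ forall w, squeeze l y w <= Nf w.
    split=> [|w]; first exact: squeeze_sublinear.
    exact: le_trans (squeeze_le_id y w hl) (lNf w).
  suff /mmax /asboolP : below m (mkD _ hs) by apply.
  by apply/asboolP => w /=; exact: squeeze_le_id.
have lD u v : l (u + v) = l u + l v.
  apply/eqP; rewrite eq_le hl.1/=.
  have := le_trans (l_squeeze v u) (squeeze_le v u hl ler01).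
  by rewrite scale1r mul1r; lra.
have lN u : l (- u) = - l u.
  by have := lD u (- u); rewrite subrr sublinear_fun0//; lra.
have lN_le u : l u <= N u by exact: le_trans (lNf u) (squeeze_le_id f u hN).
exists l; split => //.
- move=> a u v; rewrite lD; congr (_ + _).
  have [a0|a0] := leP 0 a; first exact: sublinear_funZ.
  rewrite -[in LHS](opprK a) scaleNr lN sublinear_funZ ?mulNr ?opprK//.
  by rewrite oppr_ge0 ltW.
- apply/eqP; rewrite eq_le lN_le/=.
  have := le_trans (lNf (- f)) (squeeze_opp f hN); rewrite lN; lra.
Qed.

End dominated_linear_functional.

(** * Balls of a space of homogeneous type *)

Section balls.
Context (R : realType) (dX : measure_display) (X : measurableType dX).
Context (d : X -> X -> R) (mu : {measure set X -> \bar R}).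
Hypothesis hX : homogeneous_space d mu.
Notation qball := (ball_of R X).
Notation center := Defs.center.
Notation radius := Defs.radius.
Notation bset := (ball_set d).
Implicit Types (P Q : qball) (x y z : X) (k : nat).

HB.instance Definition _ := gen_eqMixin (ball_of R X).
HB.instance Definition _ := gen_choiceMixin (ball_of R X).

Fact dyadic_subproof k Q : 0 < 2 ^+ k * radius Q.
Proof. by rewrite mulr_gt0 ?exprn_gt0 ?radius_gt0. Qed.

Definition dyadic k Q : qball := Ball (center Q) (dyadic_subproof k Q).

Lemma ball_ext P Q : center P = center Q -> radius P = radius Q -> P = Q.
Proof.
case: P Q => [x r r0] [y s s0] /= xy rs; subst; congr Ball.
exact: bool_irrelevance.
Qed.

Lemma dyadic_dyadic k l Q : dyadic k (dyadic l Q) = dyadic (k + l) Q.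
Proof. by apply: ball_ext => //=; rewrite mulrA exprD. Qed.

Lemma dyadic0 Q : dyadic 0 Q = Q.
Proof. by apply: ball_ext => //=; rewrite mul1r. Qed.

Lemma dist0 x : d x x = 0.
Proof. by have [_ d0 _ _] := hs_quasi_distance hX; apply/d0. Qed.

Lemma distC x y : d x y = d y x.
Proof. by have [_ _ dC _] := hs_quasi_distance hX; exact: dC. Qed.

Lemma dist_ge0 x y : 0 <= d x y.
Proof. by have [d0 _ _ _] := hs_quasi_distance hX; exact: d0. Qed.

Lemma center_in Q : bset Q (center Q).
Proof. by rewrite /ball_set/open_ball/= dist0 radius_gt0. Qed.

Lemma sub_dyadic k l Q : (k <= l)%N -> bset (dyadic k Q) `<=` bset (dyadic l Q).
Proof.
move=> kl x; rewrite /ball_set/open_ball/= => /lt_le_trans; apply.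
by rewrite ler_pM2r ?radius_gt0// ler_weXn2l// ler1n.
Qed.

Lemma sub_dyadicr k Q : bset Q `<=` bset (dyadic k Q).
Proof. by rewrite -[X in bset X `<=` _]dyadic0; exact: sub_dyadic. Qed.

Lemma dyadic_cover Q x : exists k, bset (dyadic k Q) x.
Proof.
exists (Num.bound (d (center Q) x / radius Q)).
rewrite /ball_set/open_ball/= -ltr_pdivrMr ?radius_gt0//.
apply: lt_le_trans (archi_boundP _) _; first by rewrite divr_ge0 ?dist_ge0// ltW ?radius_gt0.
by rewrite -natrX ler_nat ltnW// ltn_expl.
Qed.

Definition vol Q : R := fine (mu (bset Q)).

Lemma measurable_bset Q : measurable (bset Q).
Proof. exact: (hs_ball_measurable hX). Qed.
Hint Resolve measurable_bset : core.

Lemma volE Q : mu (bset Q) = (vol Q)%:E.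
Proof.
rewrite /vol fineK// ge0_fin_numE//; apply: (hs_ball_fin hX); exact: radius_gt0.
Qed.

Lemma vol_gt0 Q : 0 < vol Q.
Proof. by rewrite -lte_fin -volE; apply: (hs_ball_gt0 hX); exact: radius_gt0. Qed.

Lemma vol_ge0 Q : 0 <= vol Q.
Proof. exact/ltW/vol_gt0. Qed.

Lemma le_vol P Q : bset P `<=` bset Q -> vol P <= vol Q.
Proof. by move=> PQ; rewrite -lee_fin -!volE le_measure ?inE. Qed.

(** Infinite total measure enters the proof here: a ball has only finitely many
    dyadic dilates below a given volume, hence a largest one. *)
Lemma vol_unbounded Q (M : R) : mu [set: X] = +oo%E ->
  exists k, M < vol (dyadic k Q).
Proof.
move=> muX; apply: contrapT => h.
have hk k : vol (dyadic k Q) <= M by rewrite leNgt; apply/negP => ?; apply: h; exists k.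
have cvgX : mu (bset (dyadic k Q)) @[k --> \oo] --> mu (\bigcup_k bset (dyadic k Q)).
  apply: nondecreasing_cvg_mu => //.
    by apply: bigcup_measurable => k _.
  by move=> k l kl; apply/subsetPset; exact: sub_dyadic.
have UX : \bigcup_k bset (dyadic k Q) = [set: X].
  by apply/seteqP; split=> // x _; have [k ?] := dyadic_cover Q x; exists k.
have : (mu [set: X] <= M%:E)%E.
  rewrite -UX -(cvg_lim _ cvgX)//; apply: lime_le.
    by apply/cvg_ex; eexists; exact: cvgX.
  by near=> k; rewrite volE lee_fin.
by rewrite muX leye_eq.
Unshelve. all: by end_near. Qed.

(** All the quasi-metric geometry that is needed: the dilation by [2 ^+ e] of a
    ball swallows every smaller ball that meets it, at a bounded cost in
    volume. *)
Record geometry (e : nat) (D : R) : Prop := {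
  geo_engulf : forall P Q, radius Q <= radius P -> bset P `&` bset Q !=set0 ->
    bset Q `<=` bset (dyadic e P) ;
  geo_volS : forall Q, vol (dyadic 1 Q) <= D * vol Q ;
  geo_vol : forall Q, vol (dyadic e Q) <= D * vol Q }.

(** By the quasi-triangle inequality with constant [K], a ball that meets a
    larger one of radius [r] stays within [K * (r + 2 * K * r)] of its centre. *)
Lemma exists_geometry : exists e D, 1 <= D /\ geometry e D.
Proof.
have [_ _ _ [K0 hK0]] := hs_quasi_distance hX.
pose K := Num.max K0 1.
have K1 : 1 <= K by rewrite le_max lexx orbT.
have hK x y z : d x z <= K * (d x y + d y z).
  apply: (le_trans (hK0 x y z)); rewrite ler_wpM2r ?addr_ge0 ?dist_ge0//.
  by rewrite le_max lexx.
pose e := (Num.bound (K + 2 * K ^+ 2)).+1.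
have he : K + 2 * K ^+ 2 <= 2 ^+ e.
  apply: ltW; apply: lt_le_trans (archi_boundP _) _; first by nra.
  by rewrite -natrX ler_nat (leq_trans _ (ltnW (ltn_expl _ _)))// leqnSn.
have [A [delta [A0 delta0 hA]]] := hs_doubling hX.
pose C k := A * (2 ^+ k) `^ delta.
have hC k Q : vol (dyadic k Q) <= C k * vol Q.
  have := hA (center Q) (radius Q) (2 ^+ k) (radius_gt0 Q) (exprn_ege1 k (ler1n _ 2)).
  by rewrite -/(bset (dyadic k Q)) -/(bset Q) !volE -EFinM lee_fin.
exists e, (1 + C 1%N + C e).
have C0 k : 0 <= C k by rewrite mulr_ge0 ?powR_ge0// ltW.
split; first by have := C0 1%N; have := C0 e; lra.
split.
- move=> P Q QP [w [Pw Qw]] z Qz.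
  rewrite /ball_set/open_ball/= in Pw Qw Qz *.
  apply: lt_le_trans (_ : (K + 2 * K ^+ 2) * radius P <= _); last first.
    by rewrite ler_pM2r ?radius_gt0.
  have h1 := hK (center P) w z; have h2 := hK w (center Q) z.
  rewrite (distC w (center Q)) in h2.
  have h3 : d w z < K * (2 * radius P).
    apply: le_lt_trans h2 _; rewrite ltr_pM2l//; lra.
  apply: le_lt_trans h1 _.
  rewrite (_ : _ * radius P = K * (radius P + K * (2 * radius P))); last by ring.
  by rewrite ltr_pM2l; lra.
- move=> Q; apply: (le_trans (hC 1%N Q)); rewrite ler_wpM2r ?vol_ge0//.
  by have := C0 e; lra.
- move=> Q; apply: (le_trans (hC e Q)); rewrite ler_wpM2r ?vol_ge0//.
  by have := C0 1%N; lra.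
Qed.

Section covering.
Context (e : nat) (D : R).
Hypothesis (hD : 1 <= D) (hG : geometry e D).

Let D_ge0 : 0 <= D. Proof. exact: le_trans ler01 hD. Qed.

Lemma vol_dyadic k Q : vol (dyadic k Q) <= D ^+ k * vol Q.
Proof.
elim: k => [|k IH]; first by rewrite dyadic0 mul1r.
rewrite -add1n -dyadic_dyadic; apply: (le_trans (geo_volS hG _)).
by rewrite add1n exprS -mulrA ler_wpM2l.
Qed.

Definition disjoint_balls P Q : bool := `[< bset P `&` bset Q = set0 >].

Section family.
Context (I : choiceType) (W : I -> qball).
Implicit Types (s t : seq I) (i j : I).

Definition disjoint_seq s := pairwise (fun i j => disjoint_balls (W i) (W j)) s.

Lemma sum_vol_le s (E : set X) : measurable E -> disjoint_seq s ->
  (forall i, i \in s -> bset (W i) `<=` E) ->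
  ((\sum_(i <- s) vol (W i))%:E <= mu E)%E.
Proof.
elim: s E => [|i s IH] E mE; first by rewrite big_nil measure_ge0.
move=> /=/andP[/allP dis ds] sE; rewrite big_cons EFinD -volE.
have mEi : measurable (E `\` bset (W i)) by exact: measurableD.
have iE : bset (W i) `<=` E by apply: sE; rewrite mem_head.
rewrite (_ : E = bset (W i) `|` (E `\` bset (W i))); last first.
  apply/seteqP; split=> [x Ex|x [/iE//|[]//]].
  by have [|] := pselect (bset (W i) x); [left|right].
rewrite measureU//; last by rewrite setDE setIA setIAC setICr set0I.
apply: leeD => //; apply: IH => // j js x jx; split.
  by apply: (sE j) => //; rewrite inE js orbT.
move=> ix; have /asboolP h := dis _ js.
by have : (bset (W i) `&` bset (W j)) x by []; rewrite h.
Qed.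

(** Vitali's selection: among the balls still available keep one of largest
    radius and discard those that meet it, which its dilation swallows. *)
Lemma vitali_selection s : exists t, [/\ {subset t <= s}, disjoint_seq t &
  forall i, i \in s -> exists2 j, j \in t & bset (W i) `<=` bset (dyadic e (W j))].
Proof.
have [n] := ubnP (size s); elim: n s => // n IH [|i0 s0] sn.
  by exists [::]; split.
set s := i0 :: s0 in sn *.
have [m ms mmax] : exists2 m, m \in s & forall i, i \in s -> radius (W i) <= radius (W m).
  rewrite /s; elim: (s0) i0 {s sn} => [|j s0' IH'] i0.
    by exists i0; rewrite ?mem_head// => i; rewrite inE => /eqP ->.
  have [m ms mmax] := IH' j.
  have [im|/ltW mi] := leP (radius (W i0)) (radius (W m)).
    exists m; first by rewrite inE ms orbT.
    by move=> i; rewrite inE => /predU1P[->//|]; exact: mmax.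
  exists i0; first by rewrite mem_head.
  by move=> i; rewrite inE => /predU1P[->//|/mmax/le_trans]; apply.
pose s' := [seq i <- s | disjoint_balls (W m) (W i)].
have mm : ~~ disjoint_balls (W m) (W m).
  apply/asboolP; rewrite setIid => h.
  by have := center_in (W m); rewrite h.
have sz : (size s' < n)%N.
  have : (size s' < size s)%N.
    rewrite size_filter -(count_predC (fun i => disjoint_balls (W m) (W i)) s).
    by rewrite -[X in (X < _)%N]addn0 ltn_add2l -has_count; apply/hasP; exists m.
  by move=> /leq_trans; apply.
have [t [ts dt ht]] := IH s' sz.
exists (m :: t); split.
- move=> i; rewrite inE => /predU1P[->//|/ts]; by rewrite mem_filter => /andP[].
- apply/andP; split; last exact: dt.
  apply/allP => i /ts.
  by rewrite mem_filter => /andP[].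
- move=> i si; have [dis|/asboolP ndis] := boolP (disjoint_balls (W m) (W i)).
    have [|j jt hj] := ht i; first by rewrite mem_filter dis.
    by exists j => //; rewrite inE jt orbT.
  exists m; first by rewrite mem_head.
  by apply: (geo_engulf hG); [exact: mmax|apply/set0P/eqP].
Qed.

End family.

Lemma disjoint_seq_map (I : choiceType) (W : I -> qball) (s : seq I) :
  disjoint_seq id (map W s) = disjoint_seq W s.
Proof. by rewrite /disjoint_seq pairwise_map. Qed.

(** Packings replace the level sets of maximal functions: as unions of
    uncountably many balls, the latter need not be measurable. *)
Definition packing_bound (L : qball -> Prop) (M : R) := forall s : seq qball,
  disjoint_seq id s -> (forall Q, Q \in s -> L Q) -> \sum_(Q <- s) vol Q <= M.

Lemma packing_bound_ge0 L M : packing_bound L M -> 0 <= M.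
Proof. by move=> h; have := h [::] isT; rewrite big_nil; apply. Qed.

Lemma packing_bound_vol L M Q : packing_bound L M -> L Q -> vol Q <= M.
Proof.
move=> h LQ; have := h [:: Q] isT; rewrite big_seq1; apply=> P.
by rewrite inE => /eqP->.
Qed.

(** If disjoint balls are enlarged to members of [L], Vitali's selection of the
    latter still engulfs the former. *)
Lemma packing_bound_sub (L : qball -> Prop) M (I : choiceType) (U W : I -> qball)
    (s : seq I) : packing_bound L M -> disjoint_seq U s ->
  (forall i, i \in s -> bset (U i) `<=` bset (W i)) ->
  (forall i, i \in s -> L (W i)) -> \sum_(i <- s) vol (U i) <= D * M.
Proof.
move=> LM dU UW LW; have [t [ts dt ht]] := vitali_selection W s.
have sub_t i : i \in s -> exists2 j, j \in t & bset (U i) `<=` bset (dyadic e (W j)).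
  move=> si; have [j jt h] := ht i si; exists j => //.
  exact: subset_trans (UW _ si) h.
apply: (@le_trans _ _ (\sum_(j <- t) vol (dyadic e (W j)))).
  rewrite -lee_fin; apply: le_trans (_ : mu (\bigcup_(j in [set` t]) bset (dyadic e (W j))) <= _)%E.
    apply: sum_vol_le => //.
      by rewrite bigcup_seq; exact: bigsetU_measurable.
    by move=> i /sub_t [j jt h] x /h ?; exists j.
  rewrite bigcup_seq -sumEFin; under [leRHS]eq_bigr do rewrite -volE.
  elim: {dt ts ht sub_t} t => [|j t IH]; first by rewrite !big_nil measure0.
  rewrite !big_cons; apply: (le_trans (measureU2 _ _ _)) => //.
    exact: bigsetU_measurable.
  by rewrite leeD2l.
apply: (@le_trans _ _ (\sum_(j <- t) D * vol (W j))).
  by apply: ler_sum => j _; exact: geo_vol.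
rewrite -mulr_sumr ler_wpM2l//.
have := LM (map W t); rewrite disjoint_seq_map big_map; apply => //.
by move=> _ /mapP[j jt ->]; apply: LW; exact: ts.
Qed.

End covering.
End balls.

(** * Outer regularity and coverings of measurable sets *)

Lemma measure_shrink (R : realType) (dX : measure_display)
    (X : measurableType dX) (mu : {measure set X -> \bar R})
    (F : (set X)^nat) (eps : R) :
  (forall n, measurable (F n)) -> (mu (F 0%N) < +oo)%E ->
  nonincreasing_seq F -> \bigcap_n F n = set0 -> 0 < eps ->
  exists n, (mu (F n) < eps%:E)%E.
Proof.
move=> mF F0 niF F_0 eps0; apply: contrapT => h.
have hn n : (eps%:E <= mu (F n))%E.
  by rewrite leNgt; apply/negP => ?; apply: h; exists n.
have := nonincreasing_cvg_mu F0 mF; rewrite F_0 measure0 => /(_ measurable0 niF) F0'.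
have : (eps%:E <= 0 :> \bar R)%E.
  rewrite -(cvg_lim _ F0')//; apply: lime_ge; first by apply/cvg_ex; eexists; exact: F0'.
  exact: nearW.
by rewrite lee_fin leNgt eps0.
Qed.

Section regularity.
Context (R : realType) (dX : measure_display) (X : measurableType dX).
Context (d : X -> X -> R) (mu : {measure set X -> \bar R}).
Hypothesis hX : homogeneous_space d mu.
Context (e : nat) (D : R).
Hypothesis (hD : 1 <= D) (hG : geometry d mu e D).
Notation qball := (ball_of R X).
Notation bset := (ball_set d).
Notation center := Defs.center.
Notation radius := Defs.radius.
Notation vol := (vol d mu).
Implicit Types (P Q : qball) (x y z : X) (U V E A : set X).

Let mbset Q : measurable (bset Q). Proof. exact: measurable_bset hX Q. Qed.

Lemma quasi_openT : quasi_open d setT.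
Proof. by move=> x _; exists 1. Qed.

Lemma quasi_openI U V : quasi_open d U -> quasi_open d V -> quasi_open d (U `&` V).
Proof.
move=> oU oV x [/oU[r r0 rU] /oV[s s0 sV]]; exists (Num.min r s).
  by rewrite lt_min r0.
by move=> y; rewrite /open_ball/= lt_min => /andP[yr ys]; split; [exact: rU|exact: sV].
Qed.

Lemma quasi_open_bigcup (F : (set X)^nat) :
  (forall n, quasi_open d (F n)) -> quasi_open d (\bigcup_n F n).
Proof.
move=> oF x [n _ /oF[r r0 rF]]; exists r => // y /rF Fy; by exists n.
Qed.

Lemma quasi_open_bigcap (F : (set X)^nat) n :
  (forall k, quasi_open d (F k)) -> quasi_open d (\bigcap_(k < n) F k).
Proof.
move=> oF; elim: n => [|n IH].
  rewrite (_ : \bigcap_(k < 0) F k = setT); first exact: quasi_openT.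
  by apply/seteqP; split.
rewrite bigcap_mkord big_ord_recr/= -bigcap_mkord; exact: quasi_openI.
Qed.

Lemma quasi_open_measurable U : quasi_open d U -> measurable U.
Proof. by move=> oU; rewrite (hs_borel hX); exact: sub_sigma_algebra. Qed.

(** A ball of a quasi-distance need not be open, but it is a neighbourhood of
    its centre. *)
Definition quasi_interior A : set X :=
  [set x | exists2 r : R, 0 < r & open_ball d x r `<=` A].

Lemma quasi_interior_open A : quasi_open d (quasi_interior A).
Proof.
move=> y [s s0 sA].
have t0 : 0 < s / 2 ^+ e by rewrite divr_gt0// exprn_gt0.
exists (s / 2 ^+ e) => // z yz; exists (s / 2 ^+ e) => // w zw; apply: sA.
have := @geo_engulf _ _ _ _ _ _ _ hG (Ball y t0) (Ball z t0) (lexx _).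
rewrite /ball_set/open_ball/= mulrCA mulfV ?expf_neq0// mulr1; apply => //.
by exists z; split => //; rewrite /= (dist0 hX).
Qed.

Lemma sub_quasi_interior A : quasi_interior A `<=` A.
Proof. by move=> x [r r0]; apply; rewrite /open_ball/= (dist0 hX). Qed.

Lemma quasi_interiorS A B : A `<=` B -> quasi_interior A `<=` quasi_interior B.
Proof. by move=> AB x [r r0 rA]; exists r => // y /rA /AB. Qed.

(** The open neighbourhoods of a closed set shrink to it. *)
Lemma outer_approx_closed (B0 E : set X) (eps : R) : measurable B0 ->
  (mu B0 < +oo)%E -> quasi_open d E -> 0 < eps ->
  exists V, [/\ quasi_open d V, ~` E `<=` V & (mu (E `&` V `&` B0) < eps%:E)%E].
Proof.
move=> mB0 fB0 oE eps0.
pose V n := quasi_interior (\bigcup_(x in ~` E) open_ball d x n.+1%:R^-1).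
have oV n : quasi_open d (V n) by exact: quasi_interior_open.
have mF n : measurable (E `&` V n `&` B0).
  by apply: measurableI => //; apply: measurableI; exact: quasi_open_measurable.
have [|||||n hn] := @measure_shrink _ _ _ mu (fun n => E `&` V n `&` B0) eps => //.
- by apply: le_lt_trans fB0; apply: le_measure; rewrite ?inE//; apply: subIsetr.
- move=> m n mn; apply/subsetPset; apply: setSI; apply: setIS.
  apply: quasi_interiorS => y [x Ex xy]; exists x => //.
  apply: lt_le_trans xy _.
  by rewrite lef_pV2 ?posrE ?ltr0n// ler_nat.
- rewrite -subset0 => y Vy.
  have [[/[dup] Ey /oE[r r0 rE] _] _] := Vy 0%N I.
  have [n rn] := ltr_add_invr r0; rewrite add0r in rn.
  have [[_ /sub_quasi_interior[x Ex xy]] _] := Vy n I.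
  by apply: Ex; apply: rE; rewrite /open_ball/= (distC hX) (lt_trans xy).
exists (V n); split=> // x Ex; exists n.+1%:R^-1; first by rewrite invr_gt0.
by move=> y xy; exists x.
Qed.

(** Approximating a set and its complement from outside at the same time makes
    the class visibly stable under complements. *)
Let approx (B0 E : set X) := forall eps : R, 0 < eps -> exists U V,
  [/\ quasi_open d U, quasi_open d V, E `<=` U, ~` E `<=` V &
      (mu (U `&` V `&` B0) < eps%:E)%E].

(** For a countable union the complements can be intersected only finitely
    often, since the intersection has to stay open; the part of the union that
    is missed after [n] sets has small measure. *)
Let approx_sigma_algebra (B0 : set X) : measurable B0 -> (mu B0 < +oo)%E ->
  sigma_algebra setT (approx B0).
Proof.
move=> mB0 fB0; split.
- move=> eps eps0; exists set0, setT; split=> //; first exact: quasi_openT.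
  by rewrite !set0I measure0 lte_fin.
- move=> E aE eps eps0; have [U [V [oU oV EU EV h]]] := aE eps eps0.
  exists V, U; split=> //; rewrite ?setTD//; first by rewrite setCK.
  by rewrite (setIC V).
- move=> E aE eps eps0.
  have eps20 : 0 < eps / 2 by rewrite divr_gt0.
  have /choice[U /choice[V hUV]] : forall n, exists U V,
      [/\ quasi_open d U, quasi_open d V, E n `<=` U, ~` E n `<=` V &
      (mu (U `&` V `&` B0) < ((eps / 2) / (2 ^ n.+1)%:R)%:E)%E].
    move=> n; apply: aE; by rewrite divr_gt0// ltr0n expn_gt0.
  have oU n : quasi_open d (U n) by have [] := hUV n.
  have oV n : quasi_open d (V n) by have [] := hUV n.
  have mU n : measurable (U n) by exact: quasi_open_measurable.
  have mV n : measurable (V n) by exact: quasi_open_measurable.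
  have oUU := quasi_open_bigcup oU.
  have mUU : measurable (\bigcup_n U n) by exact: quasi_open_measurable.
  pose F n := (\bigcup_k U k `\` \bigcup_(k < n) U k) `&` B0.
  have mF n : measurable (F n).
    by apply: measurableI => //; apply: measurableD => //; apply: bigcup_measurable.
  have [|||||n hn] := @measure_shrink _ _ _ mu F (eps / 2) => //.
  + by apply: le_lt_trans fB0; apply: le_measure; rewrite ?inE//; apply: subIsetr.
  + move=> m n mn; apply/subsetPset; apply: setSI; apply: setDS => x [k /= km Ux].
    by exists k => //=; exact: leq_trans mn.
  + rewrite -subset0 => x Fx; have [[[k _ Uk] _] _] := Fx 0%N I.
    by have [[_ []]] := Fx k.+1 I; exists k => /=.
  pose W := \bigcap_(k < n) V k.
  have oW : quasi_open d W by exact: quasi_open_bigcap.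
  exists (\bigcup_n U n), W; split=> //.
  + by move=> x [k _ Ek]; exists k => //; have [_ _ h _ _] := hUV k; exact: h.
  + move=> x Ex k _; have [_ _ _ h _] := hUV k; apply: h => Ekx.
    by apply: Ex; exists k.
  pose G k := U k `&` V k `&` B0.
  have mG k : measurable (G k) by apply: measurableI => //; exact: measurableI.
  have mUG : measurable (\bigcup_k G k) by exact: bigcup_measurable.
  apply: (@le_lt_trans _ _ (mu (\bigcup_k G k `|` F n))).
    apply: le_measure; rewrite ?inE.
    * by apply: measurableI => //; apply: measurableI => //; exact: quasi_open_measurable.
    * exact: measurableU.
    move=> x [[[k _ Uk] Wx] B0x].
    have [Un|Un] := pselect ((\bigcup_(k < n) U k) x).
      left; case: Un => j jn Uj; exists j => //; split => //; split => //; exact: Wx.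
    by right; split => //; split => //; exists k.
  apply: le_lt_trans (measureU2 _ mUG (mF n)) _.
  rewrite [eps]splitr EFinD; apply: lee_ltD => //.
    by rewrite ge0_fin_numE// (le_lt_trans _ fB0)//; apply: le_measure; rewrite ?inE// => x [k _ []].
  apply: le_trans (epsilon_trick0 xpredT (ltW eps20)).
  apply: (@le_trans _ _ (\sum_(0 <= k <oo) mu (G k))%E).
    exact: measure_sigma_subadditive.
  by apply: lee_nneseries => // k _; have [_ _ _ _ /ltW] := hUV k.
Qed.

Lemma outer_regular (B0 E : set X) (eps : R) : measurable B0 ->
  (mu B0 < +oo)%E -> measurable E -> 0 < eps ->
  exists U, [/\ quasi_open d U, E `<=` U & (mu ((U `\` E) `&` B0) < eps%:E)%E].
Proof.
move=> mB0 fB0 mE eps0.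
have mE' := mE; rewrite (hs_borel hX) in mE'.
have : approx B0 E.
  apply: (smallest_sub (approx_sigma_algebra mB0 fB0) _ mE') => O oO eps' eps'0.
  have [V [oV OV h]] := outer_approx_closed mB0 fB0 oO eps'0.
  by exists O, V; split.
move=> /(_ eps eps0)[U [V [oU oV EU EV h]]]; exists U; split => //.
have mU := quasi_open_measurable oU; have mV := quasi_open_measurable oV.
apply: le_lt_trans h; apply: le_measure; rewrite ?inE.
- by apply: measurableI => //; exact: measurableD.
- by apply: measurableI => //; exact: measurableI.
- by apply: setSI => x [Ux /EV].
Qed.

(** Points of a bounded set that are far from one another are centres of
    disjoint balls of comparable volume, so there are boundedly many. *)
Lemma finite_net Q0 A (k : nat) : A `<=` bset Q0 -> exists s : seq X,
  (forall x, x \in [set` s] -> A x) /\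
  A `<=` \bigcup_(x in [set` s]) open_ball d x (radius Q0 / 2 ^+ k).
Proof.
move=> AQ0; set r := radius Q0 / 2 ^+ k.
have r0 : 0 < r by rewrite divr_gt0 ?radius_gt0// exprn_gt0.
have r'0 : 0 < r / 2 ^+ e by rewrite divr_gt0// exprn_gt0.
pose b x : qball := Ball x r'0.
pose sep (s : seq X) := disjoint_seq d b s /\ (forall x, x \in s -> A x).
pose B0 := dyadic e Q0.
have r'r : r / 2 ^+ e <= radius Q0.
  rewrite /r -mulrA ler_piMr ?(ltW (radius_gt0 _))// -invfM invf_le1.
    by rewrite -exprD exprn_ege1// ler1n.
  by rewrite -exprD exprn_gt0.
have bB0 x : A x -> bset (b x) `<=` bset B0.
  move=> Ax; apply: (geo_engulf hG) => //; exists x; split; first exact: AQ0.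
  exact: (center_in hX (b x)).
pose M := (e + e + k + e)%N.
have vb x : A x -> vol B0 <= D ^+ M * vol (b x).
  move=> Ax; apply: le_trans (vol_dyadic hD hG _ _).
  apply: (le_vol hX).
  have h0 : 0 < 2 ^+ e * radius Q0 by rewrite mulr_gt0 ?exprn_gt0 ?radius_gt0.
  have := @geo_engulf _ _ _ _ _ _ _ hG (Ball x h0) B0 (lexx _).
  have -> : dyadic e (Ball x h0) = dyadic M (b x).
    apply: ball_ext => //=; rewrite /M /r !exprD.
    by field; rewrite ?expf_neq0// ?pnatr_eq0.
  apply; exists x; split; first exact: (center_in hX (Ball x h0)).
  by apply: (bB0 x Ax); exact: (center_in hX (b x)).
have szs s : sep s -> (size s)%:R <= D ^+ M.
  move=> [ds sA].
  have : \sum_(x <- s) vol (b x) <= vol B0.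
    rewrite -lee_fin -(volE hX); apply: (sum_vol_le hX) => // x /sA; exact: bB0.
  have : \sum_(x <- s) (vol B0 / D ^+ M) <= \sum_(x <- s) vol (b x).
    rewrite big_seq [leRHS]big_seq; apply: ler_sum => x /sA Ax.
    by rewrite ler_pdivrMr ?exprn_gt0 ?(lt_le_trans ltr01)// mulrC vb.
  rewrite big_const_seq count_predT iter_addr_0 => h1 h2.
  have := le_trans h1 h2; rewrite -(mulr_natr (vol B0 / D ^+ M)) mulrAC ler_pdivrMr ?exprn_gt0 ?(lt_le_trans ltr01)//.
  by rewrite ler_pM2l ?(vol_gt0 hX).
have exn : exists n, `[< exists2 s, sep s & size s = n >].
  by exists 0%N; apply/asboolP; exists [::].
have bdn n : `[< exists2 s, sep s & size s = n >] -> (n <= Num.bound (D ^+ M))%N.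
  move=> /asboolP[s hs <-]; rewrite -(@ler_nat R); apply: le_trans (szs _ hs) _.
  by apply/ltW/archi_boundP/exprn_ge0/(le_trans _ hD).
case: (ex_maxnP exn bdn) => n /asboolP[s [ds sA] sn] nmax.
exists s; split=> [x|y Ay]; first by rewrite inE; exact: sA.
apply: contrapT => hy.
suff : (n.+1 <= n)%N by rewrite ltnn.
apply: nmax; apply/asboolP; exists (y :: s); last by rewrite /= sn.
split; last by move=> x; rewrite inE => /predU1P[->//|]; exact: sA.
apply/andP; split; last exact: ds.
apply/allP => x xs; apply/asboolP; rewrite -subset0 => z [yz xz].
apply: hy; exists x => //.
have := @geo_engulf _ _ _ _ _ _ _ hG (b x) (b y) (lexx _).
rewrite /ball_set/= mulrCA mulfV ?expf_neq0// mulr1; apply.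
  by exists z.
exact: (center_in hX (b y)).
Qed.

(** Small balls inside an open set of almost the same measure cover the given
    set; finitely many of them cover most of it, and Vitali's selection makes
    them disjoint. *)
Lemma cover_measurable Q0 E (eps : R) : measurable E -> E `<=` bset Q0 ->
  0 < eps -> exists s : seq qball, [/\ disjoint_seq d id s,
    ((\sum_(Q <- s) vol Q)%:E <= mu E + eps%:E)%E &
    (mu (E `\` \bigcup_(Q in [set` s]) bset (dyadic e Q)) < eps%:E)%E].
Proof.
move=> mE EQ0 eps0; pose B0 := dyadic e Q0.
have fB0 : (mu (bset B0) < +oo)%E by rewrite (volE hX) ltry.
have [U [oU EU hU]] := outer_regular (mbset B0) fB0 mE eps0.
have mU := quasi_open_measurable oU.
pose r k := radius Q0 / 2 ^+ k.
have r0 k : 0 < r k by rewrite divr_gt0 ?radius_gt0 ?exprn_gt0.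
have rle k : r k <= radius Q0.
  rewrite ler_pdivrMr ?exprn_gt0// ler_peMr ?(ltW (radius_gt0 _))//.
  by rewrite exprn_ege1// ler1n.
pose b k x : qball := Ball x (r0 k).
pose A k := [set x | E x /\ bset (b k x) `<=` U].
have AQ k : A k `<=` bset Q0 by move=> x [/EQ0].
have /choice[N hN] := fun k => finite_net k (AQ k).
pose net n := flatten [seq [seq b k x | x <- N k] | k <- iota 0 n].
pose W n := \bigcup_(Q in [set` net n]) bset Q.
have mW n : measurable (W n) by rewrite /W bigcup_seq; exact: bigsetU_measurable.
have netP n Q : Q \in net n -> exists k x, [/\ (k < n)%N, x \in N k & Q = b k x].
  move=> /flattenP[t /mapP[k]]; rewrite mem_iota add0n => /= kn -> /mapP[x xN ->].
  by exists k, x.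
have [|||||n hn] := @measure_shrink _ _ _ mu (fun n => E `\` W n) eps => //.
- by move=> n; exact: measurableD.
- apply: le_lt_trans fB0; apply: le_measure; rewrite ?inE//; first exact: measurableD.
  by move=> x [/EQ0 + _]; exact: sub_dyadicr.
- move=> m n mn; apply/subsetPset; apply: setDS => x [Q /= Qm Qx]; exists Q => //=.
  move: Qm => /flattenP[t /mapP[k kt ->] tQ]; apply/flattenP.
  exists [seq b k x | x <- N k] => //; apply: (map_f (fun k => [seq b k x | x <- N k])).
  by move: kt; rewrite !mem_iota !add0n /= => /leq_trans; apply.
- rewrite -subset0 => x hx; have [Ex _] := hx 0%N I.
  have [rU rU0 xU] := oU x (EU _ Ex).
  have [k hk] : exists k, r k <= rU.
    exists (Num.bound (radius Q0 / rU)); rewrite ler_pdivrMr ?exprn_gt0// mulrC -ler_pdivrMr//.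
    apply: le_trans (ltW (archi_boundP _)) _; first by rewrite divr_ge0 ?ltW ?radius_gt0.
    by rewrite -natrX ler_nat ltnW// ltn_expl.
  have Ax : A k x by split=> // y; rewrite /ball_set/open_ball/= => xy; apply: xU; exact: lt_le_trans hk.
  have [_ /(_ x Ax)[y yN yx]] := hN k.
  have [_ []] := hx k.+1 I; exists (b k y) => //=.
  apply/flattenP; exists [seq b k x | x <- N k]; last exact: (map_f (b k)).
  by apply: (map_f (fun k => [seq b k x | x <- N k])); rewrite mem_iota add0n ltnSn.
have [t [tn dt ht]] := vitali_selection hX hG id (net n).
exists t; split=> //.
- have mUB : measurable (U `&` bset B0) by exact: measurableI.
  apply: (@le_trans _ _ (mu (U `&` bset B0))).
    apply: (sum_vol_le hX) => // Q /tn /netP[k [x [kn xN ->]]].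
    have Ax : A k x by have [h _] := hN k; apply: h; rewrite inE.
    move=> y by_; split; first by apply: Ax.2.
    apply: (geo_engulf hG) by_; first exact: rle.
    exists x; split; first exact: EQ0 Ax.1.
    exact: (center_in hX (b k x)).
  apply: (@le_trans _ _ (mu (E `|` ((U `\` E) `&` bset B0)))).
    have mUE : measurable (U `\` E) by exact: measurableD.
    apply: le_measure; rewrite ?inE//; first by apply: measurableU => //; exact: measurableI.
    by move=> x [Ux Bx]; have [Ex|Ex] := pselect (E x); [left|right].
  apply: le_trans (measureU2 _ _ _) _ => //; first by apply: measurableI => //; exact: measurableD.
  by rewrite leeD2l// ltW.
- apply: le_lt_trans hn; apply: le_measure; rewrite ?inE; try exact: measurableD.
    by apply: measurableD => //; rewrite bigcup_seq; exact: bigsetU_measurable.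
  apply: setDS => x [Q /ht[P tP QP] Qx]; exists P => //; exact: QP.
Qed.

End regularity.

(** * Power integrals and normalized test functions *)

Lemma powR_le1 (R : realType) (t r : R) : 0 <= r -> 0 <= t -> t <= 1 ->
  t `^ r <= 1.
Proof.
move=> r0 t0 t1; have := @ge0_ler_powR R r r0 t 1.
by rewrite !nnegrE powR1; apply.
Qed.

Lemma le_poweR (R : realType) (x y : \bar R) (r : R) : 0 <= r -> (0 <= x)%E ->
  (x <= y)%E -> (x `^ r <= y `^ r)%E.
Proof.
move=> r0 x0 xy; apply: gt0_ler_poweR => //.
  by rewrite in_itv/= x0 leey.
by rewrite in_itv/= (le_trans x0 xy) leey.
Qed.

Section power_integral.
Context (R : realType) (dX : measure_display) (X : measurableType dX).
Context (mu : {measure set X -> \bar R}).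
Implicit Types (f g : X -> R) (E F : set X) (r : R).

Definition pint r f : \bar R := (\int[mu]_x (`|f x| `^ r)%:E)%E.

Definition cut f E : X -> R := fun x => f x * \1_E x.

Lemma cut_in f E x : E x -> cut f E x = f x.
Proof. by move=> Ex; rewrite /cut indicE mem_set// mulr1. Qed.

Lemma cut_out f E x : ~ E x -> cut f E x = 0.
Proof. by move=> Ex; rewrite /cut indicE memNset// mulr0. Qed.

Lemma cut_id f E : (forall x, ~ E x -> f x = 0) -> cut f E = f.
Proof.
move=> fE; apply/funext => x; have [Ex|Ex] := pselect (E x).
  by rewrite cut_in.
by rewrite cut_out// fE.
Qed.

Lemma measurable_cut f E : measurable_fun setT f -> measurable E ->
  measurable_fun setT (cut f E).
Proof. by move=> mf mE; apply: measurable_funM. Qed.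

Lemma measurable_pow f r : measurable_fun setT f ->
  measurable_fun setT (fun x => (`|f x| `^ r)%:E).
Proof.
move=> mf; apply/measurable_EFinP.
apply: (@measurableT_comp _ _ _ _ _ _ (@powR R ^~ r)) => //.
exact: measurableT_comp.
Qed.

Lemma pint_ge0 r f : (0 <= pint r f)%E.
Proof. by apply: integral_ge0 => x _; rewrite lee_fin powR_ge0. Qed.

Lemma Lnorm_pint r f : ('N[mu]_(r%:E) [EFin \o f] = pint r f `^ r^-1)%E.
Proof. by rewrite unlock. Qed.

Lemma Lfun_measurable (q : \bar R) f : f \in Lfun mu q -> measurable_fun setT f.
Proof. by move=> /andP[]; rewrite inE. Qed.

Lemma Lfun_pint r f : 0 < r -> f \in Lfun mu r%:E -> (pint r f < +oo)%E.
Proof.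
move=> r0 /andP[_]; rewrite inE/= /finite_norm Lnorm_pint => /lty_poweRy; apply.
by rewrite gt_eqF// invr_gt0.
Qed.

Lemma pint_Lfun r f : measurable_fun setT f -> (pint r f < +oo)%E ->
  f \in Lfun mu r%:E.
Proof.
by move=> mf h; apply/andP; split; rewrite inE//= /finite_norm Lnorm_pint poweR_lty.
Qed.

Lemma Lfun_comb (q : \bar R) (a : R) f g : (1 <= q)%E -> f \in Lfun mu q ->
  g \in Lfun mu q -> (fun x => a * f x + g x) \in Lfun mu q.
Proof. by move=> q1 Lf Lg; exact: (Lfun_submod_closed mu q1).2. Qed.

Lemma Lfun_cst0 (q : \bar R) : (1 <= q)%E -> (fun _ : X => 0 : R) \in Lfun mu q.
Proof. by move=> q1; exact: (Lfun_submod_closed mu q1).1. Qed.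

Lemma Lfun_mull (q : \bar R) (a : R) f : (1 <= q)%E -> f \in Lfun mu q ->
  (fun x => a * f x) \in Lfun mu q.
Proof.
move=> q1 Lf; rewrite (_ : (fun _ => _) = (fun x => a * f x + 0)).
  by apply: Lfun_comb => //; exact: Lfun_cst0.
by apply/funext => x; rewrite addr0.
Qed.

Lemma Lfun_add (q : \bar R) f g : (1 <= q)%E -> f \in Lfun mu q ->
  g \in Lfun mu q -> (fun x => f x + g x) \in Lfun mu q.
Proof.
move=> q1 Lf Lg; rewrite (_ : (fun _ => _) = (fun x => 1 * f x + g x)).
  exact: Lfun_comb.
by apply/funext => x; rewrite mul1r.
Qed.

Lemma Lfun_sub (q : \bar R) f g : (1 <= q)%E -> f \in Lfun mu q ->
  g \in Lfun mu q -> (fun x => f x - g x) \in Lfun mu q.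
Proof.
move=> q1 Lf Lg; rewrite (_ : (fun _ => _) = (fun x => -1 * g x + f x)).
  exact: Lfun_comb.
by apply/funext => x; rewrite mulN1r addrC.
Qed.

Lemma le_pint r f g : 0 <= r -> measurable_fun setT f -> measurable_fun setT g ->
  (forall x, `|f x| <= `|g x|) -> (pint r f <= pint r g)%E.
Proof.
move=> r0 mf mg fg; apply: ge0_le_integral => //.
- exact: measurable_pow.
- exact: measurable_pow.
- by move=> x _; rewrite lee_fin ge0_ler_powR// nnegrE.
Qed.

Lemma pint_cut r f E : r != 0 -> measurable E ->
  pint r (cut f E) = (\int[mu]_(x in E) (`|f x| `^ r)%:E)%E.
Proof.
move=> r0 mE; rewrite [RHS]integral_mkcond; apply: eq_integral => x _.
rewrite patchE; case: ifPn => [/set_mem Ex|/negP Ex]; first by rewrite cut_in.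
by rewrite cut_out ?normr0 ?powR0// => /mem_set.
Qed.

Lemma le_pint_cut r f E : 0 <= r -> measurable_fun setT f -> measurable E ->
  (pint r (cut f E) <= pint r f)%E.
Proof.
move=> r0 mf mE; apply: le_pint => //; first exact: measurable_cut.
move=> x; have [Ex|Ex] := pselect (E x); first by rewrite cut_in.
by rewrite cut_out// normr0.
Qed.

Lemma pint_mull r a f : measurable_fun setT f ->
  pint r (fun x => a * f x) = ((`|a| `^ r)%:E * pint r f)%E.
Proof.
move=> mf; rewrite /pint -ge0_integralZl//.
- by apply: eq_integral => x _; rewrite normrM powRM// EFinM.
- exact: measurable_pow.
Qed.

Lemma pint_add_disjoint r f g : r != 0 -> measurable_fun setT f ->
  measurable_fun setT g -> (forall x, f x = 0 \/ g x = 0) ->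
  pint r (fun x => f x + g x) = (pint r f + pint r g)%E.
Proof.
move=> r0 mf mg fg; rewrite /pint -ge0_integralD//.
- apply: eq_integral => x _; rewrite -EFinD; have [->|->] := fg x.
    by rewrite add0r normr0 powR0// add0r.
  by rewrite addr0 normr0 powR0// addr0.
- exact: measurable_pow.
- exact: measurable_pow.
Qed.

Lemma Lfun_cut (q : \bar R) f E : (1 <= q)%E -> (0 < mu setT)%E -> measurable E ->
  f \in Lfun mu q -> cut f E \in Lfun mu q.
Proof.
move=> + muT mE; case: q => [r r1 Lf|_|//].
- have r0 : 0 < r by rewrite (lt_le_trans ltr01).
  have mf := Lfun_measurable Lf; apply: pint_Lfun; first exact: measurable_cut.
  exact: le_lt_trans (le_pint_cut (ltW r0) mf mE) (Lfun_pint r0 Lf).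
- move=> Lf; have mf := Lfun_measurable Lf.
  move: Lf => /andP[_]; rewrite inE/= /finite_norm unlock muT => hf.
  apply/andP; split; rewrite inE/=; first exact: measurable_cut.
  rewrite /finite_norm unlock muT; apply: le_lt_trans hf.
  apply: le_ess_sup; apply/nearW => x /=; rewrite lee_fin.
  have [Ex|Ex] := pselect (E x); first by rewrite cut_in.
  by rewrite cut_out// normr0.
Qed.

End power_integral.

Lemma Lavg_leP (R : realType) (dX : measure_display) (X : measurableType dX)
    (mu : {measure set X -> \bar R}) (r : R) (E F : set X) (f : X -> R) (c v : R) :
  measurable E -> mu F = v%:E -> 0 < r -> 0 <= c -> 0 < v ->
  (Lavg mu r%:E E F f <= c%:E)%E <-> (pint mu r (cut f E) <= (c `^ r * v)%:E)%E.
Proof.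
move=> mE vE r0 c0 v0; rewrite /Lavg vE -pint_cut// ?gt_eqF//.
have I0 : (0 <= (v%:E)^-1 * pint mu r (cut f E))%E.
  by rewrite mule_ge0 ?pint_ge0// inve_ge0 lee_fin ltW.
have vV : (v%:E)^-1%E = (v^-1)%:E by rewrite inver gt_eqF.
rewrite (mulrC (c `^ r)) EFinM -lee_pdivrMl// -vV.
split=> h.
  have := le_poweR (ltW r0) (poweR_ge0 _ _) h.
  by rewrite -poweRrM mulVf ?gt_eqF// poweRe1.
have rV0 : 0 <= r^-1 by rewrite invr_ge0 ltW.
have := le_poweR rV0 I0 h.
by rewrite poweR_EFin -powRrM mulfV ?gt_eqF// powRr1.
Qed.

Section admissible.
Context (R : realType) (dX : measure_display) (X : measurableType dX).
Context (mu : {measure set X -> \bar R}).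
Hypothesis muT : (0 < mu setT)%E.
Context (beta : \bar R).
Hypothesis beta1 : (1 < beta)%E.
Implicit Types (f g h : X -> R) (E F : set X) (r : R).
Notation pint := (pint mu).

(** The normalization [Lavg mu beta E E g <= 1], written without roots because
    in this form sums over disjoint sets inherit it at once. *)
Definition admissible E g := [/\ g \in Lfun mu beta, forall x, ~ E x -> g x = 0 &
  match beta with
  | b%:E => (pint b g <= mu E)%E
  | _ => \forall x \ae mu, `|g x| <= 1
  end].

Lemma admissible_measurable E g : admissible E g -> measurable_fun setT g.
Proof. by move=> [/Lfun_measurable]. Qed.

(** Averages increase with the exponent. *)
Lemma admissible_pint E g r : measurable E -> 1 <= r -> (r%:E <= beta)%E ->
  admissible E g -> (pint r g <= mu E)%E.
Proof.
move=> mE r1; have r0 : 0 < r by rewrite (lt_le_trans ltr01).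
rewrite /admissible; case: beta beta1 => [b b1|_ _|//].
- rewrite lee_fin => rb [Lg gE gb].
  have b0 : 0 < b by rewrite (lt_le_trans r0).
  have mg := Lfun_measurable Lg.
  (* Young's inequality in place of Hoelder's *)
  have young t : 0 <= t -> t `^ r <= r / b * t `^ b + (1 - r / b).
    move=> t0; have [->|rb'] := eqVneq r b; first by rewrite divff ?gt_eqF// mul1r subrr addr0.
    have rb1 : r / b < 1 by rewrite ltr_pdivrMr// mul1r lt_neqAle rb'.
    have := @conjugate_powR R (t `^ r) 1 (b / r) (1 - r / b)^-1 (powR_ge0 _ _) ler01.
    rewrite -powRrM mulrCA divff ?gt_eqF// mulr1 powR1 mulr1 invrK.
    rewrite mul1r [_ / (b / r)]mulrC invf_div.
    by apply; rewrite ?divr_gt0// ?invr_gt0 ?subr_gt0// subrKC.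
  have pintE s : 0 < s -> pint s g = (\int[mu]_(x in E) (`|g x| `^ s)%:E)%E.
    by move=> s0; rewrite -[in LHS](cut_id gE) pint_cut// gt_eqF.
  have rb0' : 0 <= r / b by rewrite divr_ge0 ?ltW.
  have rb0 : 0 <= 1 - r / b by rewrite subr_ge0 ler_pdivrMr// mul1r.
  have mpow s : measurable_fun E (fun x => (`|g x| `^ s)%:E).
    by apply: measurable_funTS; exact: measurable_pow.
  rewrite pintE//; apply: (@le_trans _ _ (\int[mu]_(x in E) ((r / b)%:E * (`|g x| `^ b)%:E + (1 - r / b)%:E))%E).
    apply: ge0_le_integral => //.
    + by apply: emeasurable_funD => //; apply: measurable_funeM.
    + by move=> x _; have := young _ (normr_ge0 (g x)); rewrite -lee_fin EFinD EFinM.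
  rewrite ge0_integralD//.
  + rewrite ge0_integralZl//.
    rewrite integral_cst// -pintE//.
    apply: (@le_trans _ _ ((r / b)%:E * mu E + (1 - r / b)%:E * mu E)%E).
      by rewrite leeD2r// lee_wpmul2l.
    by rewrite -ge0_muleDl ?lee_fin// -EFinD subrKC mul1e.
  + by move=> x _; rewrite mule_ge0// lee_fin ?powR_ge0.
  + by apply: measurable_funeM.
- move=> [Lg gE g1]; have mg := Lfun_measurable Lg.
  rewrite -[leRHS]mul1e -integral_cst//= [leRHS]integral_mkcond.
  apply: ae_ge0_le_integral => //.
  + exact: measurable_pow.
  + by move=> x _; rewrite patchE; case: ifP.
  + by apply/(measurable_restrictT _ mE); exact: measurable_cst.
  apply: filterS g1 => x gx _; rewrite patchE; case: ifPn => [_|/negP Ex].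
    by rewrite lee_fin powR_le1// ltW.
  by rewrite gE ?normr0 ?powR0 ?gt_eqF// => /mem_set.
Qed.

Lemma admissible_Lfun E g r : measurable E -> (mu E < +oo)%E -> 1 <= r ->
  (r%:E <= beta)%E -> admissible E g -> g \in Lfun mu r%:E.
Proof.
move=> mE fE r1 rb ag; apply: pint_Lfun; first exact: admissible_measurable ag.
exact: le_lt_trans (admissible_pint mE r1 rb ag) fE.
Qed.

Lemma admissible0 E : admissible E (fun=> 0).
Proof.
split => //; first exact/Lfun_cst0/ltW.
case: beta beta1 => [b b1|_|//]; last by apply/nearW => x; rewrite normr0.
rewrite /pint; under eq_integral do rewrite normr0 powR0 ?gt_eqF ?(lt_trans ltr01 b1)//.
by rewrite integral0 measure_ge0.
Qed.

Lemma admissible_sub E F g : measurable E -> measurable F -> E `<=` F ->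
  admissible E g -> admissible F g.
Proof.
move=> mE mF EF [Lg gE gb]; split => //; first by move=> x Fx; apply: gE => /EF.
by case: beta beta1 gb => [b b1 gb|_|//]//; apply: (le_trans gb); rewrite le_measure ?inE.
Qed.

(** Normalized functions on disjoint balls can be tested together; this is what
    turns information on single balls into information on packings. *)
Lemma admissible_add E F g h : measurable E -> measurable F -> E `&` F = set0 ->
  admissible E g -> admissible F h -> admissible (E `|` F) (fun x => g x + h x).
Proof.
move=> mE mF EF [Lg gE gb] [Lh hF hb].
have disj x : g x = 0 \/ h x = 0.
  have [Ex|Ex] := pselect (E x); last by left; exact: gE.
  right; apply: hF => Fx; have : (E `&` F) x by []; by rewrite EF.
split; first exact/Lfun_add/Lh/Lg/ltW.
  by move=> x EFx; rewrite gE ?hF ?addr0// => ?; apply: EFx; [right|left].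
case: beta beta1 gb hb Lg Lh => [b b1 gb hb /Lfun_measurable mg /Lfun_measurable mh|_ gb hb _ _|//].
  rewrite pint_add_disjoint// ?gt_eqF ?(lt_trans ltr01 b1)// measureU//.
  exact: leeD.
apply: filterS2 gb hb => x g1 h1; have [->|->] := disj x; by rewrite ?add0r ?addr0.
Qed.

Lemma admissible_bounded E g : measurable E -> (mu E < +oo)%E ->
  measurable_fun setT g -> (forall x, `|g x| <= 1) ->
  (forall x, ~ E x -> g x = 0) -> admissible E g.
Proof.
move=> mE fE mg g1 gE; rewrite /admissible.
case: beta beta1 => [b b1|_|//].
  have b0 : 0 < b by rewrite (lt_trans ltr01 b1).
  have le : (pint b g <= mu E)%E.
    rewrite -[leRHS]mul1e -integral_cst//= [leRHS]integral_mkcond.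
    apply: ge0_le_integral => //.
    - exact: measurable_pow.
    - by apply/(measurable_restrictT _ mE); exact: measurable_cst.
    move=> x _; rewrite patchE; case: ifPn => [_|/negP Ex].
      by rewrite lee_fin powR_le1// ltW.
    by rewrite gE ?normr0 ?powR0 ?gt_eqF// => /mem_set.
  by split=> //; apply: pint_Lfun => //; exact: le_lt_trans fE.
split=> //; last exact/nearW.
apply/andP; split; rewrite inE//= /finite_norm unlock muT.
apply: (@le_lt_trans _ _ 1%E); last exact: ltry.
by apply/ess_supP/nearW => x /=; rewrite lee_fin.
Qed.

Lemma admissible_Lavg E g : measurable E -> (0 < mu E)%E -> (mu E < +oo)%E ->
  admissible E g -> (Lavg mu beta E E g <= 1)%E.
Proof.
move=> mE E0 fE; rewrite /admissible /Lavg; case: beta beta1 => [b b1|_|//].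
  have b0 : 0 < b by rewrite (lt_trans ltr01 b1).
  move=> [_ gE gb]; rewrite -(poweR1r b^-1) -pint_cut// ?gt_eqF// cut_id//.
  have [v vE v0] : exists2 v : R, mu E = v%:E & 0 < v.
    by exists (fine (mu E)); rewrite ?fineK ?ge0_fin_numE// fine_gt0// E0.
  rewrite vE in gb *; apply: le_poweR; first by rewrite invr_ge0 ltW.
    by rewrite mule_ge0 ?pint_ge0// inve_ge0 lee_fin ltW.
  by rewrite inver gt_eqF// lee_pdivrMl// mule1.
move=> [_ gE g1]; rewrite unlock muT; apply/ess_supP.
apply: filterS g1 => x gx /=; rewrite lee_fin.
rewrite -/(cut g E x); have [Ex|Ex] := pselect (E x); first by rewrite cut_in.
by rewrite cut_out// normr0.
Qed.

Lemma admissible_piece S P (u : X -> R) (c v : R) : measurable S ->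
  measurable P -> S `<=` P -> mu P = v%:E -> 0 < v -> 0 < c ->
  u \in Lfun mu beta -> (Lavg mu beta S P u <= c%:E)%E ->
  admissible P (fun x => c^-1 * cut u S x).
Proof.
move=> mS mP SP vE v0 c0 Lu; rewrite /admissible.
have outP x : ~ P x -> c^-1 * cut u S x = 0.
  by move=> Px; rewrite cut_out ?mulr0// => /SP.
have Lc : (fun x => c^-1 * cut u S x) \in Lfun mu beta.
  by apply: Lfun_mull; rewrite ?ltW//; apply: Lfun_cut => //; exact: ltW.
have mu_ := Lfun_measurable Lu.
case: beta beta1 Lc => [b b1 Lc|_ Lc|//] h; split => //.
  have b0 : 0 < b by rewrite (lt_trans ltr01 b1).
  rewrite pint_mull; last exact: measurable_cut.
  have := (Lavg_leP u mS vE b0 (ltW c0) v0).1 h => h'.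
  rewrite ger0_norm ?invr_ge0 ?(ltW c0)//.
  apply: (@le_trans _ _ ((c^-1 `^ b)%:E * (c `^ b * v)%:E)%E).
    by rewrite lee_wpmul2l// lee_fin powR_ge0.
  rewrite -EFinM mulrA -powRM ?invr_ge0 ?(ltW c0)// mulVf ?gt_eqF// powR1 mul1r.
  by rewrite vE.
move: h; rewrite /Lavg unlock muT => /ess_supP.
apply: filterS => x /=; rewrite lee_fin -/(cut u S x) => hx.
by rewrite normrM ger0_norm ?invr_ge0 ?(ltW c0)// ler_pdivrMl// mulr1.
Qed.

End admissible.

(** * Coronas and the averaged off-diagonal estimates *)

Section coronas.
Context (R : realType) (dX : measure_display) (X : measurableType dX).
Context (d : X -> X -> R) (mu : {measure set X -> \bar R}).
Hypothesis hX : homogeneous_space d mu.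
Notation qball := (ball_of R X).
Notation bset := (ball_set d).
Notation center := Defs.center.
Notation radius := Defs.radius.
Implicit Types (P : qball) (f g h : X -> R) (i j k : nat).

(** The coronas are the increments of this sequence of sets. *)
Definition inner P k : set X := [set x | 1 + d x (center P) / radius P < 2 ^+ k].

Lemma inner0 P : inner P 0 = set0.
Proof.
rewrite -subset0 => x; rewrite /inner/= expr0 gtrDl ltNge.
by rewrite divr_ge0 ?(dist_ge0 hX)// ltW// radius_gt0.
Qed.

Lemma measurable_inner P k : measurable (inner P k).
Proof.
rewrite (_ : inner P k = open_ball d (center P) ((2 ^+ k - 1) * radius P)).
  exact: (hs_ball_measurable hX).
apply/seteqP; split => x; rewrite /inner/open_ball/= (distC hX).
  by rewrite addrC -ltrBrDr ltr_pdivrMr ?radius_gt0.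
by rewrite -ltr_pdivrMr ?radius_gt0// ltrBrDr addrC.
Qed.

Lemma coronaE P k : corona d k P = inner P k.+1 `\` inner P k.
Proof.
apply/seteqP; split => x; rewrite /corona/inner/=.
  by move=> /andP[h1 h2]; split => //; apply/negP; rewrite -leNgt.
by move=> [-> /negP]; rewrite -leNgt => ->.
Qed.

Lemma measurable_corona P k : measurable (corona d k P).
Proof. by rewrite coronaE; apply: measurableD; exact: measurable_inner. Qed.

Lemma corona_sub P k : corona d k P `<=` bset (dyadic k.+1 P).
Proof.
move=> x /andP[_]; rewrite /ball_set/open_ball/= (distC hX) -ltr_pdivrMr ?radius_gt0//.
by move=> /(le_lt_trans _); apply; rewrite lerDr.
Qed.

Lemma le_inner P : nondecreasing_seq (inner P).
Proof.
move=> m n mn; apply/subsetPset => x; rewrite /inner/= => /lt_le_trans; apply.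
by rewrite ler_weXn2l// ler1n.
Qed.

Lemma inner_cover P x : exists k, inner P k x.
Proof.
exists (Num.bound (1 + d x (center P) / radius P)); rewrite /inner/=.
apply: lt_le_trans (archi_boundP _) _.
  by rewrite addr_ge0// divr_ge0 ?(dist_ge0 hX)// ltW ?radius_gt0.
by rewrite -natrX ler_nat ltnW// ltn_expl.
Qed.

Lemma innerS P k : inner P k.+1 = inner P k `|` corona d k P.
Proof. by rewrite coronaE setDUK//; apply/subsetPset/le_inner. Qed.

Lemma inner_corona P k : inner P k `&` corona d k P = set0.
Proof. by rewrite coronaE setDIK. Qed.

Lemma integral_le_corona P (h : X -> \bar R) (b : nat -> R) (M : R) :
  measurable_fun setT h -> (forall x, 0 <= h x)%E ->
  (forall k, \int[mu]_(x in corona d k P) h x <= (b k)%:E)%E ->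
  (forall k, \sum_(i < k) b i <= M) -> (\int[mu]_x h x <= M%:E)%E.
Proof.
move=> mh h0 hb bM.
have inner_le k : (\int[mu]_(x in inner P k) h x <= (\sum_(i < k) b i)%:E)%E.
  elim: k => [|k IH]; first by rewrite inner0 integral_set0 big_ord0.
  rewrite innerS ge0_integral_setU//.
  - by rewrite big_ord_recr/= EFinD; apply: leeD.
  - exact: measurable_inner.
  - exact: measurable_corona.
  - exact: measurable_funTS.
  - by apply/disj_setPS; rewrite inner_corona.
have cvgh := ge0_nondecreasing_set_cvg_integral (le_inner P) (measurable_inner P).
have UX : \bigcup_k inner P k = [set: X].
  by apply/seteqP; split => // x _; have [k ?] := inner_cover P x; exists k.
have {}cvgh : (\int[mu]_(x in inner P k) h x @[k --> \oo] --> \int[mu]_x h x)%E.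
  rewrite -UX; apply: cvgh => // k; exact: measurable_funTS.
rewrite -(cvg_lim _ cvgh)//; apply: lime_le; first by apply/cvg_ex; eexists; exact: cvgh.
by apply: nearW => k; apply: (le_trans (inner_le k)); rewrite lee_fin.
Qed.

End coronas.

Lemma hoelder_local (R : realType) (dX : measure_display) (X : measurableType dX)
    (mu : {measure set X -> \bar R}) (f v : X -> R) (S : set X)
    (p a A k V : R) : measurable S -> measurable_fun setT f ->
  measurable_fun setT v -> 0 < p -> 0 < a -> p^-1 + a^-1 = 1 ->
  0 <= A -> 0 <= k -> 0 <= V ->
  (pint mu p (cut f S) <= (A `^ p * V)%:E)%E ->
  (pint mu a (cut v S) <= (k `^ a * V)%:E)%E ->
  (\int[mu]_(x in S) (`|f x| * `|v x|)%:E <= (A * k * V)%:E)%E.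
Proof.
move=> mS mf mv p0 a0 pa A0 k0 V0 hf hv.
have mcf := measurable_cut mf mS; have mcv := measurable_cut mv mS.
have -> : (\int[mu]_(x in S) (`|f x| * `|v x|)%:E =
    'N[mu]_1 [EFin \o (cut f S \* cut v S)%R])%E.
  rewrite Lnorm1 [LHS]integral_mkcond; apply: eq_integral => x _ /=.
  rewrite patchE; case: ifPn => [/set_mem Sx|/negP Sx].
    by rewrite /= !cut_in// normrM.
  by rewrite (cut_out f) ?mul0r ?normr0// => /mem_set.
apply: (le_trans (hoelder mu mcf mcv p0 a0 pa)).
rewrite !Lnorm_pint.
have pow r B (u : X -> R) : 0 < r -> 0 <= B ->
    (pint mu r u <= (B `^ r * V)%:E)%E ->
    (pint mu r u `^ r^-1 <= (B * V `^ r^-1)%:E)%E.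
  move=> r0 B0 h; have rV0 : 0 <= r^-1 by rewrite invr_ge0 ltW.
  apply: (le_trans (le_poweR rV0 (pint_ge0 _ _ _) h)).
  by rewrite poweR_EFin powRM ?powR_ge0// -powRrM mulfV ?gt_eqF// powRr1.
apply: (@le_trans _ _ ((A * V `^ p^-1)%:E * (k * V `^ a^-1)%:E)%E).
  by apply: lee_pmul; rewrite ?poweR_ge0//; exact: pow.
rewrite -EFinM lee_fin mulrACA -powRD ?pa ?powRr1//.
by rewrite oner_eq0.
Qed.

Lemma pint_unscale (R : realType) (dX : measure_display) (X : measurableType dX)
    (mu : {measure set X -> \bar R}) (r c V : R) (f : X -> R) :
  measurable_fun setT f -> 0 < c ->
  (pint mu r (fun x => (c^-1 * f x)%R) <= V%:E)%E -> (pint mu r f <= (c `^ r * V)%:E)%E.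
Proof.
move=> mf c0; rewrite pint_mull// ger0_norm ?invr_ge0 ?(ltW c0)// => h.
have cr : 0 < c `^ r by rewrite powR_gt0.
rewrite EFinM -lee_pdivrMl//; apply: le_trans h; rewrite (_ : (c `^ r)^-1 = c^-1 `^ r)//.
by rewrite -(powR_inv1 (ltW c0)) -powRrM mulN1r powRN.
Qed.

Lemma supporting_functional (R : realType) (dX : measure_display)
    (X : measurableType dX) (mu : {measure set X -> \bar R}) (q : \bar R)
    (N : (X -> R) -> R) (f : X -> R) : (1 <= q)%E ->
  (forall g h, g \in Lfun mu q -> h \in Lfun mu q ->
    N (fun x => g x + h x) <= N g + N h) ->
  (forall t g, 0 < t -> g \in Lfun mu q -> N (fun x => t * g x) <= t * N g) ->
  f \in Lfun mu q -> exists l : (X -> R) -> R, [/\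
    forall c g h, g \in Lfun mu q -> h \in Lfun mu q ->
      l (fun x => c * g x + h x) = c * l g + l h,
    forall g, g \in Lfun mu q -> l g <= N g & l f = N f].
Proof.
move=> q1 ND NZ Lf; pose V := LfunType mu q1.
pose N' (u : V) := N (u : X -> R).
have hN' : sublinear_fun N'.
  split=> [u w|t u t0]; first by apply: ND; exact: LfunP.
  by apply: NZ => //; exact: LfunP.
have [l [lin dom lf]] := hahn_banach_dominated (Lfun_Sub q1 Lf : V) hN'.
exists (fun g => if pselect (g \in Lfun mu q) is left Lg then l (Lfun_Sub q1 Lg) else 0).
split.
- move=> c g h Lg Lh; case: pselect => [Lc|]; last by case; exact: Lfun_comb.
  case: pselect => [Lg'|//]; case: pselect => [Lh'|//].
  by rewrite -lin; congr l; exact/val_inj.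
- by move=> g Lg; case: pselect => [Lg'|//]; exact: dom.
- case: pselect => [Lf'|//]; rewrite -[N f]lf; congr l; exact/val_inj.
Qed.

Section off_diagonal.
Context (R : realType) (dX : measure_display) (X : measurableType dX).
Context (d : X -> X -> R) (mu : {measure set X -> \bar R}).
Hypothesis hX : homogeneous_space d mu.
Hypothesis muX : mu [set: X] = +oo%E.
Context (e : nat) (D : R).
Hypothesis (hD : 1 <= D) (hG : geometry d mu e D).
Context (beta : \bar R) (B : ball_of R X -> (X -> R) -> X -> R).
Hypothesis (beta1 : (1 < beta)%E) (hB : uniformly_bounded_family mu beta B).
Context (p0 s1 : R) (T : (X -> R) -> X -> R).
Hypothesis (p01 : 1 < p0) (p0beta : (p0%:E <= beta)%E).
Hypothesis (s11 : 1 <= s1) (s1beta : (s1%:E <= beta)%E).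
Context (gam : nat -> R) (Gam : R).
Hypothesis (gam0 : forall j, 0 < gam j).
Hypothesis (gamS : forall k, \sum_(i < k) gam i <= Gam).
Hypothesis hTbnd : exists C : R, bounded_by mu p0%:E C T.
Hypothesis hTB : forall (Q : ball_of R X) (f : X -> R) (j : nat),
    f \in Lfun mu beta -> supported_in mu f (ball_set d Q) ->
    (Lavg mu p0%:E (corona d j Q) (dilate d (2 ^+ j.+1) Q) (T (B Q f)) <=
     (gam j)%:E * (mu (ball_set d Q) / mu (dilate d (2 ^+ j) Q)) *
     Lavg mu beta (ball_set d Q) (ball_set d Q) f)%E.
Hypothesis hIB : forall (Q : ball_of R X) (f : X -> R) (j : nat),
    f \in Lfun mu beta -> supported_in mu f (ball_set d Q) ->
    (Lavg mu beta (corona d j Q) (dilate d (2 ^+ j.+1) Q)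
       (fun x => (f x - B Q f x)%R) <=
     (gam j)%:E * (mu (ball_set d Q) / mu (dilate d (2 ^+ j) Q)) *
     Lavg mu s1%:E (ball_set d Q) (ball_set d Q) f)%E.
Notation qball := (ball_of R X).
Notation bset := (ball_set d).
Notation vol := (vol d mu).
Notation test P := (admissible mu beta (bset P)).
Implicit Types (P : qball) (f g h : X -> R) (i j k : nat).

Let p00 : 0 < p0. Proof. exact: lt_trans p01. Qed.
Let s10 : 0 < s1. Proof. exact: lt_le_trans s11. Qed.
Let beta_ge1 : (1 <= beta)%E. Proof. exact: ltW. Qed.
Let p0_ge1 : (1 <= p0%:E)%E. Proof. by rewrite lee_fin ltW. Qed.
Let muT0 : (0 < mu setT)%E. Proof. by rewrite muX. Qed.
Let mbset P : measurable (bset P). Proof. exact: measurable_bset hX P. Qed.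
Let fbset P : (mu (bset P) < +oo)%E. Proof. by rewrite (volE hX) ltry. Qed.
Let pbset P : (0 < mu (bset P))%E. Proof. by rewrite (volE hX) lte_fin (vol_gt0 hX). Qed.
Let mcorona j P : measurable (corona d j P). Proof. exact: measurable_corona hX _ _. Qed.
Let Gam_ge j : gam j <= Gam.
Proof.
apply: le_trans (gamS j.+1); rewrite big_ord_recr/= lerDr.
by apply: sumr_ge0 => i _; exact: ltW.
Qed.
Let Gam0 : 0 < Gam. Proof. exact: lt_le_trans (gam0 0%N) (Gam_ge _). Qed.

Definition off_coef j P := gam j * (vol P / vol (dyadic j P)).

Lemma off_coef_gt0 j P : 0 < off_coef j P.
Proof. by rewrite mulr_gt0// divr_gt0// (vol_gt0 hX). Qed.

Lemma off_coefE j P :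
  ((gam j)%:E * (mu (bset P) / mu (dilate d (2 ^+ j) P)) = (off_coef j P)%:E)%E.
Proof.
rewrite -[dilate _ _ _]/(bset (dyadic j P)) !(volE hX) inver gt_eqF ?(vol_gt0 hX)//.
Qed.

Lemma off_coef_le j P : off_coef j P <= gam j.
Proof.
rewrite ler_piMr ?(ltW (gam0 j))// ler_pdivrMr ?(vol_gt0 hX)// mul1r.
by apply: (le_vol hX); exact: sub_dyadicr.
Qed.

Lemma off_coef_vol j P : off_coef j P * vol (dyadic j.+1 P) <= D * gam j * vol P.
Proof.
have h := geo_volS hG (dyadic j P); rewrite dyadic_dyadic add1n in h.
have v0 := vol_gt0 hX (dyadic j P).
rewrite (_ : _ * _ = vol (dyadic j.+1 P) / vol (dyadic j P) * (gam j * vol P)); last first.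
  by rewrite /off_coef; ring.
rewrite -[leRHS]mulrA ler_wpM2r ?mulr_ge0 ?(vol_ge0 hX) ?(ltW (gam0 j))//.
by rewrite ler_pdivrMr.
Qed.

Lemma test_supported P g : test P g -> supported_in mu g (bset P).
Proof. by move=> [_ h _]; apply/nearW. Qed.

Lemma test_TB P g j : test P g ->
  (pint mu p0 (cut (T (B P g)) (corona d j P)) <=
   (off_coef j P `^ p0 * vol (dyadic j.+1 P))%:E)%E.
Proof.
move=> tg; have [Lg _ _] := tg.
have v0 := vol_gt0 hX (dyadic j.+1 P).
apply: (Lavg_leP (T (B P g)) (mcorona j P) (volE hX (dyadic j.+1 P)) p00 (ltW (off_coef_gt0 j P)) v0).1.
apply: (le_trans (hTB j Lg (test_supported tg))).
rewrite off_coefE -[leRHS]mule1; apply: lee_wpmul2l.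
  by rewrite lee_fin ltW// off_coef_gt0.
exact: admissible_Lavg.
Qed.

Lemma test_sub_Lbeta P g : test P g -> (fun x => g x - B P g x) \in Lfun mu beta.
Proof.
move=> [Lg _ _]; apply: Lfun_sub => //.
by have [_ [A' hA]] := hB; exact: (hA P g Lg).1.
Qed.

(** The central point: on a corona the error [g - B P g] is again a small
    multiple of a normalized function, now of the dilated ball, and the multiple
    involves only the [L^s1] size of [g]. *)
Lemma test_IB P g j rho : test P g -> 0 < rho ->
  (pint mu s1 g <= (rho `^ s1 * vol P)%:E)%E ->
  test (dyadic j.+1 P) (fun x => (off_coef j P * rho)^-1 *
    cut (fun y => g y - B P g y) (corona d j P) x).
Proof.
move=> tg rho0 hg; have [Lg gP _] := tg.
apply: (@admissible_piece _ _ _ _ muT0 _ beta1 (corona d j P) _ _ _ (vol (dyadic j.+1 P))) => //.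
- exact: (corona_sub hX).
- exact: volE hX _.
- exact: vol_gt0 hX _.
- by rewrite mulr_gt0// off_coef_gt0.
- exact: test_sub_Lbeta.
apply: (le_trans (hIB j Lg (test_supported tg))).
rewrite off_coefE [leRHS]EFinM lee_wpmul2l//; first by rewrite lee_fin ltW// off_coef_gt0.
apply: (Lavg_leP g (mbset P) (volE hX P) s10 (ltW rho0) (vol_gt0 hX P)).2.
by rewrite cut_id.
Qed.

(** The operator [B P] is only given on [L^beta]; the decay on the coronas is
    what makes [B P g] an [L^p0] function, to which the bound for [T] applies. *)
Lemma test_sub_Lp0 P g : test P g -> (fun x => g x - B P g x) \in Lfun mu p0%:E.
Proof.
move=> tg; have Lu := test_sub_Lbeta tg; have mu_ := Lfun_measurable Lu.
have hg : (pint mu s1 g <= (1 `^ s1 * vol P)%:E)%E.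
  by rewrite powR1 mul1r -(volE hX); exact: (admissible_pint beta1 (mbset P) s11 s1beta tg).
apply: pint_Lfun => //; set u := fun x => _ in Lu mu_ *.
pose b j := Gam `^ (p0 - 1) * (D * gam j * vol P).
apply: (@le_lt_trans _ _ (Gam `^ (p0 - 1) * (D * Gam * vol P))%:E); last exact: ltry.
apply: (@integral_le_corona _ _ _ d mu hX P _ b).
- exact: measurable_pow.
- by move=> x; rewrite lee_fin powR_ge0.
- move=> j; rewrite -pint_cut ?gt_eqF//.
  have c0 : 0 < off_coef j P * 1 by rewrite mulr1 off_coef_gt0.
  have tj := test_IB j tg ltr01 hg.
  have := admissible_pint beta1 (mbset _) (ltW p01) p0beta tj.
  rewrite (volE hX) => /(pint_unscale (measurable_cut mu_ (mcorona j P)) c0).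
  move=> /le_trans; apply; rewrite mulr1 lee_fin.
  have c0' := off_coef_gt0 j P.
  rewrite -(mulr_powRB1 (ltW c0') p00) mulrAC [leRHS]mulrC ler_pM ?powR_ge0//.
  + by rewrite mulr_ge0// ltW// (vol_gt0 hX).
  + exact: off_coef_vol.
  + apply: ge0_ler_powR; rewrite ?nnegrE ?subr_ge0 ?(ltW p01) ?(ltW c0') ?(ltW Gam0)//.
    exact: le_trans (off_coef_le j P) (Gam_ge j).
- move=> k; rewrite -mulr_sumr ler_wpM2l ?powR_ge0//.
  rewrite -mulr_suml ler_wpM2r ?(vol_ge0 hX)// -mulr_sumr ler_wpM2l//.
  exact: le_trans ler01 hD.
Qed.

Lemma test_B_Lp0 P g : test P g -> B P g \in Lfun mu p0%:E.
Proof.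
move=> tg; have Lg : g \in Lfun mu p0%:E.
  exact: (admissible_Lfun beta1 (mbset P) (fbset P) (ltW p01) p0beta tg).
have := Lfun_sub p0_ge1 Lg (test_sub_Lp0 tg).
by rewrite (_ : (fun _ => _) = B P g)//; apply/funext => x; rewrite subKr.
Qed.

Lemma test_TB_weighted P g (v : X -> R) (a k : R) : test P g ->
  measurable_fun setT v -> 0 < a -> p0^-1 + a^-1 = 1 -> 0 <= k ->
  (forall j, \int[mu]_(x in bset (dyadic j.+1 P)) (`|v x| `^ a)%:E <=
     (k `^ a * vol (dyadic j.+1 P))%:E)%E ->
  (\int[mu]_x (`|T (B P g) x| * `|v x|)%:E <= (D * Gam * k * vol P)%:E)%E.
Proof.
move=> tg mv a0 pa k0 hv.
have mTB : measurable_fun setT (T (B P g)).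
  have [C hC] := hTbnd; exact: Lfun_measurable (hC _ (test_B_Lp0 tg)).1.
apply: (@integral_le_corona _ _ _ d mu hX P _ (fun j => D * gam j * k * vol P)).
- apply/measurable_EFinP; apply: measurable_funM; exact: measurableT_comp.
- by move=> x; rewrite lee_fin mulr_ge0.
- move=> j; have c0 := ltW (off_coef_gt0 j P).
  have vV := vol_ge0 hX (dyadic j.+1 P).
  have hv' : (pint mu a (cut v (corona d j P)) <= (k `^ a * vol (dyadic j.+1 P))%:E)%E.
    rewrite pint_cut ?gt_eqF//; apply: le_trans (hv j).
    apply: ge0_subset_integral => //; last exact: (corona_sub hX).
    by apply: measurable_funTS; exact: measurable_pow.
  have := hoelder_local (mcorona j P) mTB mv p00 a0 pa c0 k0 vV (test_TB j tg) hv'.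
  move=> /le_trans; apply; rewrite lee_fin mulrAC [leRHS]mulrAC ler_wpM2r//.
  exact: off_coef_vol.
- move=> j; rewrite -mulr_suml ler_wpM2r ?(vol_ge0 hX)// -mulr_suml ler_wpM2r//.
  rewrite -mulr_sumr ler_wpM2l//; exact: le_trans ler01 hD.
Qed.

Section weighted.
Context (v : X -> R) (a : R).
Hypothesis (mv : measurable_fun setT v) (a0 : 0 < a).
Hypothesis (pa : p0^-1 + a^-1 = 1) (vfin : (pint mu a v < +oo)%E).
Hypothesis hTsub : sublinear_op mu p0%:E T.

Definition wint g : \bar R := (\int[mu]_x (`|T g x| * `|v x|)%:E)%E.

Lemma wint_bounded : exists2 V0 : R, 0 <= V0 & forall g (M : R),
  g \in Lfun mu p0%:E -> 0 <= M -> (pint mu p0 g <= M%:E)%E ->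
  (wint g <= (V0 * M `^ p0^-1)%:E)%E.
Proof.
have [C hC] := hTbnd; pose C' := Num.max C 0.
have C'0 : 0 <= C' by rewrite le_max lexx orbT.
pose k := (fine (pint mu a v)) `^ a^-1.
have k0 : 0 <= k by exact: powR_ge0.
exists (C' * k) => [|g M Lg M0 hM]; first exact: mulr_ge0.
have [LTg nTg] := hC g Lg; have mTg := Lfun_measurable LTg.
have hT : (pint mu p0 (T g) <= ((C' * M `^ p0^-1) `^ p0 * 1)%:E)%E.
  have h : (pint mu p0 (T g) `^ p0^-1 <= (C' * M `^ p0^-1)%:E)%E.
    rewrite -Lnorm_pint; apply: (le_trans nTg).
    apply: (@le_trans _ _ (C'%:E * 'N[mu]_(p0%:E) [EFin \o g])%E).
      by rewrite lee_wpmul2r ?Lnorm_ge0// lee_fin le_max lexx.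
    rewrite EFinM lee_wpmul2l// Lnorm_pint -poweR_EFin.
    by apply: le_poweR; rewrite ?pint_ge0// invr_ge0 ltW.
  have := le_poweR (ltW p00) (poweR_ge0 _ _) h.
  by rewrite -poweRrM mulVf ?gt_eqF// poweRe1 ?pint_ge0// poweR_EFin mulr1.
have hv : (pint mu a v <= (k `^ a * 1)%:E)%E.
  rewrite mulr1 /k -powRrM mulVf ?gt_eqF// powRr1 ?fine_ge0 ?pint_ge0//.
  by rewrite fineK// ge0_fin_numE// pint_ge0.
have CM0 : 0 <= C' * M `^ p0^-1 by rewrite mulr_ge0// powR_ge0.
have cutT (h : X -> R) : cut h setT = h by apply: cut_id => x /(_ I).
rewrite -[T g]cutT in hT; rewrite -[v]cutT in hv.
have := hoelder_local measurableT mTg mv p00 a0 pa CM0 k0 ler01 hT hv.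
by rewrite /wint mulr1 mulrAC.
Qed.

Lemma wint_lty g : g \in Lfun mu p0%:E -> (wint g < +oo)%E.
Proof.
move=> Lg; have [V0 V00 h] := wint_bounded.
have fin := Lfun_pint p00 Lg.
apply: (le_lt_trans (h g (fine (pint mu p0 g)) Lg _ _)); last exact: ltry.
  by rewrite fine_ge0// pint_ge0.
by rewrite fineK// ge0_fin_numE// pint_ge0.
Qed.

Lemma wint_fin_num g : g \in Lfun mu p0%:E -> wint g \is a fin_num.
Proof.
move=> Lg; rewrite ge0_fin_numE ?wint_lty//.
by apply: integral_ge0 => x _; rewrite lee_fin mulr_ge0.
Qed.

Let mTv g : g \in Lfun mu p0%:E -> measurable_fun setT (fun x => (`|T g x| * `|v x|)%:E).
Proof.
move=> Lg; have [C hC] := hTbnd; have mTg := Lfun_measurable (hC g Lg).1.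
by apply/measurable_EFinP; apply: measurable_funM; exact: measurableT_comp.
Qed.

Let Tv0 g x : setT x -> (0 <= (`|T g x| * `|v x|)%:E)%E.
Proof. by move=> _; rewrite lee_fin mulr_ge0. Qed.

(** The functional [l] plays the part of the adjoint of [T] applied to [v]. *)
Lemma exists_adjoint f : f \in Lfun mu p0%:E -> exists l : (X -> R) -> R, [/\
    forall c g h, g \in Lfun mu p0%:E -> h \in Lfun mu p0%:E ->
      l (fun x => c * g x + h x) = c * l g + l h,
    forall g, g \in Lfun mu p0%:E -> ((l g)%:E <= wint g)%E & (l f)%:E = wint f].
Proof.
move=> Lf; have [hadd hmul] := hTsub.
have [||//|l [lin dom lf]] := @supporting_functional _ _ _ mu p0%:E (fun g => fine (wint g)) f p0_ge1.
- move=> g h Lg Lh; have Lgh := Lfun_add p0_ge1 Lg Lh.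
  rewrite -lee_fin EFinD !fineK ?wint_fin_num// /wint.
  rewrite -(ge0_integralD mu measurableT (Tv0 g) (mTv Lg) (Tv0 h) (mTv Lh)).
  apply: (ae_ge0_le_integral measurableT (Tv0 _) (mTv Lgh)).
  + by move=> x _; rewrite adde_ge0// lee_fin mulr_ge0.
  + by apply: emeasurable_funD; exact: mTv.
  apply: filterS (hadd g h Lg Lh) => x hx _.
  by rewrite -EFinD lee_fin -mulrDl ler_wpM2r.
- move=> t g t0 Lg; have Ltg := Lfun_mull t p0_ge1 Lg.
  have t0' : (0 <= t%:E)%E by rewrite lee_fin ltW.
  rewrite -lee_fin EFinM !fineK ?wint_fin_num// /wint.
  rewrite -(ge0_integralZl mu measurableT (mTv Lg) (Tv0 g) t0').
  apply: (ae_ge0_le_integral measurableT (Tv0 _) (mTv Ltg)).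
  + by move=> x _; rewrite mule_ge0// lee_fin mulr_ge0.
  + by apply: measurable_funeM; exact: mTv.
  apply: filterS (hmul t g Lg) => x hx _.
  by rewrite -EFinM lee_fin mulrA hx gtr0_norm.
exists l; split => //.
- by move=> g Lg; rewrite -[wint g]fineK ?wint_fin_num// lee_fin; exact: dom.
- by rewrite lf fineK// wint_fin_num.
Qed.

Context (l : (X -> R) -> R).
Hypothesis l_lin : forall c g h, g \in Lfun mu p0%:E -> h \in Lfun mu p0%:E ->
  l (fun x => c * g x + h x) = c * l g + l h.
Hypothesis l_le : forall g, g \in Lfun mu p0%:E -> ((l g)%:E <= wint g)%E.

Lemma adjoint_add g h : g \in Lfun mu p0%:E -> h \in Lfun mu p0%:E ->
  l (fun x => g x + h x) = l g + l h.
Proof.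
move=> Lg Lh; rewrite -[l g]mul1r -l_lin//; congr l; apply/funext => x.
by rewrite mul1r.
Qed.

Lemma adjoint0 : l (fun=> 0) = 0.
Proof.
have L0 := Lfun_cst0 mu p0_ge1; have := adjoint_add L0 L0.
rewrite (_ : (fun _ => 0 + 0) = (fun=> 0 : R)); last by apply/funext => x; rewrite addr0.
lra.
Qed.

Lemma adjoint_mull c g : g \in Lfun mu p0%:E -> l (fun x => c * g x) = c * l g.
Proof.
move=> Lg; rewrite -[RHS]addr0 -adjoint0 -l_lin//; last exact: Lfun_cst0.
by congr l; apply/funext => x; rewrite addr0.
Qed.

Lemma adjoint_bounded : exists2 V0 : R, 0 <= V0 & forall g (M : R),
  g \in Lfun mu p0%:E -> 0 <= M -> (pint mu p0 g <= M%:E)%E ->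
  l g <= V0 * M `^ p0^-1.
Proof.
have [V0 V00 h] := wint_bounded; exists V0 => // g M Lg M0 hM.
rewrite -lee_fin; exact: le_trans (l_le Lg) (h g M Lg M0 hM).
Qed.

(** Continuity of [l] for the norm of [L^p0], in the form of dominated
    convergence. *)
Lemma adjoint_cut_cvg (A : (set X)^nat) w (eps : R) : w \in Lfun mu p0%:E ->
  (forall k, measurable (A k)) -> nondecreasing_seq A ->
  (forall x, w x != 0 -> exists k, A k x) -> 0 < eps ->
  exists k, forall j, (k <= j)%N -> l w <= l (cut w (A j)) + eps.
Proof.
move=> Lw mA ndA wA eps0; have mw := Lfun_measurable Lw.
have [V0 V00 hV] := adjoint_bounded.
pose del := (eps / (V0 + 1)) `^ p0.
have V1 : 0 < V0 + 1 by lra.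
have del0 : 0 < del by rewrite powR_gt0// divr_gt0.
have mcA k : measurable (~` A k) by exact: measurableC.
have Lc k : cut w (A k) \in Lfun mu p0%:E by exact: Lfun_cut.
have LcC k : cut w (~` A k) \in Lfun mu p0%:E by exact: Lfun_cut.
have cvg0 : (pint mu p0 (cut w (~` A k)) @[k --> \oo] --> 0)%E.
  rewrite (_ : 0%E = (\int[mu]_x (cst 0 x))%E); last by rewrite integral0.
  apply: (@dominated_cvg _ _ _ mu setT _ _ _ (fun x => (`|w x| `^ p0)%:E)) => //.
  - by move=> k; apply: measurable_pow; exact: measurable_cut.
  - move=> x _; apply: cvg_near_cst.
    have [wx|/wA[k Ak]] := eqVneq (w x) 0.
      by apply: nearW => k; rewrite /cut wx mul0r normr0 powR0// gt_eqF.
    near=> j; rewrite cut_out ?normr0 ?powR0 ?gt_eqF// => /=; apply.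
    have kj : (k <= j)%N by near: j; exact: nbhs_infty_ge.
    by have /subsetPset := ndA _ _ kj; apply.
  - apply/integrableP; split; first exact: measurable_pow.
    under eq_integral do rewrite gee0_abs ?lee_fin ?powR_ge0//.
    exact: Lfun_pint.
  - move=> n x _; rewrite gee0_abs ?lee_fin ?powR_ge0// ge0_ler_powR ?nnegrE ?(ltW p00)//.
    rewrite /cut normrM indicE; case: (_ \in _); rewrite ?normr1 ?mulr1//.
    by rewrite normr0 mulr0.
have [k hk] : exists k, forall j, (k <= j)%N -> (pint mu p0 (cut w (~` A j)) < del%:E)%E.
  have /fine_cvgP[finA cvgA] := cvg0.
  have /cvgrPdist_lt /(_ del del0) near0 := cvgA.
  have [k _ hk] : \forall j \near \oo, (pint mu p0 (cut w (~` A j)) < del%:E)%E.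
    near=> j; have fj : pint mu p0 (cut w (~` A j)) \is a fin_num by near: j.
    rewrite -(fineK fj) lte_fin; apply: le_lt_trans (ler_norm _) _.
    by rewrite -normrN -[X in `|X|]add0r; near: j.
  by exists k => j kj; apply: hk.
exists k => j kj.
have -> : l w = l (cut w (A j)) + l (cut w (~` A j)).
  rewrite -adjoint_add//; congr l; apply/funext => x.
  have [Ax|Ax] := pselect (A j x); first by rewrite cut_in// cut_out ?addr0//; apply.
  by rewrite cut_out// cut_in ?add0r.
rewrite lerD2l; apply: (le_trans (hV _ del (LcC j) (ltW del0) (ltW (hk j kj)))).
rewrite /del -powRrM mulfV ?gt_eqF// powRr1 ?divr_ge0 ?(ltW eps0) ?(ltW V1)//.
by rewrite mulrCA ler_piMr ?(ltW eps0)// ler_pdivrMr// mul1r; lra.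
Unshelve. all: by end_near. Qed.

(** If [l] is integration against [h], this says that the average of [|h|] of
    order [beta'] over [P] exceeds [lam], the test functions giving the dual
    norm. *)
Definition large (lam : R) P := exists2 g, test P g & lam * vol P < l g.

Lemma not_large lam P g : ~ large lam P -> test P g -> l g <= lam * vol P.
Proof. by move=> h tg; rewrite leNgt; apply/negP => ?; apply: h; exists g. Qed.

(** On each corona [g - B P g] is a multiple of a test function of a dilate of
    [P]; [B P g] is paired with [v] instead. *)
Lemma adjoint_test P g (lam kap rho : R) : test P g -> 0 < lam -> 0 <= kap ->
  0 < rho -> (pint mu s1 g <= (rho `^ s1 * vol P)%:E)%E ->
  (forall j, ~ large lam (dyadic j.+1 P)) ->
  (forall j, \int[mu]_(x in bset (dyadic j.+1 P)) (`|v x| `^ a)%:E <=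
     (kap `^ a * vol (dyadic j.+1 P))%:E)%E ->
  l g <= D * Gam * (kap + lam * rho) * vol P.
Proof.
move=> tg lam0 kap0 rho0 hg nlarge hv.
have LB := test_B_Lp0 tg; have Lu := test_sub_Lp0 tg.
set u := fun x => g x - B P g x in Lu.
have -> : l g = l (B P g) + l u.
  by rewrite -adjoint_add//; congr l; apply/funext => x; rewrite /u addrC subrK.
have lB : l (B P g) <= D * Gam * kap * vol P.
  rewrite -lee_fin; apply: (le_trans (l_le LB)).
  exact: (test_TB_weighted tg mv a0 pa kap0 hv).
have Lcut (A : set X) : measurable A -> cut u A \in Lfun mu p0%:E by move=> mA; exact: Lfun_cut.
have lcorona j : l (cut u (corona d j P)) <= D * gam j * (lam * rho) * vol P.
  have c0 : 0 < off_coef j P * rho by rewrite mulr_gt0// off_coef_gt0.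
  have := not_large (nlarge j) (test_IB j tg rho0 hg).
  rewrite adjoint_mull ?Lcut// ler_pdivrMl// => /le_trans; apply.
  have := ler_wpM2l (mulr_ge0 (ltW lam0) (ltW rho0)) (off_coef_vol j P); lra.
have linner k : l (cut u (inner d P k)) <= \sum_(j < k) D * gam j * (lam * rho) * vol P.
  elim: k => [|k IH].
    rewrite big_ord0 (inner0 hX) (_ : cut u set0 = (fun=> 0)) ?adjoint0//.
    by apply/funext => x; rewrite cut_out.
  rewrite big_ord_recr/= (_ : cut u (inner d P k.+1) =
      (fun x => cut u (inner d P k) x + cut u (corona d k P) x)).
    rewrite adjoint_add ?Lcut//; first exact: lerD.
    exact: measurable_inner hX _ _.
  apply/funext => x; rewrite innerS.
  have h : inner d P k x -> corona d k P x -> False.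
    by move=> h1 h2; have : (inner d P k `&` corona d k P) x by []; rewrite inner_corona.
  have [h1|h1] := pselect (inner d P k x).
    by rewrite (cut_out u (h h1)) addr0 !cut_in//; left.
  have [h2|h2] := pselect (corona d k P x).
    by rewrite (cut_out u h1) add0r !cut_in//; right.
  by rewrite !cut_out ?addr0//; case.
have lu : l u <= D * Gam * (lam * rho) * vol P.
  apply/ler_addgt0Pr => eps eps0.
  have [||||k hk] := @adjoint_cut_cvg (inner d P) u eps Lu => //.
  - by move=> k; exact: measurable_inner hX _ _.
  - exact: le_inner.
  - by move=> x _; exact: inner_cover hX P x.
  apply: (le_trans (hk k (leqnn k))); rewrite lerD2r; apply: (le_trans (linner k)).
  rewrite -!mulr_suml ler_wpM2r ?(vol_ge0 hX)// ler_wpM2r ?mulr_ge0 ?(ltW lam0) ?(ltW rho0)//.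
  rewrite -mulr_sumr ler_wpM2l//; exact: le_trans ler01 hD.
by rewrite mulrDr mulrDl; exact: lerD.
Qed.

End weighted.

End off_diagonal.

(** * The good-lambda inequality for packings *)

Section good_lambda.
Context (R : realType) (dX : measure_display) (X : measurableType dX).
Context (d : X -> X -> R) (mu : {measure set X -> \bar R}).
Hypothesis hX : homogeneous_space d mu.
Hypothesis muX : mu [set: X] = +oo%E.
Context (e : nat) (D : R).
Hypothesis (hD : 1 <= D) (hG : geometry d mu e D).
Context (beta : \bar R).
Hypothesis (beta1 : (1 < beta)%E).
Context (p0 s1 s : R).
Hypothesis (p01 : 1 < p0) (p0beta : (p0%:E <= beta)%E).
Hypothesis (s11 : 1 <= s1) (s1beta : (s1%:E <= beta)%E) (s1s : s1 <= s) (s_gt1 : 1 < s).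
Context (v : X -> R) (a : R) (l : (X -> R) -> R) (C0 : R).
Hypothesis (a0 : 0 < a) (C00 : 0 <= C0).
Hypothesis l_lin : forall c g h, g \in Lfun mu p0%:E -> h \in Lfun mu p0%:E ->
  l (fun x => c * g x + h x) = c * l g + l h.
Notation qball := (ball_of R X).
Notation bset := (ball_set d).
Notation vol := (vol d mu).
Notation test P := (admissible mu beta (bset P)).
Notation large := (large d mu beta l).
Implicit Types (P Q : qball) (f g h : X -> R) (i j k : nat) (lam kap rho : R).

Hypothesis key : forall P g lam kap rho, test P g -> 0 < lam -> 0 <= kap ->
  0 < rho -> (pint mu s1 g <= (rho `^ s1 * vol P)%:E)%E ->
  (forall j, ~ large lam (dyadic j.+1 P)) ->
  (forall j, \int[mu]_(x in bset (dyadic j.+1 P)) (`|v x| `^ a)%:E <=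
     (kap `^ a * vol (dyadic j.+1 P))%:E)%E ->
  l g <= C0 * (kap + lam * rho) * vol P.

Let mbset P : measurable (bset P). Proof. exact: measurable_bset hX P. Qed.
Let s0 : 0 < s. Proof. exact: lt_trans s_gt1. Qed.

Definition weight_large kap P : Prop :=
  ((kap `^ a * vol P)%:E < \int[mu]_(x in bset P) (`|v x| `^ a)%:E)%E.

Lemma mu_bigcup_le (t : seq qball) :
  (mu (\bigcup_(Q in [set` t]) bset Q) <= (\sum_(Q <- t) vol Q)%:E)%E.
Proof.
rewrite bigcup_seq; elim: t => [|Q t IH]; first by rewrite !big_nil measure0.
rewrite !big_cons; apply: (le_trans (measureU2 _ _ _)) => //.
  exact: bigsetU_measurable.
by rewrite EFinD -(volE hX) leeD2l.
Qed.

Lemma large_le lam lam' P : lam <= lam' -> large lam' P -> large lam P.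
Proof.
move=> ll [g tg hg]; exists g => //; apply: le_lt_trans hg.
by rewrite ler_wpM2r ?(vol_ge0 hX).
Qed.

Lemma admissible_Lp0 (E : set X) g : measurable E -> (mu E < +oo)%E ->
  admissible mu beta E g -> g \in Lfun mu p0%:E.
Proof. by move=> mE fE; exact: admissible_Lfun (ltW p01) p0beta. Qed.

(** Here the linearity of [l] is indispensable: the seminorm that dominates it
    is not additive over disjoint balls. *)
Lemma large_sum lam (t : seq qball) : disjoint_seq d id t ->
  (forall Q, Q \in t -> large lam Q) ->
  exists2 g, admissible mu beta (\bigcup_(Q in [set` t]) bset Q) g &
    lam * \sum_(Q <- t) vol Q <= l g.
Proof.
elim: t => [|Q t IH] /=.
  move=> _ _; exists (fun=> 0); first exact: admissible0.
  by rewrite big_nil mulr0 (adjoint0 p01 l_lin).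
move=> /andP[/allP disQ dt] Lt.
have [g ag lg] : exists2 g, admissible mu beta (\bigcup_(Q in [set` t]) bset Q) g &
    lam * \sum_(Q <- t) vol Q <= l g.
  by apply: IH => // P Pt; apply: Lt; rewrite inE Pt orbT.
have [h th lh] : large lam Q by apply: Lt; rewrite mem_head.
have mU : measurable (\bigcup_(Q in [set` t]) bset Q).
  by rewrite bigcup_seq; exact: bigsetU_measurable.
have fU : (mu (\bigcup_(Q in [set` t]) bset Q) < +oo)%E.
  exact: le_lt_trans (mu_bigcup_le t) (ltry _).
have fQ : (mu (bset Q) < +oo)%E by rewrite (volE hX) ltry.
exists (fun x => h x + g x).
  rewrite bigcup_seq big_cons -bigcup_seq.
  apply: admissible_add => //.
  rewrite -subset0 => x [Qx [P Pt Px]]; have /asboolP h0 := disQ P Pt.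
  by have : (bset Q `&` bset P) x by []; rewrite h0.
have Lh := admissible_Lp0 (mbset Q) fQ th; have Lg := admissible_Lp0 mU fU ag.
by rewrite big_cons mulrDr (adjoint_add l_lin)//; apply: lerD => //; exact: ltW.
Qed.

Lemma exists_last_large lam M Q : packing_bound d mu (large lam) M ->
  large lam Q -> exists k, large lam (dyadic k Q) /\
    forall j, (k < j)%N -> ~ large lam (dyadic j Q).
Proof.
move=> LM LQ; have [k0 hk0] := vol_unbounded hX Q M muX.
have ex : exists k, `[< large lam (dyadic k Q) >].
  by exists 0%N; apply/asboolP; rewrite dyadic0.
have bd k : `[< large lam (dyadic k Q) >] -> (k <= k0)%N.
  move=> /asboolP /(packing_bound_vol LM) h; rewrite leqNgt; apply/negP => /ltnW kk.
  have := lt_le_trans hk0 (le_trans (le_vol hX (sub_dyadic kk)) h).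
  by rewrite ltxx.
case: (ex_maxnP ex bd) => k /asboolP Lk kmax; exists k; split => // j kj Lj.
by have := kmax j (asboolT Lj); rewrite leqNgt kj.
Qed.

(** The functions that witness largeness on the small balls add up to one that
    is normalized on [W], with an [L^s1] average at most [tau `^ s^-1] if the
    balls fill a proportion [tau] of [W]. The key estimate for this sum leads to
    [K * tau <= 2 * C0 * tau `^ s^-1] as soon as [eta < tau]. *)
Lemma good_ball (W : qball) lam K eta (t : seq qball) : 0 < lam -> 0 < K ->
  0 < eta -> 2 * C0 * eta `^ s^-1 <= K * eta -> disjoint_seq d id t ->
  (forall Q, Q \in t -> large (K * lam) Q) ->
  (forall Q, Q \in t -> bset Q `<=` bset W) ->
  (forall j, ~ large lam (dyadic j.+1 W)) ->
  (forall j, ~ weight_large (lam * eta `^ s^-1) (dyadic j.+1 W)) ->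
  \sum_(Q <- t) vol Q <= eta * vol W.
Proof.
move=> lam0 K0 eta0 hK dt Lt tW nL nW; set x := \sum_(Q <- t) vol Q.
have W0 := vol_gt0 hX W.
rewrite leNgt; apply/negP => xeta.
have x0 : 0 < x by apply: lt_trans xeta; rewrite mulr_gt0.
pose tau := x / vol W; have tau0 : 0 < tau by rewrite divr_gt0.
have etau : eta < tau by rewrite ltr_pdivlMr.
have xE : x = tau * vol W by rewrite /tau divfK// gt_eqF.
have tau1 : tau <= 1.
  rewrite ler_pdivrMr// mul1r -lee_fin -(volE hX).
  exact: (sum_vol_le hX).
have mU : measurable (\bigcup_(Q in [set` t]) bset Q).
  by rewrite bigcup_seq; exact: bigsetU_measurable.
have [g ag lg] := large_sum dt Lt.
have tg : test W g.
  by apply: admissible_sub ag => // y [Q Qt Qy]; exact: (tW Q Qt).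
pose rho := tau `^ s^-1.
have rho0 : 0 < rho by rewrite powR_gt0.
have hg : (pint mu s1 g <= (rho `^ s1 * vol W)%:E)%E.
  apply: (le_trans (admissible_pint beta1 mU s11 s1beta ag)).
  apply: (le_trans (mu_bigcup_le t)); rewrite -/x xE lee_fin ler_pM2r//.
  rewrite /rho -powRrM -[leLHS]powRr1 ?(ltW tau0)//.
  apply: ger_powR; first by rewrite tau0.
  by rewrite mulrC ler_pdivrMr// mul1r.
have kap0 : 0 <= lam * eta `^ s^-1 by rewrite mulr_ge0 ?powR_ge0// ltW.
have hv j : (\int[mu]_(x in bset (dyadic j.+1 W)) (`|v x| `^ a)%:E <=
     ((lam * eta `^ s^-1) `^ a * vol (dyadic j.+1 W))%:E)%E.
  by rewrite leNgt; apply/negP; exact: nW.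
have := key tg lam0 kap0 rho0 hg nL hv.
have sV0 : 0 < s^-1 by rewrite invr_gt0.
have er : eta `^ s^-1 <= rho.
  by apply: ge0_ler_powR; rewrite ?nnegrE ltW.
(* [K * tau <= 2 * C0 * tau `^ s^-1] contradicts [hK], because [eta < tau] *)
pose r := tau / eta; have r1 : 1 < r by rewrite ltr_pdivlMr ?mul1r.
have r0 : 0 < r by exact: lt_trans r1.
have rhoE : rho = eta `^ s^-1 * r `^ s^-1.
  by rewrite /rho -powRM ?(ltW eta0) ?(ltW r0)// /r mulrCA mulfV ?mulr1 ?gt_eqF.
have rs : r `^ s^-1 < r.
  rewrite -[ltRHS]powRr1 ?(ltW r0)// /powR gt_eqF// ltr_expR ltr_pM2r ?ln_gt0//.
  by rewrite invf_lt1.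
have tauE : tau = eta * r by rewrite /r mulrCA mulfV ?mulr1// gt_eqF.
rewrite -/x in lg; move=> /(le_trans lg).
rewrite xE [X in X <= _]mulrA ler_pM2r// => h.
have : K * lam * tau <= lam * (2 * C0 * rho).
  apply: (le_trans h); rewrite -mulrDr mulrCA ler_pM2l// -mulrA mulrCA.
  by rewrite ler_wpM2l//; lra.
rewrite (mulrC K lam) -(mulrA lam K) (ler_pM2l lam0) leNgt => /negP; apply.
rewrite rhoE tauE mulrA [ltRHS]mulrA.
apply: (@le_lt_trans _ _ (K * eta * r `^ s^-1)); first by rewrite ler_wpM2r ?powR_ge0.
by rewrite ltr_pM2l// mulr_gt0.
Qed.

(** Each ball of a packing at level [K * lam] is enlarged to its last dyadic
    dilate that is large at level [lam], and Vitali's selection is applied to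
    these. The balls of the packing near one selected ball fill a proportion at
    most [eta] of its dilate, unless [v] has a large average over some further
    dilate; such exceptional balls are charged to [v]. *)
Lemma good_lambda lam K eta M M' : 0 < lam -> 1 <= K -> 0 < eta ->
  2 * C0 * eta `^ s^-1 <= K * eta ->
  packing_bound d mu (large lam) M ->
  packing_bound d mu (weight_large (lam * eta `^ s^-1)) M' ->
  packing_bound d mu (large (K * lam)) (D * eta * M + D ^+ 2 * M').
Proof.
move=> lam0 K1 eta0 hK LM VM t dt Lt.
have K0 : 0 < K by exact: lt_le_trans K1.
have D0 : 0 <= D by exact: le_trans hD.
have lamK : lam <= K * lam by rewrite ler_peMl// ltW.
have /choice[kf hkf] : forall Q, exists k, Q \in t -> large lam (dyadic k Q) /\
    forall j, (k < j)%N -> ~ large lam (dyadic j Q).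
  move=> Q; have [Qt|] := boolP (Q \in t); last by exists 0%N.
  by have [k hk] := exists_last_large LM (large_le lamK (Lt Q Qt)); exists k.
pose r Q := dyadic (kf Q) Q.
have [u [ut du hu]] := vitali_selection hX hG r t.
pose W Q := dyadic e (r Q).
pose inW Q P := `[< bset P `<=` bset (W Q) >].
pose bad Q := `[< exists j, weight_large (lam * eta `^ s^-1) (dyadic j.+1 (W Q)) >].
have W_le Q : vol (W Q) <= D * vol (r Q) by exact: geo_vol.
have Lr Q : Q \in t -> large lam (r Q) by move=> /hkf[].
have nLW Q : Q \in t -> forall j, ~ large lam (dyadic j.+1 (W Q)).
  move=> /hkf[_ h] j; rewrite /W /r !dyadic_dyadic; apply: h.
  by rewrite addSn addSn ltnS leq_addl.
have step1 : \sum_(Q <- t) vol Q <= \sum_(Q <- u) \sum_(P <- t | inW Q P) vol P.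
  rewrite (exchange_big_dep xpredT)//= big_seq [leRHS]big_seq; apply: ler_sum => P Pt.
  rewrite big_const_seq iter_addr_0.
  have c : (1 <= count (inW^~ P) u)%N.
    rewrite -has_count; apply/hasP; have [Q Qu PQ] := hu P Pt; exists Q => //.
    by apply/asboolP; apply: subset_trans PQ; exact: sub_dyadicr.
  have := ler_wpMn2l (vol_ge0 hX P) c; by rewrite mulr1n.
have step2 Q : Q \in u -> \sum_(P <- t | inW Q P) vol P <=
    eta * vol (W Q) + (if bad Q then vol (W Q) else 0).
  move=> Qu; rewrite -big_filter.
  have dt' : disjoint_seq d id [seq P <- t | inW Q P].
    by apply: subseq_pairwise dt; exact: filter_subseq.
  have inW' P : P \in [seq P <- t | inW Q P] -> P \in t /\ bset P `<=` bset (W Q).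
    by rewrite mem_filter => /andP[/asboolP].
  case: ifPn => [_|/asboolP nbad].
    apply: (@le_trans _ _ (vol (W Q))); last by rewrite lerDr mulr_ge0 ?(ltW eta0) ?(vol_ge0 hX).
    rewrite -lee_fin -(volE hX); apply: (sum_vol_le hX) => //.
    by move=> P /inW'[].
  rewrite addr0; apply: (good_ball lam0 K0 eta0 hK dt') => //.
  - by move=> P /inW'[/Lt].
  - by move=> P /inW'[].
  - exact: nLW (ut _ Qu).
  - by move=> j hj; apply: nbad; exists j.
apply: (le_trans step1); apply: (@le_trans _ _
  (\sum_(Q <- u) (eta * vol (W Q) + (if bad Q then vol (W Q) else 0)))).
  by rewrite big_seq [leRHS]big_seq; apply: ler_sum.
rewrite big_split/=; apply: lerD.
  rewrite -mulr_sumr (mulrC D) -mulrA ler_pM2l//.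
  apply: (@le_trans _ _ (\sum_(Q <- u) D * vol (r Q))); first exact: ler_sum.
  rewrite -mulr_sumr ler_wpM2l//.
  have := LM (map r u); rewrite disjoint_seq_map big_map; apply => //.
  by move=> _ /mapP[Q Qu ->]; apply: Lr; exact: ut.
rewrite -big_mkcond/= expr2 -mulrA.
apply: (@le_trans _ _ (\sum_(Q <- u | bad Q) D * vol (r Q))); first exact: ler_sum.
rewrite -mulr_sumr ler_wpM2l// -big_filter.
have /choice[jf hjf] : forall Q, exists j, bad Q ->
    weight_large (lam * eta `^ s^-1) (dyadic j.+1 (W Q)).
  move=> Q; have [/asboolP[j hj]|] := boolP (bad Q); first by exists j.
  by exists 0%N.
apply: (packing_bound_sub hX hD hG (W := fun Q => dyadic (jf Q).+1 (W Q)) VM).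
- by apply: subseq_pairwise du; exact: filter_subseq.
- by move=> Q _; rewrite /W dyadic_dyadic; exact: sub_dyadicr.
- by move=> Q; rewrite mem_filter => /andP[/hjf].
Qed.

End good_lambda.

(** * Summing over the levels *)

Section packing_mass.
Context (R : realType) (dX : measure_display) (X : measurableType dX).
Context (d : X -> X -> R) (mu : {measure set X -> \bar R}).
Hypothesis hX : homogeneous_space d mu.
Notation qball := (ball_of R X).
Notation bset := (ball_set d).
Notation vol := (vol d mu).
Notation packing_bound := (packing_bound d mu).
Implicit Types (L : qball -> Prop).

Definition packing_mass L : R := sup [set x | exists t : seq qball,
  [/\ disjoint_seq d id t, forall Q, Q \in t -> L Q & x = \sum_(Q <- t) vol Q]].

Lemma packing_mass_bound L M : packing_bound L M -> packing_bound L (packing_mass L).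
Proof.
move=> LM t dt Lt; apply: ub_le_sup; last by exists t.
by exists M => _ [t' [dt' Lt' ->]]; exact: LM.
Qed.

Lemma packing_mass_le L M : packing_bound L M -> packing_mass L <= M.
Proof.
move=> LM; apply: ge_sup; first by exists 0, [::]; split=> //; rewrite big_nil.
by move=> _ [t' [dt' Lt' ->]]; exact: LM.
Qed.

Lemma packing_mass_ge0 L M : packing_bound L M -> 0 <= packing_mass L.
Proof. by move=> /packing_mass_bound/packing_bound_ge0. Qed.

Lemma sum_integral_le (t : seq qball) (E : set X) (h : X -> \bar R) :
  measurable E -> measurable_fun setT h -> (forall x, 0 <= h x)%E ->
  disjoint_seq d id t -> (forall Q, Q \in t -> bset Q `<=` E) ->
  (\sum_(Q <- t) \int[mu]_(x in bset Q) h x <= \int[mu]_(x in E) h x)%E.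
Proof.
move=> + mh h0; elim: t E => [|Q t IH] E mE.
  by rewrite big_nil => _ _; exact: integral_ge0.
move=> /=/andP[/allP dis dt] tE; rewrite big_cons.
have mQ : measurable (bset Q) := measurable_bset hX Q.
have mEQ : measurable (E `\` bset Q) by exact: measurableD.
have QE : bset Q `<=` E by apply: tE; rewrite mem_head.
rewrite (_ : E = bset Q `|` (E `\` bset Q)); last by rewrite setDUK.
rewrite ge0_integral_setU//; last 2 first.
- exact: measurable_funTS.
- by apply/disj_setPS; rewrite setDIK.
apply: leeD => //; apply: IH => // P Pt x Px; split.
  by apply: (tE P) => //; rewrite inE Pt orbT.
move=> Qx; have /asboolP h' := dis _ Pt.
by have : (bset Q `&` bset P) x by []; rewrite h'.
Qed.

Section weight.
Context (v : X -> R) (a : R).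
Hypothesis (mv : measurable_fun setT v) (a1 : 1 <= a) (vfin : (pint mu a v < +oo)%E).

Let a0 : 0 < a. Proof. exact: lt_le_trans a1. Qed.

Definition above kap : set X := [set x | kap < `|v x|].

Definition tail kap : R := fine (pint mu a (cut v (above kap))).

Lemma measurable_above kap : measurable (above kap).
Proof.
rewrite (_ : above kap = setT `&` (fun x => `|v x|) @^-1` `]kap, +oo[).
  by apply: measurableT_comp.
by apply/seteqP; split => x; rewrite /above/= in_itv/= andbT => //; case.
Qed.

Lemma tailE kap : (tail kap)%:E = pint mu a (cut v (above kap)).
Proof.
apply: fineK; rewrite (ge0_fin_numE (pint_ge0 _ _ _)); apply: le_lt_trans vfin.
by apply: le_pint_cut => //; [exact: ltW|exact: measurable_above].
Qed.

(** The weak type bound for averages of [v]: where the average exceeds [kap],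
    at least half of it comes from values above [kap / 2]. *)
Lemma weight_packing kap : 0 < kap ->
  packing_bound (weight_large d mu v a kap) (2 * kap `^ (- a) * tail (kap / 2)).
Proof.
move=> kap0 t dt Vt; set w := cut v (above (kap / 2)).
have mw : measurable_fun setT w by exact/measurable_cut/measurable_above.
have ka0 : 0 < kap `^ a by rewrite powR_gt0.
have half : (kap / 2) `^ a <= kap `^ a / 2.
  rewrite powRM ?(ltW kap0)// ler_pM2l// -[leRHS]powRr1//.
  by apply: ger_powR => //; rewrite invr_gt0 ltr0n invf_le1 ?ler1n.
have one Q : Q \in t -> ((kap `^ a / 2 * vol Q)%:E <= \int[mu]_(x in bset Q) (`|w x| `^ a)%:E)%E.
  move=> /Vt hQ; have mQ := measurable_bset hX Q.
  have mpow (u : X -> R) : measurable_fun setT u -> measurable_fun (bset Q) (fun x => (`|u x| `^ a)%:E).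
    by move=> mu_; apply: measurable_funTS; exact: measurable_pow.
  have : (\int[mu]_(x in bset Q) (`|v x| `^ a)%:E <=
      \int[mu]_(x in bset Q) (((kap / 2) `^ a)%:E + (`|w x| `^ a)%:E))%E.
    apply: (ge0_le_integral mu mQ _ (mpow v mv)).
    - by move=> x _; rewrite lee_fin powR_ge0.
    - by apply: emeasurable_funD; [exact: measurable_cst|exact: mpow].
    move=> x _; rewrite -EFinD lee_fin; have [hx|hx] := ltP (kap / 2) `|v x|.
      by rewrite /w cut_in// lerDr powR_ge0.
    rewrite (@le_trans _ _ ((kap / 2) `^ a))// ?lerDl ?powR_ge0//.
    by apply: ge0_ler_powR; rewrite ?nnegrE ?(ltW a0)// divr_ge0 ?ltW.
  have c0 x : bset Q x -> (0 <= ((kap / 2) `^ a)%:E)%E by move=> _; rewrite lee_fin powR_ge0.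
  have w0 x : bset Q x -> (0 <= (`|w x| `^ a)%:E)%E by move=> _; rewrite lee_fin powR_ge0.
  rewrite (ge0_integralD mu mQ c0 (measurable_cst _) w0 (mpow w mw)).
  rewrite (integral_cst mu mQ) (volE hX) -EFinM => /(lt_le_trans hQ) h.
  have : ((kap `^ a * vol Q)%:E <= (kap `^ a / 2 * vol Q)%:E + \int[mu]_(x in bset Q) (`|w x| `^ a)%:E)%E.
    apply: (le_trans (ltW h)); apply: leeD; last exact: lexx.
    by have := ler_wpM2r (vol_ge0 hX Q) half; rewrite -lee_fin.
  rewrite (_ : kap `^ a * vol Q = kap `^ a / 2 * vol Q + kap `^ a / 2 * vol Q); last by field.
  by rewrite EFinD leeD2lE.
have : (\sum_(Q <- t) (kap `^ a / 2 * vol Q)%:E <= (tail (kap / 2))%:E)%E.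
  rewrite tailE; apply: (@le_trans _ _ (\sum_(Q <- t) \int[mu]_(x in bset Q) (`|w x| `^ a)%:E)%E).
    rewrite [X in (X <= _)%E]big_seq [X in (_ <= X)%E]big_seq.
    by apply: lee_sum => Q Qt; exact: one.
  by apply: sum_integral_le => //; exact: measurable_pow.
rewrite sumEFin lee_fin -mulr_sumr => h.
rewrite powRN (_ : 2 * _ * _ = (kap `^ a / 2)^-1 * tail (kap / 2)).
  by rewrite ler_pdivlMl// divr_gt0.
by rewrite invf_div.
Qed.

End weight.
End packing_mass.

Section geometric_levels.
Context (R : realType).
Implicit Types (x w b : nat -> R) (K t : R).

Lemma doubling_sum x : (forall n, 0 <= x n) -> (forall n, 2 * x n <= x n.+1) ->
  forall n, \sum_(i < n.+1) x i <= 2 * x n.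
Proof.
move=> x0 x2; elim=> [|n IH]; first by rewrite big_ord1; have := x0 0%N; lra.
by rewrite big_ord_recr/=; have := x2 n; lra.
Qed.

(** Summing the recursion absorbs half of the sum into itself. *)
Lemma absorb_sum w b n : (forall n, 0 <= w n) ->
  (forall n, w n.+1 <= w n / 2 + b n) ->
  \sum_(i < n) w i <= 2 * (w 0%N + \sum_(i < n) b i).
Proof.
move=> w0 wb; suff : \sum_(i < n) w i + 2 * w n <= 2 * (w 0%N + \sum_(i < n) b i).
  by have := w0 n; lra.
elim: n => [|n IH]; first by rewrite !big_ord0; lra.
by rewrite !big_ord_recr/=; have := wb n; lra.
Qed.

Definition level t K n := t * K ^+ n.

Lemma level_gt0 t K n : 0 < t -> 0 < K -> 0 < level t K n.
Proof. by move=> t0 K0; rewrite mulr_gt0// exprn_gt0. Qed.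

Lemma levelS t K n : level t K n.+1 = K * level t K n.
Proof. by rewrite /level exprS mulrCA. Qed.

Lemma level_powR t K (th : R) n : 0 < t -> 0 < K -> 2 <= K `^ th ->
  2 * level t K n `^ th <= level t K n.+1 `^ th.
Proof.
move=> t0 K0 K2; rewrite levelS powRM ?(ltW K0) ?(ltW (level_gt0 _ t0 K0))//.
by rewrite ler_wpM2r ?powR_ge0.
Qed.

Lemma exists_large_powR (A : R) (th : R) : 0 < th ->
  exists2 K0, 1 <= K0 & forall K, K0 <= K -> A <= K `^ th.
Proof.
move=> th0; pose A' := Num.max A 1.
have A1 : 1 <= A' by rewrite le_max lexx orbT.
have A0 : 0 < A' by exact: lt_le_trans A1.
exists (A' `^ th^-1) => [|K hK].
  rewrite -(powRr0 A'); apply: ler_powR => //; rewrite invr_ge0 ltW//.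
apply: (@le_trans _ _ A'); first by rewrite le_max lexx.
have thV : th^-1 * th = 1 by rewrite mulVf// gt_eqF.
rewrite -[leLHS](powRr1 (ltW A0)) -[X in A' `^ X]thV powRrM.
apply: ge0_ler_powR; rewrite ?nnegrE ?powR_ge0 ?(ltW th0)//.
exact: le_trans (powR_ge0 _ _) hK.
Qed.

End geometric_levels.

Section tail_sum.
Context (R : realType) (dX : measure_display) (X : measurableType dX).
Context (mu : {measure set X -> \bar R}).
Context (v : X -> R) (a q K c : R).
Hypothesis (mv : measurable_fun setT v) (a1 : 1 <= a) (vfin : (pint mu a v < +oo)%E).
Hypothesis (aq : a < q) (K1 : 1 <= K) (K2 : 2 <= K `^ (q - a)) (c0 : 0 < c).

Let a0 : 0 < a. Proof. exact: lt_le_trans a1. Qed.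
Let K0 : 0 < K. Proof. exact: lt_le_trans K1. Qed.
Let th0 : 0 <= q - a. Proof. by rewrite subr_ge0 ltW. Qed.

Lemma tail_sum_pointwise (t : R) x n : 0 < t ->
  \sum_(i < n) level t K i `^ (q - a) * `|cut v (above v (c * level t K i / 2)) x| `^ a
  <= 2 * (2 / c) `^ (q - a) * `|v x| `^ q.
Proof.
move=> t0; set z := `|v x|.
have z0 : 0 <= z by exact: normr_ge0.
have rhs0 : 0 <= 2 * (2 / c) `^ (q - a) * z `^ q by rewrite !mulr_ge0 ?powR_ge0.
elim: n => [|n IH]; first by rewrite big_ord0.
have [hz|hz] := ltP (c * level t K n / 2) z; last first.
  rewrite big_ord_recr/= cut_out ?normr0 ?powR0 ?mulr0 ?addr0 ?gt_eqF//.
  by rewrite /above/= -/z ltNge hz.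
have L0 i := level_gt0 i t0 K0.
have z_gt0 : 0 < z by apply: lt_trans hz; rewrite divr_gt0// mulr_gt0.
apply: (@le_trans _ _ (\sum_(i < n.+1) level t K i `^ (q - a) * z `^ a)).
  apply: ler_sum => i _; rewrite ler_wpM2l ?powR_ge0// ge0_ler_powR ?nnegrE ?(ltW a0)//.
  rewrite /cut normrM indicE; case: (_ \in _); rewrite ?normr1 ?mulr1//.
  by rewrite normr0 mulr0.
rewrite -mulr_suml.
have dbl := doubling_sum (fun n => powR_ge0 (level t K n) (q - a))
  (fun n => level_powR n t0 K0 K2) n.
apply: (@le_trans _ _ (2 * level t K n `^ (q - a) * z `^ a)).
  by rewrite ler_wpM2r ?powR_ge0.
have -> : z `^ q = z `^ (q - a) * z `^ a.
  by rewrite -powRD ?subrK//; apply/implyP => _; rewrite gt_eqF.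
rewrite mulrA ler_wpM2r ?powR_ge0// -mulrA ler_wpM2l//.
rewrite -powRM ?divr_ge0 ?(ltW c0)//; apply: ge0_ler_powR => //.
- by rewrite nnegrE ltW.
- by rewrite nnegrE mulr_ge0// divr_ge0// ltW.
by rewrite mulrAC ler_pdivlMr//; lra.
Qed.

(** Exchanging sum and integral, each value [|v x|] meets the levels below a
    multiple of it, and their powers form a geometric sum. *)
Lemma tail_sum (t : R) n (V : R) : 0 < t -> (pint mu q v <= V%:E)%E ->
  \sum_(i < n) level t K i `^ (q - a) * tail mu v a (c * level t K i / 2)
  <= 2 * (2 / c) `^ (q - a) * V.
Proof.
move=> t0 hV; set C := 2 * (2 / c) `^ (q - a).
have C0 : 0 <= C by rewrite mulr_ge0 ?powR_ge0.
pose F i x := (level t K i `^ (q - a) * `|cut v (above v (c * level t K i / 2)) x| `^ a)%:E.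
have mpow i : measurable_fun setT (fun x => (`|cut v (above v (c * level t K i / 2)) x| `^ a)%:E).
  by apply: measurable_pow; apply: measurable_cut => //; exact: measurable_above.
have mF i : measurable_fun setT (F i).
  rewrite /F; under eq_fun do rewrite EFinM; exact: measurable_funeM.
have F0 i x : (0 <= F i x)%E by rewrite lee_fin mulr_ge0 ?powR_ge0.
rewrite -lee_fin -sumEFin.
apply: (@le_trans _ _ (\sum_(i < n) \int[mu]_x F i x)%E).
  apply: lee_sum => i _; rewrite EFinM (tailE mv a1 vfin).
  rewrite -(ge0_integralZl mu measurableT (mpow i))// ?lee_fin ?powR_ge0//.
rewrite -ge0_integral_sum//.
apply: (@le_trans _ _ (C%:E * pint mu q v)%E); last first.
  by rewrite [leRHS]EFinM lee_wpmul2l.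
have q0 : 0 <= q by rewrite ltW// (lt_trans a0).
rewrite -(ge0_integralZl mu measurableT (measurable_pow q mv))//.
apply: ge0_le_integral => //.
- by move=> x _; exact: sume_ge0.
- exact: emeasurable_sum.
- by apply: measurable_funeM; exact: measurable_pow.
by move=> x _; rewrite sumEFin -EFinM lee_fin; exact: tail_sum_pointwise.
Qed.

End tail_sum.

(** * The bound for the adjoint functional *)

Section adjoint_bound.
Context (R : realType) (dX : measure_display) (X : measurableType dX).
Context (d : X -> X -> R) (mu : {measure set X -> \bar R}).
Hypothesis hX : homogeneous_space d mu.
Hypothesis muX : mu [set: X] = +oo%E.
Context (e : nat) (D : R).
Hypothesis (hD : 1 <= D) (hG : geometry d mu e D).
Context (beta : \bar R).
Hypothesis (beta1 : (1 < beta)%E).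
Context (p0 s1 s a p q : R).
Hypothesis (p01 : 1 < p0) (p0beta : (p0%:E <= beta)%E).
Hypothesis (s11 : 1 <= s1) (s1beta : (s1%:E <= beta)%E) (s1s : s1 <= s) (s_gt1 : 1 < s).
Hypothesis (a1 : 1 <= a) (pa : p0^-1 + a^-1 = 1).
Hypothesis (p0' : 0 < p) (pq : p^-1 + q^-1 = 1) (aq : a < q).
Context (C0 K : R).
Hypothesis (C00 : 0 <= C0) (Kge2 : 2 <= K) (Ka : 2 <= K `^ (q - a)) (Kq : 2 <= K `^ (q - 1)).
Let eta : R := (2 * D * K `^ q)^-1.
Hypothesis Keta : 2 * C0 * eta `^ s^-1 <= K * eta.
Context (v : X -> R) (l : (X -> R) -> R) (V0 : R).
Hypothesis (mv : measurable_fun setT v) (vfin : (pint mu a v < +oo)%E).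
Hypothesis (v1 : (pint mu q v <= 1)%E).
Hypothesis l_lin : forall c g h, g \in Lfun mu p0%:E -> h \in Lfun mu p0%:E ->
  l (fun x => c * g x + h x) = c * l g + l h.
Hypothesis (V00 : 0 <= V0).
Hypothesis l_bounded : forall g (M : R), g \in Lfun mu p0%:E -> 0 <= M ->
  (pint mu p0 g <= M%:E)%E -> l g <= V0 * M `^ p0^-1.
Notation qball := (ball_of R X).
Notation bset := (ball_set d).
Notation vol := (vol d mu).
Notation test P := (admissible mu beta (bset P)).
Notation large := (large d mu beta l).
Implicit Types (P Q : qball) (f g h w : X -> R) (i j k m n : nat) (lam kap rho t : R).

Hypothesis key : forall P g lam kap rho, test P g -> 0 < lam -> 0 <= kap ->
  0 < rho -> (pint mu s1 g <= (rho `^ s1 * vol P)%:E)%E ->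
  (forall j, ~ large lam (dyadic j.+1 P)) ->
  (forall j, \int[mu]_(x in bset (dyadic j.+1 P)) (`|v x| `^ a)%:E <=
     (kap `^ a * vol (dyadic j.+1 P))%:E)%E ->
  l g <= C0 * (kap + lam * rho) * vol P.

Let mbset P : measurable (bset P). Proof. exact: measurable_bset hX P. Qed.
Let muT0 : (0 < mu setT)%E. Proof. by rewrite muX. Qed.
Let p00 : 0 < p0. Proof. exact: lt_trans p01. Qed.
Let a0 : 0 < a. Proof. exact: lt_le_trans a1. Qed.
Let q0 : 0 < q. Proof. exact: lt_trans aq. Qed.
Let K1 : 1 <= K. Proof. by apply: le_trans Kge2; lra. Qed.
Let K0 : 0 < K. Proof. exact: lt_le_trans K1. Qed.
Let D0 : 0 < D. Proof. exact: lt_le_trans hD. Qed.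
Let eta0 : 0 < eta. Proof. by rewrite invr_gt0 !mulr_gt0// powR_gt0. Qed.
Let p0_ge1 : (1 <= p0%:E)%E. Proof. by rewrite lee_fin ltW. Qed.

Let c := eta `^ s^-1.
Let c0 : 0 < c. Proof. exact: powR_gt0. Qed.

Definition mass lam : R := packing_mass d mu (large lam).

(** The weak type bound of order [a] that comes from the boundedness of [l] on
    [L^p0]. It makes the packing masses finite, and small at low levels once
    they are weighted by the [q]-th power of the level. *)
Lemma large_packing lam : 0 < lam -> packing_bound d mu (large lam) ((V0 / lam) `^ a).
Proof.
move=> lam0 t dt Lt; set x := \sum_(Q <- t) vol Q.
have mU : measurable (\bigcup_(Q in [set` t]) bset Q).
  by rewrite bigcup_seq; exact: bigsetU_measurable.
have fU : (mu (\bigcup_(Q in [set` t]) bset Q) < +oo)%E.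
  exact: le_lt_trans (mu_bigcup_le hX t) (ltry _).
have [g ag lg] := large_sum hX beta1 p01 p0beta l_lin dt Lt.
have Lg := admissible_Lp0 beta1 p01 p0beta mU fU ag.
have x0 : 0 <= x by apply: sumr_ge0 => Q _; exact: vol_ge0.
have hg : (pint mu p0 g <= x%:E)%E.
  exact: le_trans (admissible_pint beta1 mU (ltW p01) p0beta ag) (mu_bigcup_le hX t).
have := le_trans lg (l_bounded Lg x0 hg); rewrite -/x.
have [->|xn0] := eqVneq x 0; first by rewrite powR_ge0.
have {}x0 : 0 < x by rewrite lt_neqAle eq_sym xn0.
have xE : x = x `^ a^-1 * x `^ p0^-1.
  by rewrite -powRD addrC pa ?powRr1 ?(ltW x0)// oner_eq0.
rewrite [X in lam * X]xE mulrA ler_pM2r ?powR_gt0// => h.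
have {}h : x `^ a^-1 <= V0 / lam by rewrite ler_pdivlMr// mulrC.
have aV : a^-1 * a = 1 by rewrite mulVf// gt_eqF.
rewrite -[leLHS](powRr1 (ltW x0)) -[X in x `^ X]aV powRrM.
by apply: ge0_ler_powR; rewrite ?nnegrE ?powR_ge0 ?divr_ge0 ?(ltW a0) ?(ltW lam0).
Qed.

Lemma mass_packing lam : 0 < lam -> packing_bound d mu (large lam) (mass lam).
Proof. by move=> /large_packing/packing_mass_bound. Qed.

Lemma mass_ge0 lam : 0 < lam -> 0 <= mass lam.
Proof. by move=> /large_packing/packing_mass_ge0. Qed.

Definition weight_const : R := 2 * c `^ (- a) * (2 * (2 / c) `^ (q - a)).

Definition mass_const : R := 2 * (1 + D ^+ 2 * K `^ q * weight_const).

(** The strong type bound at the exponent [q]: [eta] is chosen so that, after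
    weighting by the [q]-th power of the level, the good-lambda inequality keeps
    at most one half of the mass of the preceding level. *)
Lemma level_mass_sum t n : 0 < t -> V0 `^ a * t `^ (q - a) <= 1 ->
  \sum_(i < n) level t K i `^ q * mass (level t K i) <= mass_const.
Proof.
move=> t0 ht; have L0 i : 0 < level t K i := level_gt0 i t0 K0.
pose Psi i := 2 * (level t K i * c) `^ (- a) * tail mu v a (level t K i * c / 2).
pose w i := level t K i `^ q * mass (level t K i).
pose b i := D ^+ 2 * K `^ q * (level t K i `^ q * Psi i).
have w0 i : 0 <= w i by rewrite mulr_ge0 ?powR_ge0 ?mass_ge0.
have wb i : w i.+1 <= w i / 2 + b i.
  have VP : packing_bound d mu (weight_large d mu v a (level t K i * c)) (Psi i).
    by apply: weight_packing => //; rewrite mulr_gt0.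
  have := good_lambda hX muX hD hG beta1 p01 p0beta s11 s1beta s1s s_gt1 C00
    l_lin key (L0 i) K1 eta0 Keta (mass_packing (L0 i)) VP.
  rewrite -levelS => /packing_mass_le; rewrite -/(mass _) => h.
  have KL : level t K i.+1 `^ q = K `^ q * level t K i `^ q.
    by rewrite levelS powRM ?(ltW K0) ?(ltW (L0 i)).
  have := ler_wpM2l (powR_ge0 (level t K i.+1) q) h; rewrite -/(w i.+1).
  move=> /le_trans; apply; rewrite KL mulrDr; apply: lerD; last first.
    rewrite /b (_ : _ * (_ * _) = D ^+ 2 * K `^ q * (level t K i `^ q * Psi i))//.
    by ring.
  have half (k L m : R) : 0 < k -> k * L * (D * (2 * D * k)^-1 * m) = L * m / 2.
    by move=> k0; field; rewrite !gt_eqF.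
  by rewrite /w /eta half// powR_gt0.
apply: (le_trans (absorb_sum n w0 wb)).
rewrite /mass_const ler_wpM2l//; apply: lerD.
  have M0 := packing_mass_le (large_packing (L0 0%N)).
  rewrite /w /level expr0 mulr1 in M0 *.
  apply: (@le_trans _ _ (t `^ q * (V0 / t) `^ a)); first by rewrite ler_wpM2l ?powR_ge0.
  apply: le_trans ht; rewrite powRM ?invr_ge0 ?(ltW t0)// mulrCA.
  rewrite -(powR_inv1 (ltW t0)) -powRrM mulN1r -powRD//.
  by apply/implyP => _; rewrite gt_eqF.
rewrite -mulr_sumr ler_wpM2l ?mulr_ge0 ?powR_ge0 ?exprn_ge0 ?(ltW D0)//.
have := tail_sum mv a1 vfin aq K1 Ka c0 n t0 v1.
rewrite mulr1 => /(ler_wpM2l (_ : 0 <= 2 * c `^ (- a))).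
rewrite mulr_ge0 ?powR_ge0// => /(_ isT); apply: le_trans.
rewrite mulr_sumr; apply: ler_sum => i _.
rewrite /Psi (powRM _ (ltW (L0 i)) (ltW c0)) (mulrC (level t K i) c).
have -> : level t K i `^ (q - a) = level t K i `^ q * level t K i `^ (- a).
  by rewrite -powRD//; apply/implyP => _; rewrite gt_eqF.
by rewrite le_eqVlt; apply/orP; left; apply/eqP; ring.
Qed.

Let l_cut_split w (E : set X) : w \in Lfun mu p0%:E -> measurable E ->
  l w = l (cut w E) + l (cut w (~` E)).
Proof.
move=> Lw mE; rewrite -(adjoint_add l_lin); last 2 first.
- exact: Lfun_cut.
- by apply: Lfun_cut => //; exact: measurableC.
congr l; apply/funext => x; have [Ex|Ex] := pselect (E x).
  by rewrite cut_in// cut_out ?addr0//; apply.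
by rewrite cut_out// cut_in ?add0r.
Qed.

Lemma bounded_Lp0 (E : set X) w tau : measurable E -> (mu E < +oo)%E ->
  measurable_fun setT w -> 0 < tau -> (forall x, `|w x| <= tau) ->
  (forall x, ~ E x -> w x = 0) -> w \in Lfun mu p0%:E.
Proof.
move=> mE fE mw tau0 wtau wE.
have : admissible mu beta E (fun x => tau^-1 * w x).
  apply: admissible_bounded => //.
  - by apply: measurable_funM => //; exact: measurable_cst.
  - move=> x; rewrite normrM ger0_norm ?invr_ge0 ?(ltW tau0)//.
    by rewrite ler_pdivrMl// mulr1.
  - by move=> x Ex; rewrite wE// mulr0.
move=> /(admissible_Lp0 beta1 p01 p0beta mE fE) /(Lfun_mull tau p0_ge1).
rewrite (_ : (fun _ => _) = w)//; apply/funext => x.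
by rewrite mulrA mulfV ?mul1r// gt_eqF.
Qed.

(** The part of [w] in the first ball of the covering is [tau] times a test
    function; the remainder vanishes there and is left to the other balls. *)
Lemma adjoint_cover (u : seq qball) (W : qball -> qball) (H : qball -> R) w tau :
  measurable_fun setT w -> 0 < tau -> (forall x, `|w x| <= tau) ->
  (forall x, ~ (\bigcup_(Q in [set` u]) bset (W Q)) x -> w x = 0) ->
  (forall Q g, Q \in u -> test (W Q) g -> l g <= H Q) ->
  l w <= tau * \sum_(Q <- u) H Q.
Proof.
move=> + tau0; elim: u w => [|Q u IH] w mw wtau wu hH.
  rewrite big_nil mulr0 (_ : w = (fun=> 0)) ?(adjoint0 p01 l_lin)//.
  by apply/funext => x; apply: wu => -[].
have mU : measurable (\bigcup_(Q in [set` Q :: u]) bset (W Q)).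
  by rewrite bigcup_seq; exact: bigsetU_measurable.
have fU : (mu (\bigcup_(Q in [set` Q :: u]) bset (W Q)) < +oo)%E.
  rewrite bigcup_seq -(big_map W xpredT bset) -bigcup_seq.
  exact: le_lt_trans (mu_bigcup_le hX _) (ltry _).
have Lw := bounded_Lp0 mU fU mw tau0 wtau wu.
have mC : measurable (~` bset (W Q)) by exact: measurableC.
rewrite big_cons mulrDr (l_cut_split Lw (mbset (W Q))); apply: lerD.
  have ct x : `|tau^-1 * cut w (bset (W Q)) x| <= 1.
    rewrite normrM ger0_norm ?invr_ge0 ?(ltW tau0)// ler_pdivrMl// mulr1.
    have [Ex|Ex] := pselect (bset (W Q) x); first by rewrite cut_in.
    by rewrite cut_out// normr0 ltW.
  have tt : test (W Q) (fun x => tau^-1 * cut w (bset (W Q)) x).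
    apply: admissible_bounded => //; first by rewrite (volE hX) ltry.
      by apply: measurable_funM => //; exact: measurable_cut.
    by move=> x Ex; rewrite cut_out// mulr0.
  have := hH Q _ (mem_head _ _) tt.
  by rewrite (adjoint_mull p01 l_lin) ?ler_pdivrMl//; exact: Lfun_cut.
apply: IH.
- exact: measurable_cut.
- move=> x; have [Ex|Ex] := pselect (bset (W Q) x).
    by rewrite cut_out ?normr0 ?ltW//; apply.
  by rewrite cut_in.
- move=> x xu; have [Ex|Ex] := pselect (bset (W Q) x); first by rewrite cut_out//; apply.
  rewrite cut_in// wu// => -[P /=]; rewrite inE => /predU1P[->//|Pu] Px.
  by apply: xu; exists P.
- by move=> P g Pu; apply: hH; rewrite inE Pu orbT.
Qed.

Let indic_large (lam : R) P : R := if `[< large lam P >] then 1 else 0.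

(** The pairing with [l] over one ball is controlled by the largest level at
    which the ball is large, and this level is one term of the sum. *)
Lemma test_levels t n N P g : 0 < t -> (n <= N)%N -> test P g ->
  ~ large (level t K N) P ->
  l g <= vol P * (level t K n + \sum_(n <= m < N) indic_large (level t K m) P * level t K m.+1).
Proof.
move=> t0 nN tg; have L0 i : 0 <= level t K i := ltW (level_gt0 i t0 K0).
have I0 m : 0 <= indic_large (level t K m) P * level t K m.+1.
  by rewrite mulr_ge0// /indic_large; case: ifP.
elim: N nN => [|N IH].
  rewrite leqn0 => /eqP ->; rewrite big_geq// addr0 mulrC => /not_large; exact.
rewrite leq_eqVlt => /predU1P[->|nN].
  by rewrite big_geq// addr0 mulrC => /not_large; exact.
move=> nL; have nN' : (n <= N)%N by [].
have [LN|LN] := pselect (large (level t K N) P); last first.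
  apply: (le_trans (IH nN' LN)); rewrite ler_wpM2l ?(vol_ge0 hX)//.
  by rewrite lerD2l big_nat_recr//= lerDl.
apply: (le_trans (not_large nL tg)); rewrite mulrC ler_wpM2l ?(vol_ge0 hX)//.
rewrite big_nat_recr//= {2}/indic_large asboolT// mul1r addrA lerDr addr_ge0//.
by apply: sumr_ge0.
Qed.

Lemma not_large_eventually t P : 0 < t ->
  exists N0, forall N, (N0 <= N)%N -> ~ large (level t K N) P.
Proof.
move=> t0; have P0 := vol_gt0 hX P.
pose A := V0 * vol P `^ p0^-1 / vol P / t.
have A0 : 0 <= A.
  by rewrite /A -!mulrA !mulr_ge0 ?powR_ge0 ?invr_ge0 ?(ltW P0) ?(ltW t0).
exists (Num.bound A) => N hN [g tg].
have fP : (mu (bset P) < +oo)%E by rewrite (volE hX) ltry.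
have hg : (pint mu p0 g <= (vol P)%:E)%E.
  by rewrite -(volE hX); exact: (admissible_pint beta1 (mbset P) (ltW p01) p0beta tg).
have lg := l_bounded (admissible_Lp0 beta1 p01 p0beta (mbset P) fP tg) (ltW P0) hg.
move=> /lt_le_trans /(_ lg); rewrite ltNge => /negP; apply.
have AK : A <= K ^+ N.
  apply: (le_trans (ltW (archi_boundP A0))).
  apply: (@le_trans _ _ (2 ^+ N)); last by rewrite lerXn2r ?nnegrE ?(ltW K0).
  by rewrite -natrX ler_nat (leq_trans hN)// ltnW// ltn_expl.
have := ler_wpM2l (ltW (mulr_gt0 t0 P0)) AK.
rewrite (_ : t * vol P * A = V0 * vol P `^ p0^-1); last first.
  by rewrite /A; field; rewrite !gt_eqF.
by rewrite /level mulrAC.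
Qed.

Lemma not_large_seq t (u : seq qball) (W : qball -> qball) : 0 < t ->
  exists N0, forall N, (N0 <= N)%N -> forall Q, Q \in u -> ~ large (level t K N) (W Q).
Proof.
move=> t0; elim: u => [|Q u [N1 h1]]; first by exists 0%N.
have [N2 h2] := not_large_eventually (W Q) t0.
exists (maxn N1 N2) => N; rewrite geq_max => /andP[hN1 hN2] P.
by rewrite inE => /predU1P[->|Pu]; [exact: h2|exact: h1].
Qed.

(** One level set of [f]: cover it by balls of about the same total volume, and
    sort these according to the largest level at which they are large. *)
Lemma adjoint_level t n f (E : set X) Q0 tau (eps : R) : 0 < t -> 0 < tau ->
  0 < eps -> measurable_fun setT f -> measurable E -> E `<=` bset Q0 ->
  (forall x, E x -> `|f x| <= tau) ->
  exists N0, forall N, (N0 <= N)%N ->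
  l (cut f E) <= tau * (D * (level t K n * fine (mu E)) +
    D ^+ 2 * \sum_(n <= m < N) level t K m.+1 * mass (level t K m)) + eps.
Proof.
move=> t0 tau0 eps0 mf mE EQ0 ftau; have L0 i : 0 < level t K i := level_gt0 i t0 K0.
pose W := dyadic e : qball -> qball.
(* what the covering misses and its excess volume each cost at most [eps / 2] *)
pose del1 := (eps / 2 / (V0 * tau + 1)) `^ p0.
pose del2 := eps / 2 / (tau * (D * level t K n) + 1).
pose del := Num.min del1 del2.
have V1 : 0 < V0 * tau + 1 by rewrite ltr_wpDl// mulr_ge0// ltW.
have T1 : 0 < tau * (D * level t K n) + 1 by apply: ltr_wpDl => //; apply: mulr_ge0; [exact: ltW|apply: mulr_ge0; exact: ltW].
have e2 : 0 < eps / 2 by rewrite divr_gt0.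
have del0 : 0 < del by rewrite lt_min powR_gt0 ?divr_gt0.
have le_del1 : del <= del1 by rewrite /del ge_min lexx.
have le_del2 : del <= del2 by rewrite /del ge_min lexx orbT.
have [u [du usum uleft]] := cover_measurable hX hD hG mE EQ0 del0.
have [N1 hN1] := not_large_seq u W t0.
exists (maxn N1 n) => N; rewrite geq_max => /andP[/hN1 nL nN].
have fE : (mu E < +oo)%E.
  have fQ0 : (mu (bset Q0) < +oo)%E by rewrite (volE hX) ltry.
  by apply: le_lt_trans fQ0; apply: le_measure; rewrite ?inE.
have muE : mu E = (fine (mu E))%:E by rewrite fineK// ge0_fin_numE.
have uvol : \sum_(Q <- u) vol Q <= fine (mu E) + del.
  by rewrite -lee_fin EFinD -muE.
pose U := \bigcup_(Q in [set` u]) bset (W Q).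
have mU : measurable U by rewrite /U bigcup_seq; exact: bigsetU_measurable.
have mcf := measurable_cut mf mE.
have cftau x : `|cut f E x| <= tau.
  have [Ex|Ex] := pselect (E x); first by rewrite cut_in// ftau.
  by rewrite cut_out// normr0 ltW.
have Lw : cut f E \in Lfun mu p0%:E.
  by apply: (bounded_Lp0 mE fE mcf tau0 cftau) => x; exact: cut_out.
rewrite (l_cut_split Lw mU).
have lU : l (cut (cut f E) U) <= tau * \sum_(Q <- u) vol (W Q) *
    (level t K n + \sum_(n <= m < N) indic_large (level t K m) (W Q) * level t K m.+1).
  apply: (@adjoint_cover u W) => //.
  - exact: measurable_cut.
  - move=> x; have [Ux|Ux] := pselect (U x); first by rewrite cut_in.
    by rewrite cut_out// normr0 ltW.
  - by move=> x; exact: cut_out.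
  - by move=> Q g Qu tg; apply: test_levels => //; exact: nL.
have lleft : l (cut (cut f E) (~` U)) <= eps / 2.
  have mEU : measurable (E `\` U) by exact: measurableD.
  have hp : (pint mu p0 (cut (cut f E) (~` U)) <= (tau `^ p0 * del)%:E)%E.
    have -> : cut (cut f E) (~` U) = cut f (E `\` U).
      apply/funext => x; have [Ex|Ex] := pselect (E x); last first.
        by rewrite [RHS]cut_out; [rewrite -[LHS]/(cut f E x * \1_(~` U) x) (cut_out f Ex) mul0r|case].
      have [Ux|Ux] := pselect (U x); first last.
        by rewrite !cut_in.
      have nEU : ~ (E `\` U) x by case.
      have nCU : ~ (~` U) x by apply.
      by rewrite (cut_out _ nEU) (cut_out _ nCU).
    rewrite pint_cut ?gt_eqF//.
    apply: (@le_trans _ _ (\int[mu]_(x in E `\` U) (tau `^ p0)%:E)%E).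
      apply: (ge0_le_integral mu mEU) => //.
      - by apply: measurable_funTS; exact: measurable_pow.
      by move=> x [Ex _]; rewrite lee_fin ge0_ler_powR ?nnegrE ?(ltW p00) ?(ltW tau0)// ftau.
    rewrite (integral_cst mu mEU) EFinM lee_wpmul2l ?lee_fin ?powR_ge0//.
    exact: ltW.
  have Lc : cut (cut f E) (~` U) \in Lfun mu p0%:E.
    by apply: Lfun_cut => //; exact: measurableC.
  have td0 : 0 <= tau `^ p0 * del by rewrite mulr_ge0 ?powR_ge0// ltW.
  apply: (le_trans (l_bounded Lc td0 hp)).
  rewrite powRM ?powR_ge0 ?(ltW del0)// -powRrM mulfV ?gt_eqF// powRr1 ?(ltW tau0)//.
  have : del `^ p0^-1 <= eps / 2 / (V0 * tau + 1).
    have B0 : 0 <= eps / 2 / (V0 * tau + 1) by rewrite ltW// divr_gt0.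
    have pV : p0 * p0^-1 = 1 by rewrite mulfV// gt_eqF.
    rewrite -[leRHS]powRr1// -[X in _ <= _ `^ X]pV powRrM.
    by apply: ge0_ler_powR; rewrite ?nnegrE ?powR_ge0 ?invr_ge0 ?(ltW p00) ?(ltW del0).
  move=> /(ler_wpM2l (mulr_ge0 V00 (ltW tau0))); rewrite mulrA => /le_trans; apply.
  rewrite mulrCA ler_piMr ?(ltW e2)// ler_pdivrMr// mul1r; lra.
have dist : \sum_(Q <- u) vol (W Q) *
    (level t K n + \sum_(n <= m < N) indic_large (level t K m) (W Q) * level t K m.+1)
    <= D * (level t K n * (fine (mu E) + del)) +
    D ^+ 2 * \sum_(n <= m < N) level t K m.+1 * mass (level t K m).
  under eq_bigr do rewrite mulrDr; rewrite big_split/=; apply: lerD.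
    apply: (@le_trans _ _ (\sum_(Q <- u) D * level t K n * vol Q)).
      apply: ler_sum => Q _; rewrite mulrAC ler_wpM2r ?(ltW (L0 n))//; exact: geo_vol.
    by rewrite -mulr_sumr -mulrA ler_pM2l// ler_wpM2l// ltW.
  under eq_bigr do rewrite mulr_sumr; rewrite exchange_big/= mulr_sumr.
  apply: ler_sum => m _.
  rewrite (_ : \sum_(Q <- u) _ = level t K m.+1 *
      \sum_(Q <- u | `[< large (level t K m) (W Q) >]) vol (W Q)); last first.
    rewrite mulr_sumr [RHS]big_mkcond; apply: eq_bigr => Q _.
    by rewrite /indic_large; case: ifP => _; rewrite ?mul1r ?mul0r ?mulr0// mulrC.
  rewrite mulrCA ler_wpM2l ?(ltW (L0 _))//.
  apply: (@le_trans _ _ (\sum_(Q <- u | `[< large (level t K m) (W Q) >]) D * vol Q)).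
    by apply: ler_sum => Q _; exact: geo_vol.
  rewrite -mulr_sumr expr2 -mulrA ler_pM2l// -big_filter.
  apply: (packing_bound_sub hX hD hG (W := W) (mass_packing (L0 m))).
  - by apply: subseq_pairwise du; exact: filter_subseq.
  - by move=> Q _; exact: sub_dyadicr.
  - by move=> Q; rewrite mem_filter => /andP[/asboolP].
have := lerD (le_trans lU (ler_wpM2l (ltW tau0) dist)) lleft.
move=> /le_trans; apply.
have : tau * (D * level t K n) * del <= eps / 2.
  apply: (@le_trans _ _ ((tau * (D * level t K n) + 1) * del)).
    by rewrite ler_wpM2r ?(ltW del0)// lerDl.
  by rewrite mulrC -ler_pdivlMr.
set S := \sum_(n <= m < N) _; set F := fine _; move=> h.
rewrite [eps in leRHS]splitr addrA lerD2r.
rewrite [leLHS](_ : _ = tau * (D * (level t K n * F) + D ^+ 2 * S) + tau * (D * level t K n) * del).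
  by rewrite lerD2l.
by ring.
Qed.

(** Heights of [f] are matched with levels of [l] as in the equality case of
    Young's inequality for [p] and [q]: the product of a height and its level,
    the [p]-th power of the height and the [q]-th power of the level agree. *)
Let height t i : R := level t K i `^ (q - 1).

Let height_gt0 t i : 0 < t -> 0 < height t i.
Proof. by move=> t0; rewrite powR_gt0// level_gt0. Qed.

Let height2 t i : 0 < t -> 2 * height t i <= height t i.+1.
Proof. by move=> t0; exact: level_powR. Qed.

Let height_le t i j : 0 < t -> (i <= j)%N -> height t i <= height t j.
Proof.
move=> t0; elim: j => [|j IH]; first by rewrite leqn0 => /eqP ->.
rewrite leq_eqVlt => /predU1P[->//|ij]; apply: (le_trans (IH ij)).
by have := height2 j t0; have := height_gt0 j t0; lra.
Qed.

Let heightS t i : 0 < t -> height t i.+1 = K `^ (q - 1) * height t i.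
Proof.
by move=> t0; rewrite /height levelS powRM ?(ltW K0)// ltW// level_gt0.
Qed.

Let height_level t i : 0 < t -> height t i * level t K i = level t K i `^ q.
Proof. by move=> t0; rewrite mulrC mulr_powRB1// ltW// level_gt0. Qed.

Let height_pow t i : level t K i `^ q = height t i `^ p.
Proof.
rewrite /height -powRrM; congr powR.
have : p * q * (p^-1 + q^-1) = p * q by rewrite pq mulr1.
rewrite mulrDr mulrAC mulfV ?gt_eqF// mul1r -mulrA mulfV ?gt_eqF// mulr1.
by lra.
Qed.

Let heights_sum t m M : 0 < t ->
  \sum_(n < M | (n <= m)%N) height t n <= 2 * height t m.
Proof.
move=> t0; have h0 i : 0 <= height t i := ltW (height_gt0 i t0).
elim: M => [|M IH]; first by rewrite big_ord0 mulr_ge0.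
rewrite big_mkcond big_ord_recr/= -big_mkcond/=; case: ifPn => Mm; last by rewrite addr0.
apply: (@le_trans _ _ (\sum_(n < M.+1) height t n)).
  rewrite big_ord_recr/= lerD2r big_mkcond/=; apply: ler_sum => i _.
  by case: ifP.
apply: (le_trans (doubling_sum h0 (fun n => height2 n t0) M)).
by rewrite ler_wpM2l// height_le.
Qed.

Let slab f Q0 t i j : set X :=
  [set x | height t i < `|f x| <= height t j] `&` bset Q0.

Let measurable_slab f Q0 t i j : measurable_fun setT f -> measurable (slab f Q0 t i j).
Proof.
move=> mf; apply: measurableI => //.
rewrite (_ : [set x | _] = setT `&` (fun x => `|f x|) @^-1` `]height t i, height t j]).
  by apply: measurableT_comp.
by apply/seteqP; split => x; rewrite /= in_itv//= => -[].
Qed.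

Let slabS f Q0 t M : 0 < t ->
  slab f Q0 t 0 M.+1 = slab f Q0 t 0 M `|` slab f Q0 t M M.+1.
Proof.
move=> t0; have h1 := height_le t0 (leq0n M); have h2 := height_le t0 (leqnSn M).
apply/seteqP; split => x; rewrite /slab/=.
  move=> [/andP[a1' a2'] Qx]; have [h|h] := leP `|f x| (height t M).
    by left; rewrite a1'.
  by right; rewrite a2'.
move=> [[/andP[a1' a2'] Qx]|[/andP[a1' a2'] Qx]]; split => //; apply/andP; split => //.
  exact: le_trans h2.
exact: le_lt_trans h1 a1'.
Qed.

Let slab_disj f Q0 t M : slab f Q0 t 0 M `&` slab f Q0 t M M.+1 = set0.
Proof.
rewrite -subset0 => x [[/andP[_ h] _] [/andP[h' _] _]].
by have := lt_le_trans h' h; rewrite ltxx.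
Qed.

Definition adjoint_const : R :=
  D * K `^ (q - 1) + D ^+ 2 * (2 * K `^ q * mass_const).

(** Below the matching level, a level set of [f] is charged to the integral of
    [|f| ^ p]. Above it, a given level of [l] meets heights that form a
    geometric sum, which leaves the [q]-th power of that level. *)
Let adjoint_slab f Q0 t M : 0 < t -> V0 `^ a * t `^ (q - a) <= 1 ->
  measurable_fun setT f -> (pint mu p f <= 1)%E ->
  l (cut f (slab f Q0 t 0 M)) <= adjoint_const.
Proof.
move=> t0 ht mf hf; apply/ler_addgt0Pr => eps eps0.
have L0 i : 0 < level t K i := level_gt0 i t0 K0.
have H0 i : 0 < height t i := height_gt0 i t0.
have mS i j : measurable (slab f Q0 t i j) by exact: measurable_slab.
have fS i j : (mu (slab f Q0 t i j) < +oo)%E.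
  apply: (@le_lt_trans _ _ (mu (bset Q0))); last by rewrite (volE hX) ltry.
  by apply: le_measure; rewrite ?inE//; exact: subIsetr.
have Sle i j x : slab f Q0 t i j x -> `|f x| <= height t j by move=> [/andP[]].
have LS i j : cut f (slab f Q0 t i j) \in Lfun mu p0%:E.
  apply: (bounded_Lp0 (mS i j) (fS i j) (measurable_cut mf (mS i j)) (H0 j)).
    move=> x; have [Sx|Sx] := pselect (slab f Q0 t i j x).
      by rewrite cut_in//; exact: Sle Sx.
    by rewrite cut_out// normr0 ltW.
  by move=> x; exact: cut_out.
pose J n : \bar R := (\int[mu]_(x in slab f Q0 t n n.+1) (`|f x| `^ p)%:E)%E.
pose e1 := eps / M.+1%:R.
have e10 : 0 < e1 by rewrite divr_gt0.
have /choice[N1 hN1] : forall n, exists N0, forall N, (N0 <= N)%N ->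
    l (cut f (slab f Q0 t n n.+1)) <= height t n.+1 *
      (D * (level t K n * fine (mu (slab f Q0 t n n.+1))) +
       D ^+ 2 * \sum_(n <= m < N) level t K m.+1 * mass (level t K m)) + e1.
  move=> n; apply: (@adjoint_level t n f (slab f Q0 t n n.+1) Q0 _ e1) => //.
  - exact: subIsetr.
  - by move=> x; exact: Sle.
pose N := \max_(n < M) N1 n.
have split_l : l (cut f (slab f Q0 t 0 M)) = \sum_(n < M) l (cut f (slab f Q0 t n n.+1)).
  elim: (M) => [|k IH].
    rewrite big_ord0 (_ : cut _ _ = (fun=> 0)) ?(adjoint0 p01 l_lin)//; apply/funext => x.
    by rewrite cut_out// => -[/andP[h1 h2] _]; have := lt_le_trans h1 h2; rewrite ltxx.
  rewrite big_ord_recr/= -IH -(adjoint_add l_lin)//.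
  congr l; apply/funext => x; rewrite slabS//.
  have [h1|h1] := pselect (slab f Q0 t 0 k x).
    have h2 : ~ slab f Q0 t k k.+1 x.
      by move=> h2; have : (slab f Q0 t 0 k `&` slab f Q0 t k k.+1) x by []; rewrite slab_disj.
    by rewrite (cut_out _ h2) addr0 !cut_in//; left.
  have [h2|h2] := pselect (slab f Q0 t k k.+1 x).
    by rewrite (cut_out _ h1) add0r !cut_in//; right.
  by rewrite !cut_out ?addr0//; case.
have sum_J : (\sum_(n < M) J n <= 1)%E.
  apply: (@le_trans _ _ (\int[mu]_(x in slab f Q0 t 0 M) (`|f x| `^ p)%:E)%E); last first.
    apply: le_trans hf; rewrite -(pint_cut mu f (lt0r_neq0 p0') (mS 0%N M)).
    exact: le_pint_cut (ltW p0') mf (mS 0%N M).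
  elim: (M) => [|k IH]; first by rewrite big_ord0 integral_ge0.
  rewrite big_ord_recr/= (slabS f Q0 k t0).
  have mpf : measurable_fun (slab f Q0 t 0 k `|` slab f Q0 t k k.+1)
      (fun x => (`|f x| `^ p)%:E).
    by apply: measurable_funTS; exact: measurable_pow.
  have pf0 x : (slab f Q0 t 0 k `|` slab f Q0 t k k.+1) x -> (0 <= (`|f x| `^ p)%:E)%E.
    by move=> _; rewrite lee_fin powR_ge0.
  have dj : [disjoint slab f Q0 t 0 k & slab f Q0 t k k.+1].
    by apply/disj_setPS; rewrite slab_disj.
  have -> := ge0_integral_setU mu (mS 0%N k) (mS k k.+1) mpf pf0 dj.
  exact: leeD IH (lexx _).
have hJ n : ((level t K n `^ q * fine (mu (slab f Q0 t n n.+1)))%:E <= J n)%E.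
  rewrite EFinM fineK ?ge0_fin_numE// -(integral_cst mu (mS n n.+1)).
  apply: (ge0_le_integral mu (mS n n.+1)) => //.
  - by move=> x _; rewrite lee_fin powR_ge0.
  - by apply: measurable_funTS; exact: measurable_pow.
  move=> x [/andP[h _] _]; rewrite lee_fin height_pow.
  by apply: ge0_ler_powR; rewrite ?nnegrE ?(ltW p0')// ltW.
have sum_mu : \sum_(n < M) level t K n `^ q * fine (mu (slab f Q0 t n n.+1)) <= 1.
  rewrite -lee_fin -sumEFin; apply: le_trans sum_J.
  by apply: lee_sum => n _; exact: hJ.
rewrite split_l; apply: (@le_trans _ _ (\sum_(n < M) (
    D * K `^ (q - 1) * (level t K n `^ q * fine (mu (slab f Q0 t n n.+1))) +
    D ^+ 2 * K `^ q * (\sum_(m < N | (n <= m)%N) height t n * (level t K m * mass (level t K m))) + e1))).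
  apply: ler_sum => n _.
  have nN : (N1 n <= N)%N by rewrite /N; exact: leq_bigmax.
  apply: (le_trans (hN1 n N nN)); rewrite lerD2r le_eqVlt; apply/orP; left; apply/eqP.
  rewrite mulrDr heightS//; congr (_ + _).
    by rewrite -height_level//; ring.
  rewrite (@big_nat_widenl _ _ _ n 0%N N)// big_mkord -(mulr_powRB1 (ltW K0) q0).
  rewrite mulrCA -[RHS]mulrA; congr (_ * _); rewrite !mulr_sumr; apply: eq_bigr => m _.
  by rewrite levelS; ring.
rewrite !big_split/= sumr_const card_ord; apply: lerD; last first.
  rewrite -mulr_natr /e1 mulrAC ler_pdivrMr// ler_wpM2l ?(ltW eps0)// ler_nat.
  exact: leqnSn.
apply: lerD.
  rewrite -mulr_sumr -[leRHS]mulr1 ler_wpM2l ?mulr_ge0 ?powR_ge0//.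
  exact: ltW.
rewrite -mulr_sumr -mulrA ler_wpM2l ?exprn_ge0 ?(ltW D0)//.
rewrite mulrAC [leRHS]mulrC ler_wpM2l ?powR_ge0//.
rewrite (exchange_big_dep xpredT)//=.
apply: (@le_trans _ _ (\sum_(m < N) 2 * (level t K m `^ q * mass (level t K m)))).
  apply: ler_sum => m _; rewrite -mulr_suml -height_level//.
  rewrite [leRHS](_ : _ = 2 * height t m * (level t K m * mass (level t K m))); last by ring.
  apply: (ler_wpM2r (mulr_ge0 (ltW (L0 m)) (mass_ge0 (L0 m)))).
  exact: heights_sum.
by rewrite -mulr_sumr ler_wpM2l//; exact: level_mass_sum.
Qed.

(** Truncations of [f] in height and in space exhaust it. *)
Lemma adjoint_le f : f \in Lfun mu p0%:E -> (pint mu p f <= 1)%E ->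
  (forall (A : (set X)^nat) (eps : R), (forall k, measurable (A k)) ->
     nondecreasing_seq A -> (forall x, f x != 0 -> exists k, A k x) -> 0 < eps ->
     exists k, forall j, (k <= j)%N -> l f <= l (cut f (A j)) + eps) ->
  l f <= adjoint_const.
Proof.
move=> Lf hf l_cvg; have mf := Lfun_measurable Lf.
have [x0 _] : [set: X] !=set0.
  by apply/set0P/eqP => h; have := muX; rewrite h measure0.
pose Q0 : qball := Ball x0 ltr01.
pose t k : R := (K ^+ k)^-1.
have t0 k : 0 < t k by rewrite invr_gt0 exprn_gt0.
pose G := K `^ (q - 1).
have G0 : 0 < G by rewrite powR_gt0.
have G1 : 1 <= G by apply: le_trans Kq; lra.
have powG k : (K ^+ k) `^ (q - 1) = G ^+ k.
  by rewrite -powR_mulrn ?(ltW K0)// -powRrM mulrC powRrM powR_mulrn ?powR_ge0.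
have hlow k : height (t k) 0 = G ^- k.
  rewrite /height /level expr0 mulr1 /t -(powG k) -powR_inv1 ?exprn_ge0 ?(ltW K0)//.
  by rewrite -powRrM mulN1r powRN.
have hhigh k : height (t k) (2 * k) = G ^+ k.
  rewrite /height /level /t mul2n -addnn exprD mulKf ?expf_neq0 ?gt_eqF//.
pose A k := slab f (dyadic k Q0) (t k) 0 (2 * k).
apply/ler_addgt0Pr => eps eps0.
have G_big (r : R) : exists k, r <= G ^+ k.
  exists (Num.bound `|r|); apply: (le_trans (ler_norm r)).
  apply: (le_trans (ltW (archi_boundP (normr_ge0 r)))).
  apply: (@le_trans _ _ (2 ^+ Num.bound `|r|)).
    by rewrite -natrX ler_nat ltnW// ltn_expl.
  by rewrite lerXn2r ?nnegrE ?(ltW G0).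
have ndA : nondecreasing_seq A.
  move=> i j ij; apply/subsetPset => x; rewrite /A/slab/= !hlow !hhigh => -[/andP[h1 h2] Qx].
  split; last exact: sub_dyadic Qx.
  have GG : G ^+ i <= G ^+ j by rewrite ler_weXn2l.
  rewrite (le_trans h2 GG) andbT; apply: le_lt_trans h1.
  by rewrite lef_pV2 ?posrE ?exprn_gt0.
have coverA x : f x != 0 -> exists k, A k x.
  move=> fx; have fx0 : 0 < `|f x| by rewrite normr_gt0.
  have [k1 h1] := G_big (`|f x|^-1 + 1); have [k2 h2] := G_big `|f x|.
  have [k3 h3] := dyadic_cover hX Q0 x.
  pose k := maxn k1 (maxn k2 k3); exists k; rewrite /A/slab/= hlow hhigh; split.
    have g1 : G ^+ k1 <= G ^+ k by rewrite ler_weXn2l// leq_maxl.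
    have g2 : G ^+ k2 <= G ^+ k by rewrite ler_weXn2l// leq_max leq_maxl orbT.
    rewrite (le_trans h2 g2) andbT invf_plt ?posrE ?exprn_gt0//.
    by apply: lt_le_trans (le_trans h1 g1); rewrite ltrDl.
  by apply: sub_dyadic h3; rewrite /k !leq_max leqnn !orbT.
have [k hk] := l_cvg A eps (fun k => measurable_slab _ _ _ _ mf) ndA coverA eps0.
have [k' hk'] : exists k', forall j, (k' <= j)%N -> V0 `^ a * t j `^ (q - a) <= 1.
  exists (Num.bound (V0 `^ a)) => j hj.
  have tE : t j `^ (q - a) = ((K `^ (q - a)) ^+ j)^-1.
    rewrite /t -powR_inv1 ?exprn_ge0 ?(ltW K0)// -powRrM mulN1r powRN; congr _^-1.
    by rewrite -powR_mulrn ?(ltW K0)// -powRrM mulrC powRrM powR_mulrn ?powR_ge0.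
  have Kj : 0 < (K `^ (q - a)) ^+ j by rewrite exprn_gt0// powR_gt0.
  rewrite tE ler_pdivrMr// mul1r.
  apply: (le_trans (ltW (archi_boundP (powR_ge0 _ _)))).
  apply: (@le_trans _ _ (2 ^+ j)).
    by rewrite -natrX ler_nat (leq_trans hj)// ltnW// ltn_expl.
  by rewrite lerXn2r ?nnegrE ?powR_ge0.
pose j := maxn k k'.
apply: (le_trans (hk j (leq_maxl _ _))); rewrite lerD2r.
by apply: adjoint_slab => //; apply: hk'; exact: leq_maxr.
Qed.

End adjoint_bound.
(** * Conclusion *)

Lemma Lavg_ge0 (R : realType) (dX : measure_display) (X : measurableType dX)
    (mu : {measure set X -> \bar R}) (r : \bar R) (E F : set X) (g : X -> R) :
  (0 <= Lavg mu r E F g)%E.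
Proof. by case: r => [r||]; rewrite /Lavg ?poweR_ge0 ?Lnorm_ge0. Qed.

(** The extremal weight is a power of [h], truncated so as to lie in every
    Lebesgue space. *)
Lemma converse_hoelder (R : realType) (dX : measure_display)
    (X : measurableType dX) (mu : {measure set X -> \bar R})
    (F : (set X)^nat) (h : X -> R) (a p q C : R) :
  (forall k, measurable (F k)) -> (forall k, mu (F k) < +oo)%E ->
  nondecreasing_seq F -> (forall x, exists k, F k x) ->
  0 < a -> 1 < p -> 0 < q -> p^-1 + q^-1 = 1 -> 0 <= C ->
  measurable_fun setT h ->
  (forall v : X -> R, measurable_fun setT v -> (pint mu a v < +oo)%E ->
    (pint mu q v <= 1)%E -> (\int[mu]_x (`|h x| * `|v x|)%:E <= C%:E)%E) ->
  (pint mu p h <= (C `^ p)%:E)%E.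
Proof.
move=> mF fF ndF coverF a0 p1 q0 pq C0 mh hv.
have p0 : 0 < p by exact: lt_trans p1.
pose A k := F k `&` [set x | `|h x| <= k%:R].
have mA k : measurable (A k).
  apply: measurableI => //.
  rewrite (_ : [set x | _] = setT `&` (fun x => `|h x|) @^-1` `]-oo, k%:R]).
    by apply: measurableT_comp.
  by apply/seteqP; split => x; rewrite /= in_itv//= => -[].
have fA k : (mu (A k) < +oo)%E.
  by apply: le_lt_trans (fF k); apply: le_measure; rewrite ?inE//; exact: subIsetl.
have mhp (r : R) : measurable_fun setT (fun x => `|h x| `^ r).
  apply: (@measurableT_comp _ _ _ _ _ _ (@powR R ^~ r)) => //.
  exact: measurableT_comp.
have pow_bound r k x : 0 <= r -> A k x -> `|h x| `^ r <= k%:R `^ r.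
  by move=> r0 [_ hx]; apply: ge0_ler_powR; rewrite ?nnegrE.
have int_fin (r : R) k : 0 <= r -> (\int[mu]_(x in A k) (`|h x| `^ r)%:E < +oo)%E.
  move=> r0; apply: (@le_lt_trans _ _ (\int[mu]_(x in A k) (k%:R `^ r)%:E)%E).
    apply: (ge0_le_integral mu (mA k)) => //.
    - by apply: measurable_funTS; exact/measurable_EFinP.
    - by move=> x Ax; rewrite lee_fin; exact: pow_bound.
  by rewrite (integral_cst mu (mA k)) lte_mul_pinfty ?lee_fin ?powR_ge0.
have pq1 : (p - 1) * q = p.
  have : p * q * (p^-1 + q^-1) = p * q by rewrite pq mulr1.
  rewrite mulrDr mulrAC mulfV ?gt_eqF// mul1r -mulrA mulfV ?gt_eqF// mulr1.
  by lra.
have p10 : 0 <= p - 1 by rewrite subr_ge0 ltW.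
have main k : (\int[mu]_(x in A k) (`|h x| `^ p)%:E <= (C `^ p)%:E)%E.
  set I := (\int[mu]_(x in A k) _)%E.
  have I0 : (0 <= I)%E by apply: integral_ge0 => x _; rewrite lee_fin powR_ge0.
  have If : I = (fine I)%:E by rewrite fineK// ge0_fin_numE//; apply: int_fin; exact: ltW.
  have [In0|Ip] := eqVneq (fine I) 0; first by rewrite If In0 lee_fin powR_ge0.
  have {}Ip : 0 < fine I by rewrite lt_neqAle eq_sym Ip/= -lee_fin -If.
  pose z := (fine I) `^ q^-1; have z0 : 0 < z by rewrite powR_gt0.
  have zV0 : 0 <= z^-1 by rewrite invr_ge0 ltW.
  pose v x := z^-1 * cut (fun y => `|h y| `^ (p - 1)) (A k) x.
  have mcut : measurable_fun setT (cut (fun y => `|h y| `^ (p - 1)) (A k)).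
    exact: measurable_cut.
  have mv : measurable_fun setT v by apply: measurable_funM => //; exact: measurable_cst.
  have pintv r : 0 < r -> pint mu r v =
      ((z^-1 `^ r)%:E * \int[mu]_(x in A k) (`|h x| `^ ((p - 1) * r))%:E)%E.
    move=> r0; rewrite (pint_mull mu r _ mcut) (ger0_norm zV0).
    rewrite (pint_cut mu _ (lt0r_neq0 r0) (mA k)); congr (_ * _)%E.
    by apply: eq_integral => x _; rewrite ger0_norm ?powR_ge0// -powRrM.
  have va : (pint mu a v < +oo)%E.
    rewrite pintv// lte_mul_pinfty ?lee_fin ?powR_ge0//.
    by apply: int_fin; rewrite mulr_ge0// ltW.
  have zq : z `^ q = fine I by rewrite /z -powRrM mulVf ?gt_eqF// powRr1 ?ltW.
  have vq : (pint mu q v <= 1)%E.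
    rewrite pintv// pq1 -/I If -EFinM lee_fin -zq -powRM ?invr_ge0 ?(ltW z0)//.
    by rewrite mulVf ?gt_eqF// powR1.
  have := hv v mv va vq.
  have -> : (\int[mu]_x (`|h x| * `|v x|)%:E = (z^-1)%:E * I)%E.
    have mhA : measurable_fun (A k) (fun x => (`|h x| `^ p)%:E).
      by apply: measurable_funTS; exact/measurable_EFinP.
    have hA0 x : A k x -> (0 <= (`|h x| `^ p)%:E)%E by move=> _; rewrite lee_fin powR_ge0.
    have zVe : (0 <= (z^-1)%:E)%E by rewrite lee_fin.
    rewrite /I -(ge0_integralZl mu (mA k) mhA hA0 zVe).
    rewrite [RHS]integral_mkcond; apply: eq_integral => x _; rewrite patchE /v.
    case: ifPn => [/set_mem Ax|/negP Ax].
      rewrite cut_in// normrM (ger0_norm (powR_ge0 _ _)) ger0_norm ?invr_ge0 ?(ltW z0)//.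
      by rewrite -EFinM mulrCA mulr_powRB1.
    by rewrite cut_out ?mulr0 ?normr0 ?mulr0// => /mem_set.
  rewrite If -EFinM lee_fin.
  have zp : z^-1 * fine I = fine I `^ p^-1.
    have -> : p^-1 = 1 - q^-1 by lra.
    rewrite powRD; last by rewrite subr_eq0; apply/implyP => _; rewrite gt_eqF.
    by rewrite powRr1 ?(ltW Ip)// powRN mulrC.
  rewrite zp => hC.
  have := @ge0_ler_powR R p (ltW p0) (fine I `^ p^-1) C; rewrite !nnegrE powR_ge0 C0.
  move=> /(_ isT isT hC); by rewrite -powRrM mulVf ?gt_eqF// powRr1 ?(ltW Ip).
have ndA : nondecreasing_seq A.
  move=> i j ij; apply/subsetPset => x [Fx hx]; split.
    by have /subsetPset := ndF _ _ ij; apply.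
  by apply: (le_trans hx); rewrite ler_nat.
have UA : \bigcup_k A k = [set: X].
  apply/seteqP; split => // x _; have [k Fx] := coverF x.
  pose j := maxn k (Num.bound `|h x|); exists j => //; split.
    by have /subsetPset := ndF _ _ (leq_maxl k (Num.bound `|h x|)); apply.
  apply: (le_trans (ltW (archi_boundP (normr_ge0 _)))).
  by rewrite ler_nat leq_maxr.
have cvgh := ge0_nondecreasing_set_cvg_integral ndA mA.
have {}cvgh : (\int[mu]_(x in A k) (`|h x| `^ p)%:E @[k --> \oo] --> pint mu p h)%E.
  rewrite /pint -UA; apply: cvgh.
  - by move=> k; apply: measurable_funTS; exact/measurable_EFinP.
  - by move=> k x _; rewrite lee_fin powR_ge0.
rewrite -(cvg_lim _ cvgh)//; apply: lime_le; first by apply/cvg_ex; eexists; exact: cvgh.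
exact: nearW.
Qed.

Lemma powRV_mul (R : realType) (x r : R) : 0 < x ->
  x^-1 `^ r * x = x `^ (1 - r).
Proof.
move=> x0; rewrite -(powR_inv1 (ltW x0)) -powRrM mulN1r addrC powRD ?powRr1 ?ltW//.
by apply/implyP => _; rewrite gt_eqF.
Qed.

(** The good-lambda inequality gains a power of [K] of exponent the conjugate of
    [s], and summation over the levels costs the power [q]. Since [s < p], the
    gain prevails for large [K]. *)
Lemma exists_ratio (R : realType) (D C0 s a p q : R) : 1 <= D -> 1 < s ->
  s < p -> a < q -> 1 < q -> p^-1 + q^-1 = 1 ->
  exists K : R, [/\ 2 <= K, 2 <= K `^ (q - a), 2 <= K `^ (q - 1) &
    2 * C0 * ((2 * D * K `^ q)^-1) `^ s^-1 <= K * (2 * D * K `^ q)^-1].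
Proof.
move=> D1 s1 sp aq q1 pq.
have s0 : 0 < s by exact: lt_trans s1.
have q0 : 0 < q by exact: lt_trans q1.
have D0 : 0 < 2 * D by rewrite mulr_gt0// (lt_le_trans ltr01).
pose th := 1 - q * (1 - s^-1).
have th0 : 0 < th.
  rewrite subr_gt0 -ltr_pdivlMl// mulr1.
  have : p^-1 < s^-1 by rewrite ltf_pV2 ?posrE// (lt_trans s0).
  by lra.
have qa0 : 0 < q - a by rewrite subr_gt0.
have q10 : 0 < q - 1 by rewrite subr_gt0.
have [K1 K11 h1] := exists_large_powR 2 qa0.
have [K2 K21 h2] := exists_large_powR 2 q10.
have [K3 K31 h3] := exists_large_powR (2 * C0 * (2 * D) `^ (1 - s^-1)) th0.
pose K := 2 + K1 + K2 + K3.
exists K; split; [by rewrite /K; lra|by apply: h1; rewrite /K; lra|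
  by apply: h2; rewrite /K; lra|].
have K0 : 0 < K by rewrite /K; lra.
have K3K : K3 <= K by rewrite /K; lra.
have := h3 K K3K; set E := 2 * D * K `^ q.
have E0 : 0 < E by rewrite mulr_gt0// powR_gt0.
move=> h; rewrite ler_pdivlMr// -(mulrA (2 * C0)).

rewrite powRV_mul//.
rewrite /E powRM ?powR_ge0 ?(ltW D0)// -powRrM mulrA.
apply: (@le_trans _ _ (K `^ th * K `^ (q * (1 - s^-1)))).
  by rewrite ler_wpM2r ?powR_ge0.
rewrite -powRD; last by apply/implyP => _; rewrite gt_eqF.
by rewrite subrK powRr1// ltW.
Qed.

Lemma sum_geometric_half (R : realType) k : \sum_(i < k) (2^-1 : R) ^+ i <= 2.
Proof.
suff : \sum_(i < k) (2^-1 : R) ^+ i + 2 * 2^-1 ^+ k <= 2.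
  have : 0 <= (2^-1 : R) ^+ k by rewrite exprn_ge0// invr_ge0.
  lra.
elim: k => [|k IH]; first by rewrite big_ord0 expr0; lra.
by rewrite big_ord_recr/= exprS; lra.
Qed.

Theorem theorem4p3 (R : realType) (dX : measure_display)
  (X : measurableType dX) (d : X -> X -> R)
  (mu : {measure set X -> \bar R})
  (hX : homogeneous_space d mu)
  (hmuX : mu [set: X] = +oo%E)
  (beta : \bar R) (hbeta : (1 < beta)%E)
  (B : ball_of R X -> (X -> R) -> X -> R)
  (hB : uniformly_bounded_family mu beta B)
  (sigma : \bar R) (p0 : R)
  (hsigma1 : (1 <= hoelder_conjugate sigma)%E)
  (hsigmap0 : (hoelder_conjugate sigma < p0%:E)%E)
  (hp0beta : (p0%:E <= beta)%E)
  (hH1 : H1ato_embeds_L1 d mu beta B)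
  (T : (X -> R) -> X -> R)
  (hTsub : sublinear_op mu p0%:E T)
  (hTbnd : exists C : R, bounded_by mu p0%:E C T)
  (gamma : nat -> R)
  (hgamma0 : forall j, 0 <= gamma j)
  (hgamma : (\sum_(0 <= j <oo) (gamma j)%:E < +oo)%E)
  (hTB : forall (Q : ball_of R X) (f : X -> R) (j : nat),
    f \in Lfun mu beta -> supported_in mu f (ball_set d Q) ->
    (Lavg mu p0%:E (corona d j Q) (dilate d (2 ^+ j.+1) Q) (T (B Q f)) <=
     (gamma j)%:E * (mu (ball_set d Q) / mu (dilate d (2 ^+ j) Q)) *
     Lavg mu beta (ball_set d Q) (ball_set d Q) f)%E)
  (hIB : forall (Q : ball_of R X) (f : X -> R) (j : nat),
    f \in Lfun mu beta -> supported_in mu f (ball_set d Q) ->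
    (Lavg mu beta (corona d j Q) (dilate d (2 ^+ j.+1) Q)
       (fun x => (f x - B Q f x)%R) <=
     (gamma j)%:E * (mu (ball_set d Q) / mu (dilate d (2 ^+ j) Q)) *
     Lavg mu (hoelder_conjugate sigma) (ball_set d Q) (ball_set d Q) f)%E) :
  forall p : R, (hoelder_conjugate sigma < p%:E)%E -> p < p0 ->
  exists C : R, forall f : X -> R,
    f \in Lfun mu p0%:E -> f \in Lfun mu p%:E ->
    ('N[mu]_(p%:E) [EFin \o T f] <= C%:E * 'N[mu]_(p%:E) [EFin \o f])%E.
Proof.
move=> p sp pp0.
(* [s1] is the exponent of the second hypothesis on the operators [B] *)
have [s1 s1E] : exists s1 : R, hoelder_conjugate sigma = s1%:E.
  move: hsigma1 hsigmap0; case: (hoelder_conjugate sigma) => [r _ _|//|//].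
  by exists r.
rewrite s1E lte_fin in sp; rewrite s1E lee_fin in hsigma1; rewrite s1E in hIB.
(* an exponent above 1 even if [s1 = 1], still below [p] *)
pose s := (s1 + p) / 2.
have s1s : s1 <= s by rewrite /s; lra.
have s_gt1 : 1 < s by rewrite /s; lra.
have s_lt : s < p by rewrite /s; lra.
have p1 : 1 < p by exact: lt_trans s_lt.
have p01 : 1 < p0 by exact: lt_trans pp0.
have p_gt0 : 0 < p by exact: lt_trans p1.
have p0_gt0 : 0 < p0 by exact: lt_trans p01.
pose conj (r : R) := (1 - r^-1)^-1.
have conjE r : 1 < r -> r^-1 + (conj r)^-1 = 1 by rewrite /conj invrK; lra.
have conj_gt1 r : 1 < r -> 1 < conj r.
  move=> r1; have r0 : 0 < r by exact: lt_trans r1.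
  have rV : 0 < r^-1 by rewrite invr_gt0.
  have rV1 : r^-1 < 1 by rewrite invf_lt1.
  by rewrite /conj invf_gt1; lra.
pose a := conj p0; pose q := conj p.
have aq : a < q.
  have h : p0^-1 < p^-1 by rewrite ltf_pV2 ?posrE.
  have h' : p^-1 < 1 by rewrite invf_lt1.
  by rewrite /a /q /conj ltf_pV2 ?posrE; lra.
have [a1 q1] : 1 < a /\ 1 < q by split; exact: conj_gt1.
have a0 : 0 < a by exact: lt_trans a1.
have q0 : 0 < q by exact: lt_trans q1.
have pa : p0^-1 + a^-1 = 1 by exact: conjE.
have pq : p^-1 + q^-1 = 1 by exact: conjE.
have s1beta : (s1%:E <= beta)%E.
  by apply: le_trans hp0beta; rewrite lee_fin ltW// (lt_trans sp).
(* Adding a summable positive sequence makes the coefficients positive, so that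
   the pieces on the coronas can be normalized by division. *)
pose gam j := gamma j + 2^-1 ^+ j.
pose G0 := fine (\sum_(0 <= j <oo) (gamma j)%:E)%E.
pose Gam := G0 + 2.
have half_gt0 j : 0 < (2^-1 : R) ^+ j by rewrite exprn_gt0// invr_gt0.
have gam0 j : 0 < gam j by rewrite ltr_wpDl.
have gamS k : \sum_(i < k) gam i <= Gam.
  rewrite big_split/=; apply: lerD; last exact: sum_geometric_half.
  rewrite -lee_fin -sumEFin /G0 fineK; last first.
    by rewrite ge0_fin_numE//; apply: nneseries_ge0 => n _ _; rewrite lee_fin.
  rewrite -(big_mkord xpredT (fun i => (gamma i)%:E)).
  by apply: nneseries_lim_ge => n _ _; rewrite lee_fin.
have gam_le (Q : ball_of R X) (L : \bar R) j : (0 <= L)%E ->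
    ((gamma j)%:E * (mu (ball_set d Q) / mu (dilate d (2 ^+ j) Q)) * L <=
     (gam j)%:E * (mu (ball_set d Q) / mu (dilate d (2 ^+ j) Q)) * L)%E.
  move=> L0; rewrite lee_wpmul2r// lee_wpmul2r ?mule_ge0 ?inve_ge0//.
  by rewrite lee_fin lerDl ltW.
have hTB' Q f j := fun Lf sf => le_trans (hTB Q f j Lf sf) (gam_le Q _ j (Lavg_ge0 _ _ _ _ _)).
have hIB' Q f j := fun Lf sf => le_trans (hIB Q f j Lf sf) (gam_le Q _ j (Lavg_ge0 _ _ _ _ _)).
have [e [D [hD hG]]] := exists_geometry hX.
have D0 : 0 <= D by exact: le_trans hD.
have Gam0 : 0 <= Gam by apply: le_trans (gamS 0%N); rewrite big_ord0.
pose C0 := D * Gam.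
have C00 : 0 <= C0 by exact: mulr_ge0.
have [K [K2 Ka Kq Keta]] := exists_ratio C0 hD s_gt1 s_lt aq q1 pq.
pose C := Num.max (adjoint_const D s a q K) 0.
have C_ge0 : 0 <= C by rewrite le_max lexx orbT.
have weighted f (v : X -> R) : f \in Lfun mu p0%:E -> (pint mu p f <= 1)%E ->
    measurable_fun setT v -> (pint mu a v < +oo)%E -> (pint mu q v <= 1)%E ->
    (wint mu T v f <= C%:E)%E.
  move=> Lf hf mv va vq.
  have [l [l_lin l_le lf]] := exists_adjoint p01 hTbnd mv a0 pa va hTsub Lf.
  have [V0 V00 l_bounded] := adjoint_bounded p01 hTbnd mv a0 pa va l_le.
  have key P g lam kap rho := @adjoint_test _ _ _ _ _ hX hmuX _ _ hD hG _ _ hbeta hB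
    _ _ _ p01 hp0beta hsigma1 s1beta _ _ gam0 gamS hTbnd hTB' hIB' _ _ mv a0 pa va
    _ l_lin l_le P g lam kap rho.
  rewrite -lf lee_fin le_max; apply/orP; left.
  apply: (adjoint_le hX hmuX hD hG hbeta p01 hp0beta hsigma1 s1beta s1s s_gt1
    (ltW a1) pa p_gt0 pq aq C00 K2 Ka Kq Keta mv va vq l_lin V00 l_bounded key Lf hf).
  move=> A eps mA ndA coverA eps0.
  exact: (adjoint_cut_cvg hmuX p01 hTbnd mv a0 pa va l_lin l_le Lf mA ndA coverA eps0).
have [_ hmul] := hTsub; have [CT hCT] := hTbnd.
have [x0 _] : [set: X] !=set0.
  by apply/set0P/eqP => h; have := hmuX; rewrite h measure0.
pose Q0 : ball_of R X := Ball x0 ltr01.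
exists C => f Lf0 Lf.
have mf := Lfun_measurable Lf; have fp := Lfun_pint p_gt0 Lf.
have mTf := Lfun_measurable (hCT f Lf0).1.
(* [eta] is a positive bound for the norm of [f], which itself may vanish *)
have scaled (eta : R) : 0 < eta -> (pint mu p f <= (eta `^ p)%:E)%E ->
    ('N[mu]_(p%:E) [EFin \o T f] <= (C * eta)%:E)%E.
  move=> eta0 hf; have etaV : 0 < eta^-1 by rewrite invr_gt0.
  pose g x := eta^-1 * f x.
  have Lg : g \in Lfun mu p0%:E by apply: Lfun_mull => //; rewrite lee_fin ltW.
  have hg : (pint mu p g <= 1)%E.
    rewrite (pint_mull mu p _ mf) (gtr0_norm etaV).
    apply: (@le_trans _ _ ((eta^-1 `^ p)%:E * (eta `^ p)%:E)%E).
      by rewrite lee_wpmul2l// lee_fin powR_ge0.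
    by rewrite -EFinM -powRM ?(ltW eta0) ?(ltW etaV)// mulVf ?gt_eqF// powR1.
  have hTg : \forall x \ae mu, `|T g x| = eta^-1 * `|T f x|.
    by apply: filterS (hmul eta^-1 f Lf0) => x; rewrite (gtr0_norm etaV).
  have h : (pint mu p (fun x => (eta^-1 * T f x)%R) <= (C `^ p)%:E)%E.
    apply: (@converse_hoelder _ _ _ mu (fun k => ball_set d (dyadic k Q0)) _ a p q) => //.
    - by move=> k; exact: measurable_bset hX _.
    - by move=> k; rewrite (volE hX) ltry.
    - by move=> i j ij; apply/subsetPset; exact: sub_dyadic.
    - by move=> x; exact: dyadic_cover hX Q0 x.
    - by apply: measurable_funM => //; exact: measurable_cst.
    move=> v mv va vq; apply: le_trans (weighted g v Lg hg mv va vq).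
    have mT (u : X -> R) : measurable_fun setT u ->
        measurable_fun setT (fun x => (`|u x| * `|v x|)%:E).
      by move=> mu_; apply/measurable_EFinP; apply: measurable_funM; exact: measurableT_comp.
    have T0 (u : X -> R) x : [set: X] x -> (0 <= (`|u x| * `|v x|)%:E)%E.
      by move=> _; rewrite lee_fin mulr_ge0.
    have mTf' : measurable_fun setT (fun x => eta^-1 * T f x).
      by apply: measurable_funM => //; exact: measurable_cst.
    apply: (ae_ge0_le_integral measurableT (T0 _) (mT _ mTf') (T0 _)).
      exact: mT _ (Lfun_measurable (hCT g Lg).1).
    apply: filterS hTg => x hx _.
    by rewrite lee_fin hx normrM (gtr0_norm etaV).
  have hT := pint_unscale mTf eta0 h.
  rewrite Lnorm_pint; have pV0 : 0 <= p^-1 by rewrite invr_ge0 ltW.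
  apply: (le_trans (le_poweR pV0 (pint_ge0 _ _ _) hT)).
  rewrite -powRM ?(ltW eta0)// poweR_EFin -powRrM mulfV ?gt_eqF// powRr1.
    by rewrite mulrC.
  by rewrite mulr_ge0// ltW.
pose n := (fine (pint mu p f)) `^ p^-1.
have fpE : pint mu p f = (fine (pint mu p f))%:E.
  by rewrite fineK// ge0_fin_numE// pint_ge0.
have n0 : 0 <= n by exact: powR_ge0.
have nE : ('N[mu]_(p%:E) [EFin \o f] = n%:E)%E by rewrite Lnorm_pint fpE poweR_EFin.
have np : n `^ p = fine (pint mu p f).
  by rewrite /n -powRrM mulVf ?gt_eqF// powRr1// fine_ge0// pint_ge0.
rewrite nE -EFinM; apply/lee_addgt0Pr => eps eps0.
pose del := eps / (C + 1).
have C1 : 0 < C + 1 by lra.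
have del0 : 0 < del by rewrite divr_gt0.
apply: (le_trans (scaled (n + del) _ _)); first by lra.
  rewrite fpE -np lee_fin; apply: ge0_ler_powR; rewrite ?nnegrE; lra.
rewrite -EFinD lee_fin mulrDr lerD2l /del mulrCA ler_piMr ?(ltW eps0)//.
by rewrite ler_pdivrMr// mul1r; lra.
Qed.
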